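(* Let $1<q\le\infty$. Let $\Omega$ be an ellipsoid $\Omega=\{z\in\mathbb C^n: \sum_{j=1}^n|z_j|^2/a_j^2<1\}$ with $a_1,\dots,a_n>0$ (in particular the unit ball of $\mathbb C^n$). Then the set $$\Big\{g\in\bigcap_{p<q}\mathcal{O}L^p(\Omega): g\text{ totally unbounded in }\Omega,\ g\notin\mathcal{O}L^q(B(\zeta,\varepsilon)\cap\Omega)\ \forall\zeta\in\partial\Omega,\ \forall\varepsilon>0\Big\}$$ is dense and $G_\delta$ in $\bigcap_{p<q}\mathcal{O}L^p(\Omega)$.
   Context: For an open bounded set $D$ and $p\ge1$, $\mathcal{O}L^p(D)$ is the space of holomorphic $f$ on $D$ with $\int_D|f|^p\,dv<\infty$; $\mathcal{O}L^\infty(D)$ is the space of bounded holomorphic functions. For $1<q\le\infty$, $\bigcap_{p<q}\mathcal{O}L^p(\Omega)$ carries the complete metric $d(f,g)=\sum_j2^{-j}\frac{\|f-g\|_{p_j}}{1+\|f-g\|_{p_j}}$ with $1<p_1<p_2<\dots$, $p_j\to q$; convergence means $\|f_k-f\|_p\to0$ for all $p<q$. A holomorphic $f$ is totally unbounded in $\Omega$ if for every $w\in\partial\Omega$, $\delta>0$ and every connected component $E$ of $B(w,\delta)\cap\Omega$, $\sup_E|f|=\infty$. *)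

(* Defs.v *)
From HB Require Import structures.
From mathcomp Require Import all_boot all_order all_algebra.
From mathcomp Require Import all_classical all_reals all_analysis.
From mathcomp Require Import complex.
Import Order.TTheory GRing.Theory Num.Theory.
Import numFieldNormedType.Exports.

Set Implicit Arguments.
Unset Strict Implicit.
Unset Printing Implicit Defensive.

Local Open Scope classical_set_scope.
Local Open Scope ring_scope.

Section Defs.
Variable R : realType.
Local Notation C := (R[i]).

Definition cabs2 (z : C) : R := complex.Re z ^+ 2 + complex.Im z ^+ 2.
Definition cabs (z : C) : R := Num.sqrt (cabs2 z).

Variable n : nat.
(* C^n is 'rV[C]_n, a normed C-vector space (product = Euclidean topology). *)
Local Notation Cn := 'rV[C]_n.

(* holomorphic on (an open set) D: complex (Frechet) differentiable, i.e.
   with a C-linear differential, at every point of D *)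
Definition holomorphic_on (D : set Cn) (f : Cn -> C^o) : Prop :=
  forall z : (Cn : normedModType C), D z -> differentiable f z.

Definition upd (z : Cn) (k : nat) (w : C) : Cn :=
  \row_j (if (j : nat) == k then w else z 0 j).

(* iterated Lebesgue integral over the real and imaginary parts of the
   coordinates k-1, ..., 0 (outermost first); by Tonelli this is the
   integral w.r.t. Lebesgue measure dv on C^n = R^(2n) for nonnegative
   measurable integrands *)
Fixpoint iter_int (k : nat) (G : Cn -> \bar R) (z : Cn) : \bar R :=
  match k with
  | 0 => G z
  | k'.+1 => (\int[lebesgue_measure]_(x in setT)
               \int[lebesgue_measure]_(y in setT)
                 iter_int k' G (upd z k' (x +i* y)%C))%E
  end.

Definition volint (G : Cn -> \bar R) : \bar R := iter_int n G 0.

Definition Lp_int (D : set Cn) (p : R) (f : Cn -> C^o) : \bar R :=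
  volint (fun z => (\1_D z * powR (cabs (f z)) p)%:E).

Definition OL (q : \bar R) (D : set Cn) (f : Cn -> C^o) : Prop :=
  holomorphic_on D f /\
  match q with
  | EFin p => (Lp_int D p f < +oo)%E
  | +oo%E => exists M : R, forall z, D z -> cabs (f z) <= M
  | -oo%E => False
  end.

Definition OLcap (q : \bar R) (D : set Cn) : set (Cn -> C^o) :=
  [set f | forall p : R, 1 <= p -> (p%:E < q)%E -> OL p%:E D f].

Definition pnorm (D : set Cn) (p : R) (f : Cn -> C^o) : R :=
  powR (fine (Lp_int D p f)) p^-1.

Definition dist (D : set Cn) (pj : nat -> R) (f g : Cn -> C^o) : R :=
  limn (series (fun j : nat =>
    (2 ^- j.+1) * (pnorm D (pj j) (fun z => f z - g z) /
                   (1 + pnorm D (pj j) (fun z => f z - g z))))).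

Definition eball (w : Cn) (delta : R) : set Cn :=
  [set z | \sum_(j < n) cabs2 (z 0 j - w 0 j) < delta ^+ 2].

Definition bdry (D : set Cn) : set Cn := @closure (Cn : normedModType C) D `\` @interior (Cn : normedModType C) D.

Definition ellipsoid (a : 'I_n -> R) : set Cn :=
  [set z | \sum_(j < n) cabs2 (z 0 j) / a j ^+ 2 < 1].

Definition totally_unbounded (D : set Cn) (f : Cn -> C^o) : Prop :=
  forall w delta, bdry D w -> 0 < delta ->
  forall x, (eball w delta `&` D) x ->
  forall M : R, exists z,
    @connected_component (Cn : normedModType C) (eball w delta `&` D) x z /\ M < cabs (f z).

End Defs.

Definition rel_open (T : Type) (R : realType) (d : T -> T -> R)
  (X U : set T) : Prop :=
  U `<=` X /\
  forall f, U f -> exists2 e : R, 0 < e & forall g, X g -> d f g < e -> U g.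

Definition dense_in (T : Type) (R : realType) (d : T -> T -> R)
  (X S : set T) : Prop :=
  S `<=` X /\
  forall f, X f -> forall e : R, 0 < e -> exists g, S g /\ d f g < e.

Definition Gdelta_in (T : Type) (R : realType) (d : T -> T -> R)
  (X S : set T) : Prop :=
  exists U : nat -> set T,
    (forall k, rel_open d X (U k)) /\ S = \bigcap_k U k.

(* Main.v *)
(** A function of the intersection lies in the set of the theorem iff it fails to be in OL^q on
    each of countably many sets "small ball meeting the boundary, intersected with the
    ellipsoid"; these intersections are convex, so total unboundedness follows (a bounded
    function on such a set is in OL^q).

    G-delta: on an open set D, failing to be in OL^q means that the integrals over D of
    bounded Lipschitz truncations of |f| are unbounded (for q infinite: that certain such
    integrals are positive), and these integrals depend continuously on f.

    Density: if h belongs to the set and f is arbitrary, then for each of the countably many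
    test sets f + c h can be in OL^q for at most one c, so some arbitrarily small c works.

    To build one h, take a boundary point w and u(z) = 1 - <z, w>, which has positive real part
    in the ellipsoid. The humps b / (b + u) have positive real part, and by dilation about w
    the integral of |b / (b + u)|^r is comparable with the volume of the cap {|u| < K b} as soon
    as r >= 2n + 2. Hence suitable multiples have large L^(mq) norm near w while their L^(mp)
    norms are small for p < q, where m = 2n + 2. Let H be a sum of such humps over all test
    sets; positivity of the real parts prevents cancellation, and h = H^m. *)
Require Import Defs.
From HB Require Import structures.
From mathcomp Require Import all_boot all_order all_algebra.
From mathcomp Require Import all_classical all_reals all_analysis.
From mathcomp Require Import measurable_realfun.
From mathcomp Require Import complex.
From mathcomp Require Import ring lra.
Import Order.TTheory GRing.Theory Num.Theory.
Import numFieldNormedType.Exports.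
Local Open Scope classical_set_scope.
Local Open Scope ring_scope.

Set Implicit Arguments.
Unset Strict Implicit.
Unset Printing Implicit Defensive.


(** * Modulus and topology *)

Section Complex_modulus.
Variable R : realType.
Local Notation C := (R[i]).
Implicit Types z w : C.

(** Two obstacles shape the proof. First, [volint] is an iterated integral: monotone convergence,
    dilation and box volumes are proved by induction on the number of integrated coordinates, and
    norm estimates rest on pointwise inequalities instead of Hoelder or Minkowski. Second, the order
    of sum and power matters. A single hump decays too slowly for its integral to be comparable with
    the cap volume at exponents near 1, while the [m]-th power of a hump need not have positive real
    part. So first powers are summed, where positivity is available, and the power [m] is taken at
    the end, which turns every exponent [p >= 1] into [m p >= 2 n + 2]. No hump integral is
    computed: the parameters [b] and [2 b] are compared, and Bernoulli's inequality controls the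
    loss. Density uses neither completeness nor Baire's theorem, only that the tests are countable
    and an interval is not. Holomorphy of [H] needs no Cauchy formula, since the remainders of the
    quotients with affine denominator are explicit. *)

Lemma cabsE z : cabs z = Normc.normc z.
Proof. by case: z. Qed.

Lemma normcE z : `|z| = (cabs z)%:C%C.
Proof. by case: z. Qed.

Lemma cabs_ge0 z : 0 <= cabs z.
Proof. exact: sqrtr_ge0. Qed.

Lemma sqr_cabs z : cabs z ^+ 2 = cabs2 z.
Proof. by rewrite sqr_sqrtr// addr_ge0// sqr_ge0. Qed.

Lemma cabsD z w : cabs (z + w) <= cabs z + cabs w.
Proof. rewrite !cabsE; exact: le_normcD. Qed.

Lemma cabsN z : cabs (- z) = cabs z.
Proof. by case: z => x y; rewrite /cabs /cabs2 /= !sqrrN. Qed.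

Lemma cabsM z w : cabs (z * w) = cabs z * cabs w.
Proof. by rewrite !cabsE Normc.normcM. Qed.

End Complex_modulus.

Section Topology_of_Cn.
Variables (R : realType) (n : nat).
Local Notation C := (R[i]).
Local Notation Cn := 'rV[C]_n.

Lemma nbhs_CP (z : C) (A : set C) :
  nbhs (z : C^o) A <->
  exists2 e : R, 0 < e & forall w : C, cabs (w - z) < e -> A w.
Proof.
split=> [/nbhs_ballP [e e0 eA]|[e e0 eA]].
  (* In the order of [R[i]], a positive element has zero imaginary part, so the radius is a real
     number. *)
  have [r er] : exists r : R, e = r%:C%C.
    exists (complex.Re e); move: e e0 {eA} => [x y] /=.
    by rewrite ltcE /= => /andP[/eqP -> _].
  move: e0 eA; rewrite er /= ltcR => r0 rA.
  exists r => // w wr; apply: rA; rewrite -ball_normE /ball_/= normcE ltcR.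
  by rewrite -opprB cabsN.
apply/nbhs_ballP; exists (e%:C)%C; first by rewrite /= ltcR.
move=> w; rewrite -ball_normE /ball_/= normcE ltcR => we; apply: eA.
by rewrite -opprB cabsN.
Qed.

Lemma nbhs_CnP (z : Cn) (A : set Cn) :
  nbhs (z : (Cn : normedModType C)) A <->
  exists2 e : R, 0 < e & forall w : Cn, (forall j, cabs (w 0 j - z 0 j) < e) -> A w.
Proof.
split=> [/nbhs_ballP [e e0 eA]|[e e0 eA]].
  have [r er] : exists r : R, e = r%:C%C.
    exists (complex.Re e); move: e e0 {eA} => [x y] /=.
    by rewrite ltcE /= => /andP[/eqP -> _].
  move: e0 eA; rewrite er /= ltcR => r0 rA.
  exists r => // w wr; apply: rA; split; first by rewrite ltcR.
  move=> i j; rewrite (ord1 i) -ball_normE /ball_/= normcE ltcR.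
  by rewrite -opprB cabsN.
apply/nbhs_ballP; exists (e%:C)%C; first by rewrite /= ltcR.
move=> w [_ we]; apply: eA => j.
have := we 0 j; rewrite -ball_normE /ball_/= normcE ltcR.
by rewrite -opprB cabsN.
Qed.

Lemma differentiable_cabs_cts (f : Cn -> C^o) (z : Cn) :
  differentiable f (z : (Cn : normedModType C)) -> forall e : R, 0 < e ->
  exists2 d : R, 0 < d & forall w : Cn, (forall j, cabs (w 0 j - z 0 j) < d) ->
    cabs (f w - f z) < e.
Proof.
move=> /differentiable_continuous fz e e0.
have /fz/nbhs_CnP [d d0 dP] : nbhs (f z : C^o) [set w | cabs (w - f z) < e].
  by apply/nbhs_CP; exists e.
by exists d.
Qed.

End Topology_of_Cn.

(** * Iterated integrals *)

Section Iterated_integral.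
Variables (R : realType) (n : nat).
Local Notation C := (R[i]).
Local Notation Cn := 'rV[C]_n.
Local Notation mu := (@lebesgue_measure R).

(* [Cn] carries no sigma-algebra: measurability is tested along every map from a
   measurable space with measurable real coordinates. Quantifying over all source
   spaces lets Fubini-Tonelli propagate it through each stage of [iter_int]. *)
Definition jmeasurable (G : Cn -> \bar R) : Prop :=
  forall d (T : measurableType d) (Phi : T -> Cn),
    (forall j, measurable_fun [set: T] (fun t => complex.Re (Phi t 0 j))) ->
    (forall j, measurable_fun [set: T] (fun t => complex.Im (Phi t 0 j))) ->
    measurable_fun [set: T] (fun t => G (Phi t)).

Lemma Re_upd (z : Cn) k (x y : R) (j : 'I_n) :
  complex.Re (upd z k (x +i* y)%C 0 j) = if (j : nat) == k then x else complex.Re (z 0 j).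
Proof. by rewrite mxE; case: ifP. Qed.

Lemma Im_upd (z : Cn) k (x y : R) (j : 'I_n) :
  complex.Im (upd z k (x +i* y)%C 0 j) = if (j : nat) == k then y else complex.Im (z 0 j).
Proof. by rewrite mxE; case: ifP. Qed.

Lemma iter_int_ge0 k (G : Cn -> \bar R) z :
  (forall z, (0 <= G z)%E) -> (0 <= iter_int k G z)%E.
Proof.
move=> G0; elim: k z => [|k IH] z //=.
by apply: integral_ge0 => x _; apply: integral_ge0 => y _.
Qed.

Lemma jmeasurable_iter_int k (G : Cn -> \bar R) :
  (forall z, (0 <= G z)%E) -> jmeasurable G -> jmeasurable (iter_int k G).
Proof.
move=> G0 mG; elim: k => [//|k IH] d T Phi mRe mIm /=.
pose F2 (p : (T * R) * R) := iter_int k G (upd (Phi p.1.1) k (p.1.2 +i* p.2)%C).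
have mF2 : measurable_fun setT F2.
  apply: (IH _ _ (fun p : (T * R) * R => upd (Phi p.1.1) k (p.1.2 +i* p.2)%C)) => j.
  - case jk : ((j : nat) == k); under eq_fun do rewrite Re_upd jk.
      exact: (measurableT_comp measurable_snd measurable_fst).
    exact: (measurableT_comp (measurableT_comp (mRe j) measurable_fst) measurable_fst).
  - case jk : ((j : nat) == k); under eq_fun do rewrite Im_upd jk.
      exact: measurable_snd.
    exact: (measurableT_comp (measurableT_comp (mIm j) measurable_fst) measurable_fst).
have F20 p : (0 <= F2 p)%E by exact: iter_int_ge0.
have mF1 := @measurable_fun_fubini_tonelli_F _ _ _ _ _ mu F2 mF2 F20.
have F10 (p : T * R) : (0 <= fubini_F mu F2 p)%E by exact: integral_ge0.
exact: (@measurable_fun_fubini_tonelli_F _ _ _ _ _ mu _ mF1 F10).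
Qed.

Lemma jmeasurable_upd (G : Cn -> \bar R) z k x :
  jmeasurable G -> measurable_fun setT (fun y : R => G (upd z k (x +i* y)%C)).
Proof.
move=> mG; apply: (mG _ _ (fun y => upd z k (x +i* y)%C)) => j.
- by case jk : ((j : nat) == k); under eq_fun do rewrite Re_upd jk; exact: measurable_cst.
- by case jk : ((j : nat) == k); under eq_fun do rewrite Im_upd jk; [exact: measurable_id|exact: measurable_cst].
Qed.

Lemma jmeasurable_int_upd (G : Cn -> \bar R) z k :
  (forall z, (0 <= G z)%E) -> jmeasurable G ->
  measurable_fun setT (fun x : R => \int[mu]_y G (upd z k (x +i* y)%C))%E.
Proof.
move=> G0 mG.
pose F (p : R * R) := G (upd z k (p.1 +i* p.2)%C).
have mF : measurable_fun setT F.
  apply: (mG _ _ (fun p : R * R => upd z k (p.1 +i* p.2)%C)) => j.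
  - by case jk : ((j : nat) == k); under eq_fun do rewrite Re_upd jk; [exact: measurable_fst|exact: measurable_cst].
  - by case jk : ((j : nat) == k); under eq_fun do rewrite Im_upd jk; [exact: measurable_snd|exact: measurable_cst].
by apply: (@measurable_fun_fubini_tonelli_F _ _ _ _ _ mu F mF) => p; exact: G0.
Qed.

Lemma le_iter_int k (G1 G2 : Cn -> \bar R) z :
  jmeasurable G1 -> jmeasurable G2 -> (forall z, (0 <= G1 z)%E) ->
  (forall z, (G1 z <= G2 z)%E) -> (iter_int k G1 z <= iter_int k G2 z)%E.
Proof.
move=> m1 m2 G10 G12; have G20 z' : (0 <= G2 z')%E by exact: le_trans (G12 _).
elim: k z => [|k IH] z //=.
have mi1 := jmeasurable_iter_int k G10 m1; have mi2 := jmeasurable_iter_int k G20 m2.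
apply: ge0_le_integral => //.
- by move=> x _; apply: integral_ge0 => y _; exact: iter_int_ge0.
- by apply: jmeasurable_int_upd => // z'; exact: iter_int_ge0.
- by apply: jmeasurable_int_upd => // z'; exact: iter_int_ge0.
- move=> x _; apply: ge0_le_integral => //.
  + by move=> y _; exact: iter_int_ge0.
  + exact: jmeasurable_upd.
  + exact: jmeasurable_upd.
Qed.

Lemma iter_intD k (G1 G2 : Cn -> \bar R) z :
  jmeasurable G1 -> jmeasurable G2 -> (forall z, (0 <= G1 z)%E) ->
  (forall z, (0 <= G2 z)%E) ->
  (iter_int k (fun z => G1 z + G2 z) z = iter_int k G1 z + iter_int k G2 z)%E.
Proof.
move=> m1 m2 G10 G20; elim: k z => [|k IH] z //=.
have mi1 := jmeasurable_iter_int k G10 m1; have mi2 := jmeasurable_iter_int k G20 m2.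
rewrite -ge0_integralD//; first last.
- by apply: jmeasurable_int_upd => // z'; exact: iter_int_ge0.
- by move=> x _; apply: integral_ge0 => y _; exact: iter_int_ge0.
- by apply: jmeasurable_int_upd => // z'; exact: iter_int_ge0.
- by move=> x _; apply: integral_ge0 => y _; exact: iter_int_ge0.
apply: eq_integral => x _.
under eq_integral do rewrite IH.
rewrite ge0_integralD//.
- by move=> y _; exact: iter_int_ge0.
- exact: jmeasurable_upd.
- by move=> y _; exact: iter_int_ge0.
- exact: jmeasurable_upd.
Qed.

Lemma iter_intZ k (c : R) (G : Cn -> \bar R) z :
  0 <= c -> jmeasurable G -> (forall z, (0 <= G z)%E) ->
  (iter_int k (fun z => c%:E * G z) z = c%:E * iter_int k G z)%E.
Proof.
move=> c0 mG G0; elim: k z => [|k IH] z //=.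
have mi := jmeasurable_iter_int k G0 mG.
rewrite -ge0_integralZl//; first last.
- by move=> x _; apply: integral_ge0 => y _; exact: iter_int_ge0.
- by apply: jmeasurable_int_upd => // z'; exact: iter_int_ge0.
apply: eq_integral => x _.
under eq_integral do rewrite IH.
rewrite ge0_integralZl//.
- exact: jmeasurable_upd.
- by move=> y _; exact: iter_int_ge0.
Qed.

Lemma iter_int_nneseries k (G : nat -> Cn -> \bar R) z :
  (forall i, jmeasurable (G i)) -> (forall i z, (0 <= G i z)%E) ->
  (iter_int k (fun z => \sum_(i <oo) G i z) z = \sum_(i <oo) iter_int k (G i) z)%E.
Proof.
move=> mG G0; elim: k z => [|k IH] z //=.
have mi i := jmeasurable_iter_int k (G0 i) (mG i).
rewrite -integral_nneseries//; first last.
- by move=> i x _; apply: integral_ge0 => y _; exact: iter_int_ge0.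
- by move=> i; apply: jmeasurable_int_upd => // z'; exact: iter_int_ge0.
apply: eq_integral => x _.
under eq_integral do rewrite IH.
rewrite integral_nneseries//.
- by move=> i; exact: jmeasurable_upd.
- by move=> i y _; exact: iter_int_ge0.
Qed.

Lemma jmeasurableD (G1 G2 : Cn -> \bar R) :
  jmeasurable G1 -> jmeasurable G2 -> jmeasurable (fun z => G1 z + G2 z)%E.
Proof.
move=> m1 m2 d T Phi a b.
exact: emeasurable_funD (m1 _ _ _ a b) (m2 _ _ _ a b).
Qed.

Lemma jmeasurableZ (c : R) (G : Cn -> \bar R) :
  jmeasurable G -> jmeasurable (fun z => c%:E * G z)%E.
Proof. by move=> m d T Phi a b; apply: measurable_funeM; exact: m. Qed.

Lemma jmeasurable_nneseries (G : nat -> Cn -> \bar R) :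
  (forall i, jmeasurable (G i)) -> (forall i z, (0 <= G i z)%E) ->
  jmeasurable (fun z => \sum_(i <oo) G i z)%E.
Proof.
move=> m G0 d T Phi a b.
apply: (@ge0_emeasurable_sum _ _ _ setT (fun i t => G i (Phi t)) xpredT) => //.
by move=> i _; exact: m.
Qed.

Lemma iter_int_monotone k (G : nat -> Cn -> \bar R) z :
  (forall i, jmeasurable (G i)) -> (forall i z, (0 <= G i z)%E) ->
  (forall z, {homo (fun i => G i z) : i j / (i <= j)%N >-> (i <= j)%E}) ->
  iter_int k (fun z => limn (fun i => G i z)) z = limn (fun i => iter_int k (G i) z).
Proof.
move=> mG G0 ndG; elim: k z => [|k IH] z //=.
have mi i := jmeasurable_iter_int k (G0 i) (mG i).
have nd x y : {homo (fun i => iter_int k (G i) (upd z k (x +i* y)%C)) :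
    i j / (i <= j)%N >-> (i <= j)%E}.
  by move=> i j ij; apply: le_iter_int => // w; exact: ndG.
rewrite -monotone_convergence//; first last.
- move=> x _ i j ij; apply: ge0_le_integral => //.
  + by move=> y _; exact: iter_int_ge0.
  + exact: jmeasurable_upd.
  + exact: jmeasurable_upd.
  + by move=> y _; exact: nd.
- by move=> i x _; apply: integral_ge0 => y _; exact: iter_int_ge0.
- by move=> i; apply: jmeasurable_int_upd => // z'; exact: iter_int_ge0.
apply: eq_integral => x _.
under eq_integral do rewrite IH.
rewrite monotone_convergence//.
- by move=> i; exact: jmeasurable_upd.
- by move=> i y _; exact: iter_int_ge0.
Qed.

(** The right-hand side is a measure in [A] that agrees with Lebesgue measure on half-open
    intervals, so uniqueness applies. *)
Lemma lebesgue_measure_affine (a b : R) (A : set (measurableTypeR R)) :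
  0 < a -> measurable A ->
  mu A = (a%:E * pushforward mu (fun x : measurableTypeR R => (a * x + b)%R : measurableTypeR R) A)%E.
Proof.
move=> a0 mA.
have mphi : measurable_fun setT (fun x : measurableTypeR R => a * x + b : measurableTypeR R).
  by apply: measurable_funD => //; exact: measurable_funM.
pose m := mscale (NngNum (ltW a0)) (pushforward mu (fun x : measurableTypeR R => a * x + b : measurableTypeR R)).
rewrite -[RHS]/(m mphi A).
apply: lebesgue_measure_unique => //= _ [[c d]] _ <-.
rewrite /m/= /mscale /= /pushforward.
rewrite (_ : _ @^-1` _ = `](c - b) / a, (d - b) / a]%classic); last first.
  apply/seteqP; split => x /=; rewrite !in_itv/=.
    by rewrite ltr_pdivrMr// ler_pdivlMr// ltrBlDr lerBrDr !(mulrC x).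
  by rewrite ltr_pdivrMr// ler_pdivlMr// ltrBlDr lerBrDr !(mulrC x).
rewrite !lebesgue_measure_itv/= !lte_fin ltr_pM2r ?invr_gt0// ltrD2r.
case: ifP => _; last by rewrite mule0.
by rewrite -EFinB -EFinM; congr EFin; field; rewrite gt_eqF.
Qed.

Lemma integral_affine (a b : R) (f : R -> \bar R) :
  0 < a -> measurable_fun setT f -> (forall x, (0 <= f x)%E) ->
  (\int[mu]_x f x = a%:E * \int[mu]_x f (a * x + b)%R)%E.
Proof.
move=> a0 mf f0.
have mphi : measurable_fun setT (fun x : measurableTypeR R => a * x + b : measurableTypeR R).
  by apply: measurable_funD => //; exact: measurable_funM.
pose m := mscale (NngNum (ltW a0)) (pushforward mu (fun x : measurableTypeR R => a * x + b : measurableTypeR R)).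
transitivity (\int[m mphi]_x f x)%E.
  by apply: eq_measure_integral => A mA _; exact: lebesgue_measure_affine.
rewrite ge0_integral_mscale//=; congr (_ * _)%E.
by rewrite ge0_integral_pushforward.
Qed.

(** The homothety with centre [w] and ratio [t]; with [w] on the boundary and [t <= 1] it maps the
    ellipsoid into itself. *)
Definition dilate (w : Cn) (t : R) (z : Cn) : Cn := w + t%:C%C *: (z - w).

Lemma Re_dilate w t z (j : 'I_n) :
  complex.Re (dilate w t z 0 j) = t * complex.Re (z 0 j) + (1 - t) * complex.Re (w 0 j).
Proof.
by rewrite !mxE; case: (w 0 j) => a b; case: (z 0 j) => c d /=; ring.
Qed.

Lemma Im_dilate w t z (j : 'I_n) :
  complex.Im (dilate w t z 0 j) = t * complex.Im (z 0 j) + (1 - t) * complex.Im (w 0 j).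
Proof.
by rewrite !mxE; case: (w 0 j) => a b; case: (z 0 j) => c d /=; ring.
Qed.

Lemma complexP (u v : C) :
  complex.Re u = complex.Re v -> complex.Im u = complex.Im v -> u = v.
Proof. by case: u => a b; case: v => c d /= -> ->. Qed.

Lemma dilate_upd w t z (k : 'I_n) (x y : R) :
  dilate w t (upd z k (x +i* y)%C) =
  upd (dilate w t z) k ((t * x + (1 - t) * complex.Re (w 0 k)) +i*
                        (t * y + (1 - t) * complex.Im (w 0 k)))%C.
Proof.
apply/rowP => j; apply: complexP.
  rewrite Re_dilate !Re_upd Re_dilate; case: eqP => // jk.
  by have /val_inj -> : val j = val k.
rewrite Im_dilate !Im_upd Im_dilate; case: eqP => // jk.
by have /val_inj -> : val j = val k.
Qed.

Lemma jmeasurable_dilate (G : Cn -> \bar R) (w : Cn) (t : R) :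
  jmeasurable G -> jmeasurable (fun z => G (dilate w t z)).
Proof.
move=> mG d T Phi a b; apply: mG => j.
  under eq_fun do rewrite Re_dilate.
  by apply: measurable_funD => //; apply: measurable_funM.
under eq_fun do rewrite Im_dilate.
by apply: measurable_funD => //; apply: measurable_funM.
Qed.

(* [k <= n]: the coordinates from [n] on do not exist, and [upd] ignores them. *)
Lemma iter_int_dilate k (G : Cn -> \bar R) (w z : Cn) (t : R) :
  0 < t -> jmeasurable G -> (forall z, (0 <= G z)%E) -> (k <= n)%N ->
  (iter_int k G (dilate w t z) =
   ((t ^+ 2) ^+ k)%:E * iter_int k (fun z => G (dilate w t z)) z)%E.
Proof.
move=> t0 mG G0; elim: k z => [|k IH] z kn; first by rewrite expr0 mul1e.
have mi := jmeasurable_iter_int k G0 mG.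
have i0 z' : (0 <= iter_int k G z')%E by exact: iter_int_ge0.
have mi' := jmeasurable_iter_int k (fun z => G0 (dilate w t z)) (jmeasurable_dilate w t mG).
have i0' z' : (0 <= iter_int k (fun z => G (dilate w t z)) z')%E by exact: iter_int_ge0.
pose k' := Ordinal kn.
have t20 : (0 <= ((t ^+ 2) ^+ k)%:E)%E by rewrite lee_fin exprn_ge0// sqr_ge0.
pose F x := (\int[mu]_y iter_int k G (upd (dilate w t z) k (x +i* y)%C))%E.
have F0 x : (0 <= F x)%E by exact: integral_ge0.
have mF : measurable_fun setT F by exact: jmeasurable_int_upd.
(* The shift is the one produced by [dilate_upd], so that after both substitutions the point is the
   dilation of an updated point. Each of the two real integrals contributes one factor [t]. *)
rewrite -[LHS]/(\int[mu]_x F x)%E (integral_affine ((1 - t) * complex.Re (w 0 k')) t0 mF F0).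
transitivity (t%:E * \int[mu]_x (t%:E * \int[mu]_y
    (((t ^+ 2) ^+ k)%:E * iter_int k (fun z => G (dilate w t z)) (upd z k (x +i* y)%C))))%E.
  congr (_ * _)%E; apply: eq_integral => x _.
  have mf : measurable_fun setT (fun y : R => iter_int k G
      (upd (dilate w t z) k ((t * x + (1 - t) * complex.Re (w 0 k')) +i* y)%C)).
    exact: (@jmeasurable_upd _ (dilate w t z) k (t * x + (1 - t) * complex.Re (w 0 k'))%R mi).
  rewrite /F (integral_affine ((1 - t) * complex.Im (w 0 k')) t0 mf (fun y => i0 _)).
  congr (_ * _)%E; apply: eq_integral => y _.
  by rewrite -IH ?(ltnW kn)// (dilate_upd w t z k').
under eq_integral => x _.
  rewrite ge0_integralZl//; last exact: jmeasurable_upd.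
  rewrite muleA -EFinM.
  over.
rewrite ge0_integralZl//; first last.
- by rewrite lee_fin mulr_ge0 ?(ltW t0)// -lee_fin.
- by move=> x _; exact: integral_ge0.
- exact: jmeasurable_int_upd.
by rewrite muleA -EFinM mulrA -expr2 -exprS.
Qed.

(** Indicator of a closed square of side [2 M]. Products of these are the only functions whose
    integral is computed exactly; they give finiteness of bounded volumes and positivity of
    integrals. *)
Definition boxcoord (c : Cn) (M : R) (j : 'I_n) (v : C) : R :=
  \1_(`[complex.Re (c 0 j) - M, complex.Re (c 0 j) + M]%classic) (complex.Re v) *
  \1_(`[complex.Im (c 0 j) - M, complex.Im (c 0 j) + M]%classic) (complex.Im v).

Lemma boxcoord_ge0 c M j v : 0 <= boxcoord c M j v.
Proof. by rewrite mulr_ge0. Qed.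

Lemma lebesgue_measure_sym_itv (c M : R) : 0 <= M ->
  mu (`[c - M, c + M]%classic : set R) = (2 * M)%:E.
Proof.
move=> M0; rewrite lebesgue_measure_itv/= lte_fin.
case: ifPn; first by move=> _; rewrite -EFinB; congr EFin; ring.
rewrite -leNgt => h; congr EFin; lra.
Qed.

Lemma integralZ_indic_sym_itv (K c M : R) : 0 <= K -> 0 <= M ->
  (\int[mu]_x (K * \1_(`[c - M, c + M]%classic) x)%:E = (K * (2 * M))%:E)%E.
Proof.
move=> K0 M0; under eq_integral do rewrite EFinM.
rewrite ge0_integralZl//.
- by rewrite integral_indic//= setIT lebesgue_measure_sym_itv// EFinM.
- by apply/measurable_EFinP; exact: measurable_indic.
Qed.

(** Invariant of the induction: each coordinate already integrated has turned its factor into the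
    area [(2 M) ^ 2], and the other factors still depend on [z]. *)
Lemma iter_int_box (c : Cn) (M : R) k z : 0 <= M -> (k <= n)%N ->
  iter_int k (fun z => (\prod_(j < n) boxcoord c M j (z 0 j))%:E) z =
  (((2 * M) ^+ 2) ^+ k * \prod_(j < n | (k <= j)%N) boxcoord c M j (z 0 j))%:E.
Proof.
move=> M0; elim: k z => [|k IH] z kn.
  by rewrite expr0 mul1r.
rewrite /=.
under eq_integral => x _ do under eq_integral => y _ do rewrite IH ?(ltnW kn)//.
pose k' := Ordinal kn.
set Q := \prod_(j < n | (k.+1 <= j)%N) _.
have Q0 : 0 <= Q by apply: prodr_ge0 => j _; exact: boxcoord_ge0.
set K := ((2 * M) ^+ 2) ^+ k.
have K0 : 0 <= K by rewrite exprn_ge0// sqr_ge0.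
have E x y : K * \prod_(j < n | (k <= j)%N) boxcoord c M j (upd z k (x +i* y)%C 0 j) =
    K * Q * \1_(`[complex.Re (c 0 k') - M, complex.Re (c 0 k') + M]%classic) x *
    \1_(`[complex.Im (c 0 k') - M, complex.Im (c 0 k') + M]%classic) y.
  rewrite (bigD1 k')//= mxE eqxx.
  have -> : \prod_(j < n | (k <= j)%N && (j != k'))
      boxcoord c M j (upd z k (x +i* y)%C 0 j) = Q.
    apply: eq_big => j; first by rewrite ltn_neqAle andbC eq_sym.
    by move=> /andP[_ jk]; rewrite mxE ifN.
  by rewrite /boxcoord /=; ring.
transitivity (\int[mu]_x (K * Q * (2 * M) *
    \1_(`[complex.Re (c 0 k') - M, complex.Re (c 0 k') + M]%classic) x)%:E)%E.
  apply: eq_integral => x _; under eq_integral => y _ do rewrite E.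
  by rewrite integralZ_indic_sym_itv ?mulr_ge0//; congr EFin; ring.
rewrite integralZ_indic_sym_itv ?mulr_ge0//; congr EFin.
by rewrite exprSr -/K; ring.
Qed.

End Iterated_integral.

(** * Measurability on open sets, and volumes *)

Section Volume_integral.
Variables (R : realType) (n : nat).
Local Notation C := (R[i]).
Local Notation Cn := 'rV[C]_n.
Local Notation volint := (@volint R n).

Lemma normr_Re_le_cabs (z : C) : `|complex.Re z| <= cabs z.
Proof.
rewrite -(ler_sqr (normr_ge0 _) (cabs_ge0 z)) sqr_cabs real_normK ?num_real//.
by rewrite lerDl sqr_ge0.
Qed.

Lemma normr_Im_le_cabs (z : C) : `|complex.Im z| <= cabs z.
Proof.
rewrite -(ler_sqr (normr_ge0 _) (cabs_ge0 z)) sqr_cabs real_normK ?num_real//.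
by rewrite lerDr sqr_ge0.
Qed.

Lemma cabs_le_ReIm (z : C) : cabs z <= `|complex.Re z| + `|complex.Im z|.
Proof.
rewrite -(ler_sqr (cabs_ge0 z)) ?nnegrE ?addr_ge0// sqr_cabs sqrrD.
by rewrite !real_normK ?num_real// /cabs2 addrAC lerDl mulrn_wge0// mulr_ge0.
Qed.

Definition gridpt (v : 'rV[(int * int)%type]_n) (N : nat) : Cn :=
  \row_j ((v 0 j).1%:~R / N.+1%:R +i* ((v 0 j).2%:~R / N.+1%:R))%C.

Lemma gridpt_approx (z : Cn) (N : nat) : exists v, forall j,
  `|complex.Re (z 0 j - gridpt v N 0 j)| < N.+1%:R^-1 /\
  `|complex.Im (z 0 j - gridpt v N 0 j)| < N.+1%:R^-1.
Proof.
exists (\row_j (Num.floor (complex.Re (z 0 j) * N.+1%:R),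
                Num.floor (complex.Im (z 0 j) * N.+1%:R))) => j.
have fl (x : R) : `|x - (Num.floor (x * N.+1%:R))%:~R / N.+1%:R| < N.+1%:R^-1.
  have N0 : 0 < N.+1%:R :> R by [].
  have /andP[] := floor_itv (x * N.+1%:R).
  set k := Num.floor _; rewrite intrD => h1 h2.
  rewrite ger0_norm; last by rewrite subr_ge0 ler_pdivrMr.
  rewrite -(ltr_pM2r N0) mulrBl divfK ?gt_eqF// mulVf ?gt_eqF//; lra.
by rewrite !mxE /=; case: (z 0 j) => a b /=; split; exact: fl.
Qed.

(** Openness stated with real radii and moduli of coordinates, which keeps the [C]-valued norm of
    [Cn] out of the estimates. *)
Definition copen (D : set Cn) : Prop := forall z, D z ->
  exists2 e : R, 0 < e & forall w : Cn, (forall j, cabs (w 0 j - z 0 j) < e) -> D w.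

Definition cball (c : Cn) (r : R) : set Cn :=
  [set z | forall j, cabs (z 0 j - c 0 j) < r].

Definition obox (c : Cn) (r : R) : set Cn := [set z | forall j,
  `|complex.Re (z 0 j - c 0 j)| < r /\ `|complex.Im (z 0 j - c 0 j)| < r].

(** The grid boxes form a countable base. Open sets are thus countable unions of sets described by
    real and imaginary parts, which is how their preimages become measurable. *)
Lemma copen_grid (D : set Cn) (z : Cn) : copen D -> D z ->
  exists vN, obox (gridpt vN.1 vN.2) vN.2.+1%:R^-1 z /\
    obox (gridpt vN.1 vN.2) vN.2.+1%:R^-1 `<=` D.
Proof.
move=> oD Dz; have [e e0 eD] := oD _ Dz.
have e4 : 0 < e / 4 by rewrite divr_gt0.
have [N _ /(_ N (leqnn N)) /= HN] := near_infty_natSinv_lt (PosNum e4).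
have [v vz] := gridpt_approx z N; exists (v, N); split => // w vw /=.
apply: eD => j; apply: le_lt_trans (cabs_le_ReIm _) _.
have [a1 a2] := vz j; have [b1 b2] := vw j; move: a1 a2 b1 b2 HN => /=.
case: (z 0 j) => x y; case: (w 0 j) => x' y'; case: (gridpt v N 0 j) => s t /=.
set d := N.+1%:R^-1.
move=> /ltr_normlP[? ?] /ltr_normlP[? ?] /ltr_normlP[? ?] /ltr_normlP[? ?] ?.
have h1 : `|x' - x| < e / 2 by rewrite ltr_norml; apply/andP; split; lra.
have h2 : `|y' - y| < e / 2 by rewrite ltr_norml; apply/andP; split; lra.
lra.
Qed.

Section Measurability.
Context d (T : measurableType d) (Phi : T -> Cn).
Hypothesis mRe : forall j, measurable_fun [set: T] (fun t => complex.Re (Phi t 0 j)).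
Hypothesis mIm : forall j, measurable_fun [set: T] (fun t => complex.Im (Phi t 0 j)).

Lemma measurable_preimage_obox (c : Cn) (r : R) : measurable (Phi @^-1` obox c r).
Proof.
have -> : Phi @^-1` obox c r = \bigcap_(j in [set: 'I_n])
    (([set: T] `&` (fun t => complex.Re (Phi t 0 j)) @^-1` `]complex.Re (c 0 j) - r, complex.Re (c 0 j) + r[%classic) `&`
     ([set: T] `&` (fun t => complex.Im (Phi t 0 j)) @^-1` `]complex.Im (c 0 j) - r, complex.Im (c 0 j) + r[%classic)).
  apply/seteqP; split => t /=.
    move=> h j _ /=; rewrite !in_itv /=; have := h j.
    case: (Phi t 0 j) => x y; case: (c 0 j) => a b /= [].
    by move=> /ltr_normlP[? ?] /ltr_normlP[? ?]; split; split => //; apply/andP; split; lra.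
  move=> h j; have := h j I => /=; rewrite !in_itv /=.
  case: (Phi t 0 j) => x y; case: (c 0 j) => a b /= [[_ /andP[? ?]] [_ /andP[? ?]]].
  by split; rewrite ltr_norml; apply/andP; split; lra.
apply: fin_bigcap_measurable => // j _; apply: measurableI.
  exact: mRe.
exact: mIm.
Qed.

Lemma measurable_preimage_copen (D : set Cn) : copen D -> measurable (Phi @^-1` D).
Proof.
move=> oD.
have -> : Phi @^-1` D = \bigcup_(vN : ('rV[(int * int)%type]_n * nat)%type)
  (Phi @^-1` [set z | obox (gridpt vN.1 vN.2) vN.2.+1%:R^-1 z /\
     obox (gridpt vN.1 vN.2) vN.2.+1%:R^-1 `<=` D]).
  apply/seteqP; split => t /=.
    by move=> /(copen_grid oD) [vN ?]; exists vN.
  by move=> [vN _ /= [h1 h2]]; exact: h2.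
apply: countable_bigcupT_measurable => // vN.
have [h|h] := pselect (obox (gridpt vN.1 vN.2) vN.2.+1%:R^-1 `<=` D).
  rewrite (_ : _ @^-1` _ = Phi @^-1` obox (gridpt vN.1 vN.2) vN.2.+1%:R^-1).
    exact: measurable_preimage_obox.
  by apply/seteqP; split => t /= => [[]|].
rewrite (_ : _ @^-1` _ = set0)//.
by apply/seteqP; split => t //= [].
Qed.

End Measurability.

Definition ccontinuous (D : set Cn) (f : Cn -> C) : Prop :=
  forall z, D z -> forall e : R, 0 < e -> exists2 d : R, 0 < d &
    forall w : Cn, (forall j, cabs (w 0 j - z 0 j) < d) -> cabs (f w - f z) < e.

Lemma copenI (D1 D2 : set Cn) : copen D1 -> copen D2 -> copen (D1 `&` D2).
Proof.
move=> o1 o2 z [/o1 [e1 e10 h1] /o2 [e2 e20 h2]].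
exists (Num.min e1 e2); first by rewrite lt_min e10.
by move=> w h; split; [apply: h1|apply: h2] => j; have := h j; rewrite lt_min => /andP[].
Qed.

Lemma cabs_dist (z w : C) : `|cabs z - cabs w| <= cabs (z - w).
Proof.
rewrite ler_norml; apply/andP; split.
  by rewrite -cabsN opprB; have := cabsD (w - z) z; rewrite subrK; lra.
by have := cabsD (z - w) w; rewrite subrK; lra.
Qed.

Lemma copen_superlevel (D : set Cn) (f : Cn -> C) (a : R) :
  copen D -> ccontinuous D f -> copen [set z | D z /\ a < cabs (f z)].
Proof.
move=> oD cf z [/= Dz az]; have [e e0 he] := oD _ Dz.
have az0 : 0 < cabs (f z) - a by rewrite subr_gt0.
have [d d0 hd] := cf z Dz _ az0.
exists (Num.min e d); first by rewrite lt_min e0.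
move=> w h; split.
  by apply: he => j; have := h j; rewrite lt_min => /andP[].
have : cabs (f w - f z) < cabs (f z) - a.
  by apply: hd => j; have := h j; rewrite lt_min => /andP[].
by have := cabs_dist (f w) (f z); move=> /ler_normlP[]; lra.
Qed.

Lemma jmeasurable_indic (D : set Cn) (c : R) : copen D ->
  jmeasurable (fun z => (\1_D z * c)%:E).
Proof.
move=> oD d T Phi mRe mIm.
apply/measurable_EFinP; apply: measurable_funM => //.
rewrite (_ : (fun t => _) = \1_(Phi @^-1` D)).
  by apply: measurable_indic; exact: measurable_preimage_copen.
by apply/funext => t; rewrite !indicE.
Qed.

(** Nothing is known about [f] outside [D], so [phi] is composed with [\1_D * cabs f], whose
    superlevel sets are open; outside [D] the outer indicator erases the value of [phi] at 0. *)
Lemma jmeasurable_indic_comp (D : set Cn) (f : Cn -> C) (phi : R -> R) :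
  copen D -> ccontinuous D f -> measurable_fun [set: R] phi ->
  jmeasurable (fun z => (\1_D z * phi (cabs (f z)))%:E).
Proof.
move=> oD cf mphi d T Phi mRe mIm.
have mD : measurable_fun setT (fun t => \1_D (Phi t) : R).
  rewrite (_ : (fun t => _) = \1_(Phi @^-1` D)).
    by apply: measurable_indic; exact: measurable_preimage_copen.
  by apply/funext => t; rewrite !indicE.
have mDf : measurable_fun setT (fun t => \1_D (Phi t) * cabs (f (Phi t)) : R).
  apply: (measurability _ (RGenOInfty.measurableE R)).
  move=> _ [_ [a ->] <-].
  (* The product with the indicator is nonnegative: below level 0 the superlevel set is everything,
     and from level 0 on it lies inside [D]. *)
  rewrite setTI; have [a0|a0] := ltP a 0.
    rewrite (_ : _ @^-1` _ = setT)//; apply/seteqP; split => // t _ /=.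
    by rewrite in_itv/= andbT (lt_le_trans a0)// mulr_ge0// cabs_ge0.
  rewrite (_ : _ @^-1` _ = Phi @^-1` [set z | D z /\ a < cabs (f z)]).
    by apply: measurable_preimage_copen => //; exact: copen_superlevel.
  apply/seteqP; split => t /=; rewrite in_itv/= andbT indicE.
    case: (boolP (Phi t \in D)); first by rewrite mul1r inE.
    by rewrite mul0r => _; rewrite ltNge a0.
  by move=> [/mem_set -> ?]; rewrite mul1r.
apply/measurable_EFinP.
rewrite (_ : (fun t => _) = (fun t => \1_D (Phi t) * phi (\1_D (Phi t) * cabs (f (Phi t))))).
  by apply: measurable_funM => //; exact: measurableT_comp.
by apply/funext => t; rewrite indicE; case: (_ \in _); rewrite ?mul1r// !mul0r.
Qed.

(** The coordinates below [k] are overwritten by the integration variables. For [k = n] the base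
    point is irrelevant, which lets [volint_dilate] replace [dilate w t 0] by [0]. *)
Lemma iter_int_agree k (G : Cn -> \bar R) (z z' : Cn) :
  (forall j : 'I_n, (k <= j)%N -> z 0 j = z' 0 j) -> iter_int k G z = iter_int k G z'.
Proof.
elim: k z z' => [|k IH] z z' h /=.
  by congr G; apply/rowP => j; exact: h.
apply: eq_integral => x _; apply: eq_integral => y _; apply: IH => j kj.
by rewrite !mxE; case: eqP => // /eqP jk; apply: h; rewrite ltn_neqAle eq_sym jk.
Qed.

Lemma volint_ge0 (G : Cn -> \bar R) : (forall z, (0 <= G z)%E) -> (0 <= volint G)%E.
Proof. exact: iter_int_ge0. Qed.

Lemma le_volint (G1 G2 : Cn -> \bar R) : jmeasurable G1 -> jmeasurable G2 ->
  (forall z, (0 <= G1 z)%E) -> (forall z, (G1 z <= G2 z)%E) ->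
  (volint G1 <= volint G2)%E.
Proof. exact: le_iter_int. Qed.

Lemma volintD (G1 G2 : Cn -> \bar R) : jmeasurable G1 -> jmeasurable G2 ->
  (forall z, (0 <= G1 z)%E) -> (forall z, (0 <= G2 z)%E) ->
  (volint (fun z => G1 z + G2 z) = volint G1 + volint G2)%E.
Proof. exact: iter_intD. Qed.

Lemma volintZ (c : R) (G : Cn -> \bar R) : 0 <= c -> jmeasurable G ->
  (forall z, (0 <= G z)%E) -> (volint (fun z => c%:E * G z) = c%:E * volint G)%E.
Proof. exact: iter_intZ. Qed.

Lemma volint_dilate (G : Cn -> \bar R) (w : Cn) (t : R) : 0 < t -> jmeasurable G ->
  (forall z, (0 <= G z)%E) ->
  (volint G = (t ^+ (2 * n))%:E * volint (fun z => G (dilate w t z)))%E.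
Proof.
move=> t0 mG G0; rewrite exprM -iter_int_dilate//.
by apply: iter_int_agree => j; rewrite leqNgt ltn_ord.
Qed.

Lemma volint_box (c : Cn) (M : R) : 0 <= M ->
  volint (fun z => (\prod_(j < n) boxcoord c M j (z 0 j))%:E) = ((2 * M) ^+ (2 * n))%:E.
Proof.
move=> M0; rewrite /Defs.volint iter_int_box// exprM big_pred0 ?mulr1//.
by move=> j; rewrite leqNgt ltn_ord.
Qed.

Lemma box_indicE (c : Cn) (M : R) (z : Cn) :
  \prod_(j < n) boxcoord c M j (z 0 j) =
  \1_[set z : Cn | forall j, `|complex.Re (z 0 j - c 0 j)| <= M /\
                          `|complex.Im (z 0 j - c 0 j)| <= M] z.
Proof.
have E j : (boxcoord c M j (z 0 j) = 1 /\
    (`|complex.Re (z 0 j - c 0 j)| <= M /\ `|complex.Im (z 0 j - c 0 j)| <= M)) \/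
    (boxcoord c M j (z 0 j) = 0 /\
    ~ (`|complex.Re (z 0 j - c 0 j)| <= M /\ `|complex.Im (z 0 j - c 0 j)| <= M)).
  rewrite /boxcoord !indicE; case: (z 0 j) => x y; case: (c 0 j) => a b /=.
  have e1 u v : (u \in `[v - M, v + M]%classic) = (`|u - v| <= M).
    rewrite ler_norml; apply/idP/idP; first by rewrite inE/= in_itv/= => /andP[? ?]; apply/andP; split; lra.
    by move=> /andP[? ?]; rewrite inE/= in_itv/=; apply/andP; split; lra.
  rewrite !e1; case: (`|x - a| <= M); case: (`|y - b| <= M); rewrite ?mulr0 ?mul0r ?mulr1;
    by [left|right; split => // -[]].
have [h|h] := pselect (forall j, `|complex.Re (z 0 j - c 0 j)| <= M /\
                          `|complex.Im (z 0 j - c 0 j)| <= M).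
  rewrite indicE mem_set//= big1// => j _.
  by have [[]//|[]] := E j => _ /(_ (h j)).
rewrite indicE memNset//=.
move/existsNP : h => [j hj]; rewrite (bigD1 j)//=.
by have [[_ /hj]//|[-> _]] := E j; rewrite mul0r.
Qed.

Lemma jmeasurable_box (c : Cn) (M : R) :
  jmeasurable (fun z => (\prod_(j < n) boxcoord c M j (z 0 j))%:E).
Proof.
move=> d T Phi mRe mIm; apply/measurable_EFinP.
apply: measurable_prod => j _.
by apply: measurable_funM; apply: measurableT_comp.
Qed.

Lemma volint_gt0 (G : Cn -> \bar R) (z0 : Cn) (c e : R) : jmeasurable G ->
  (forall z, (0 <= G z)%E) -> 0 < c -> 0 < e ->
  (forall z : Cn, (forall j, cabs (z 0 j - z0 0 j) < e) -> (c%:E <= G z)%E) ->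
  (0 < volint G)%E.
Proof.
move=> mG G0 c0 e0 h.
(* A point of the box of half-side [e / 4] has every coordinate within [e / 4 + e / 4 < e] of
   [z0]. *)
have e40 : 0 < e / 4 by rewrite divr_gt0.
apply: (@lt_le_trans _ _ (c%:E * ((2 * (e / 4)) ^+ (2 * n))%:E)%E).
  by rewrite -EFinM lte_fin mulr_gt0// exprn_gt0// mulr_gt0.
rewrite -(volint_box z0 (ltW e40)) -volintZ ?(ltW c0)//; first last.
  by move=> z; rewrite lee_fin prodr_ge0// => j _; exact: boxcoord_ge0.
  exact: jmeasurable_box.
apply: le_volint => //.
- exact/jmeasurableZ/jmeasurable_box.
- move=> z; rewrite -EFinM lee_fin mulr_ge0 ?(ltW c0)// prodr_ge0// => j _.
  exact: boxcoord_ge0.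
- move=> z; rewrite box_indicE indicE.
  case: (boolP (z \in _)); rewrite /= ?mule0 ?mule1// inE /= => hz.
  apply: h => j; apply: le_lt_trans (cabs_le_ReIm _) _.
  have [h1 h2] := hz j.
  apply: (@le_lt_trans _ _ (e / 4 + e / 4)); first exact: lerD.
  lra.
Qed.

Lemma volint_indic_fin (D : set Cn) (M : R) : copen D ->
  (forall z j, D z -> cabs (z 0 j) <= M) -> (volint (fun z => (\1_D z)%:E) < +oo)%E.
Proof.
move=> oD hM.
have Mp : 0 <= `|M| by [].
apply: (@le_lt_trans _ _ ((2 * `|M|) ^+ (2 * n))%:E); last exact: ltry.
rewrite -(volint_box 0 Mp); apply: le_volint => //.
- have := jmeasurable_indic 1 oD; congr (jmeasurable _).
  by apply/funext => z; rewrite mulr1.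
- exact: jmeasurable_box.
move=> z; rewrite lee_fin box_indicE !indicE.
case: (boolP (z \in D)) => //; rewrite inE => Dz.
rewrite mem_set//= => j; rewrite mxE subr0.
split.
  by rewrite (le_trans (normr_Re_le_cabs _))// (le_trans (hM _ j Dz))// ler_norm.
by rewrite (le_trans (normr_Im_le_cabs _))// (le_trans (hM _ j Dz))// ler_norm.
Qed.

End Volume_integral.

(** * Geometry of the ellipsoid *)

Section Ellipsoid_geometry.
Variables (R : realType) (n : nat).
Local Notation C := (R[i]).
Local Notation Cn := 'rV[C]_n.

(** A weighted squared norm: Euclidean balls (all weights 1) and the ellipsoid (weights [wgt]) are
    sublevel sets of the same form, so openness and convexity are proved once. *)
Definition qform (b : 'I_n -> R) (z : Cn) : R := \sum_(j < n) cabs2 (z 0 j) * b j.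

Lemma cabs2_ge0 (z : C) : 0 <= cabs2 z.
Proof. by rewrite addr_ge0// sqr_ge0. Qed.

Lemma qform_ge0 b z : (forall j, 0 <= b j) -> 0 <= qform b z.
Proof. by move=> b0; apply: sumr_ge0 => j _; rewrite mulr_ge0// cabs2_ge0. Qed.

Lemma cabs2_cts (z w : C) (d : R) : d <= 1 -> cabs (w - z) < d ->
  `|cabs2 w - cabs2 z| <= d * (2 * cabs z + 1).
Proof.
move=> d1 wz; rewrite -!sqr_cabs subr_sqr normrM.
have h := le_trans (cabs_dist w z) (ltW wz).
have z0 := cabs_ge0 z; have w0 := cabs_ge0 w.
apply: ler_pM => //; rewrite ger0_norm ?addr_ge0//.
by move: h => /ler_normlP[]; lra.
Qed.

Lemma qform_cts b (z : Cn) (e : R) : (forall j, 0 <= b j) -> 0 < e ->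
  exists2 d : R, 0 < d & forall w : Cn, (forall j, cabs (w 0 j - z 0 j) < d) ->
    `|qform b w - qform b z| < e.
Proof.
move=> b0 e0; pose K := \sum_(j < n) (2 * cabs (z 0 j) + 1) * b j.
have K0 : 0 <= K.
  by apply: sumr_ge0 => j _; rewrite mulr_ge0// addr_ge0// mulr_ge0// cabs_ge0.
have K1 : 0 < K + 1 by rewrite ltr_wpDl.
exists (Num.min 1 (e / (K + 1))); first by rewrite lt_min ltr01 divr_gt0.
set d := Num.min _ _.
have d0 : 0 <= d by rewrite le_min ler01 divr_ge0// ltW.
have d1 : d <= 1 by rewrite ge_min lexx.
move=> w h; rewrite /qform -sumrB.
apply: le_lt_trans (ler_norm_sum _ _ _) _.
apply: (@le_lt_trans _ _ (d * K)).
  rewrite mulr_sumr; apply: ler_sum => j _.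
  rewrite -mulrBl normrM (ger0_norm (b0 j)) mulrA ler_wpM2r//.
  exact: cabs2_cts.
apply: (@le_lt_trans _ _ (e / (K + 1) * K)).
  by rewrite ler_wpM2r// ge_min lexx orbT.
by rewrite mulrAC ltr_pdivrMr// ltr_pM2l// ltrDl.
Qed.

Lemma copen_qball b (c : Cn) (r : R) : (forall j, 0 <= b j) ->
  copen [set z | qform b (z - c) < r].
Proof.
move=> b0 z /= zr.
have rz : 0 < r - qform b (z - c) by rewrite subr_gt0.
have [d d0 dP] := qform_cts (z - c) b0 rz.
exists d => // w wz; have /dP : forall j, cabs ((w - c) 0 j - (z - c) 0 j) < d.
  by move=> j; rewrite !mxE opprB addrA subrK.
by move=> /ltr_normlP[] ? ?; lra.
Qed.

Lemma eballE (w : Cn) (r : R) : eball w r = [set z | qform (fun=> 1) (z - w) < r ^+ 2].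
Proof.
apply/seteqP; split => z /=; rewrite /eball /qform /=.
  by under eq_bigr do rewrite -[cabs2 _]mulr1; under [in X in _ -> X]eq_bigr do rewrite !mxE.
by under eq_bigr do rewrite mulr1 !mxE.
Qed.

Lemma copen_eball (w : Cn) (r : R) : copen (eball w r).
Proof. by rewrite eballE; exact: copen_qball. Qed.

(** The exact convexity defect of the squared modulus. Summed over coordinates it yields both the
    convexity of the test sets and the invariance of the ellipsoid under dilation. *)
Lemma cabs2_conv (t : R) (u v : C) :
  cabs2 ((1 - t)%:C%C * u + t%:C%C * v) =
  (1 - t) * cabs2 u + t * cabs2 v - t * (1 - t) * cabs2 (u - v).
Proof. by case: u => x y; case: v => p q; rewrite /cabs2 /=; ring. Qed.

Lemma qform_conv b (t : R) (u v : Cn) :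
  qform b ((1 - t)%:C%C *: u + t%:C%C *: v) =
  (1 - t) * qform b u + t * qform b v - t * (1 - t) * qform b (u - v).
Proof.
rewrite /qform !mulr_sumr -big_split -sumrB; apply: eq_bigr => j _ /=.
by rewrite !mxE cabs2_conv; ring.
Qed.

Lemma qform_conv_lt b (t r : R) (u v : Cn) : (forall j, 0 <= b j) ->
  0 <= t <= 1 -> qform b u < r -> qform b v < r ->
  qform b ((1 - t)%:C%C *: u + t%:C%C *: v) < r.
Proof.
move=> b0 /andP[t0 t1] ur vr; rewrite qform_conv.
have h : 0 <= t * (1 - t) * qform b (u - v).
  by rewrite !mulr_ge0 ?subr_ge0// qform_ge0.
rewrite ltrBlDr ltr_wpDr//.
have [->|t0'] := eqVneq t 0; first by rewrite subr0 mul1r mul0r addr0.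
apply: (@le_lt_trans _ _ ((1 - t) * r + t * qform b v)).
  by rewrite lerD2r ler_wpM2l ?subr_ge0// ltW.
have : t * qform b v < t * r by rewrite ltr_pM2l// lt_neqAle eq_sym t0'.
by lra.
Qed.

Lemma dilateE (w z : Cn) (t : R) : dilate w t z = (1 - t)%:C%C *: w + t%:C%C *: z.
Proof. by apply/rowP => j; rewrite !mxE rmorphB rmorph1; ring. Qed.

Section Omega.
Variable a : 'I_n -> R.
Hypothesis a0 : forall j, 0 < a j.

Definition wgt (j : 'I_n) : R := (a j ^+ 2)^-1.

Lemma wgt_ge0 j : 0 <= wgt j.
Proof. by rewrite invr_ge0 sqr_ge0. Qed.

Lemma ellipsoidE : ellipsoid a = [set z | qform wgt z < 1].
Proof. by []. Qed.

Lemma copen_ellipsoid : copen (ellipsoid a).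
Proof.
have := @copen_qball wgt 0 1 wgt_ge0; congr (copen _).
by apply/funext => z /=; rewrite subr0.
Qed.

(** A value below 1 would put [w] in the interior by openness; a value above 1 would keep it away
    from the closure by continuity of [qform]. *)
Lemma bdry_ellipsoid (w : Cn) : bdry (ellipsoid a) w -> qform wgt w = 1.
Proof.
move=> [clw iw]; apply: contrapT => /eqP; rewrite neq_lt => /orP[w1|w1].
  apply: iw; apply/nbhs_CnP; exact: copen_ellipsoid.
have rw : 0 < qform wgt w - 1 by rewrite subr_gt0.
have [d d0 dP] := qform_cts w wgt_ge0 rw.
have /clw [z [/= z1 zw]] : nbhs (w : (Cn : normedModType C)) (cball w d).
  by apply/nbhs_CnP; exists d.
have := dP _ zw; move: z1; rewrite ellipsoidE /= => z1 /ltr_normlP[]; lra.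
Qed.

Lemma qform_le1_coord (z : Cn) j : qform wgt z <= 1 -> cabs (z 0 j) <= \sum_(i < n) a i.
Proof.
rewrite /qform (bigD1 j)//= => h.
have : cabs2 (z 0 j) * wgt j <= 1.
  apply: le_trans h; rewrite lerDl sumr_ge0// => i _.
  by rewrite mulr_ge0 ?cabs2_ge0 ?wgt_ge0.
rewrite /wgt ler_pdivrMr ?exprn_gt0// mul1r -sqr_cabs ler_sqr ?nnegrE ?cabs_ge0 ?(ltW (a0 j))//.
move=> /le_trans; apply.
by rewrite (bigD1 j)//= lerDl sumr_ge0// => i _; exact: ltW.
Qed.

Lemma ellipsoid_coord (z : Cn) j : ellipsoid a z -> cabs (z 0 j) <= \sum_(i < n) a i.
Proof. by rewrite ellipsoidE /= => /ltW; exact: qform_le1_coord. Qed.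

Lemma convex_eball_ellipsoid (c : Cn) (r t : R) (u v : Cn) : 0 <= t <= 1 ->
  (eball c r `&` ellipsoid a) u -> (eball c r `&` ellipsoid a) v ->
  (eball c r `&` ellipsoid a) ((1 - t)%:C%C *: u + t%:C%C *: v).
Proof.
rewrite eballE ellipsoidE => t01 [/= u1 u2] [/= v1 v2]; split => /=; last first.
  exact: qform_conv_lt wgt_ge0 _ _ _.
have -> : (1 - t)%:C%C *: u + t%:C%C *: v - c =
    (1 - t)%:C%C *: (u - c) + t%:C%C *: (v - c).
  apply/rowP => j; rewrite !mxE rmorphB rmorph1; ring.
exact: qform_conv_lt.
Qed.

Section Peak.
Variable w : Cn.
Hypothesis w1 : qform wgt w = 1.

(* [1 - <z, w>] for the inner product of the ellipsoid: it vanishes at the boundary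
   point [w] and has positive real part inside. *)
Definition peak (z : Cn) : C := 1 - \sum_(j < n) z 0 j * (conjc (w 0 j) * (wgt j)%:C%C).

Lemma Re_sum (I : finType) (F : I -> C) :
  complex.Re (\sum_i F i) = \sum_i complex.Re (F i).
Proof. by apply: big_morph => // -[? ?] [? ?]. Qed.

(** Polarization, with [qform wgt w = 1]. Both terms on the right are nonnegative in the ellipsoid:
    the first gives positivity of the real part, the second shows that a small [peak] forces [z] to
    be close to [w]. *)
Lemma Re_peak (z : Cn) : 2 * complex.Re (peak z) = 1 - qform wgt z + qform wgt (z - w).
Proof.
have -> : qform wgt (z - w) = qform wgt z + qform wgt w -
    2 * \sum_(j < n) complex.Re (z 0 j * (conjc (w 0 j) * (wgt j)%:C%C)).
  rewrite /qform mulr_sumr -big_split -sumrB /=; apply: eq_bigr => j _.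
  rewrite !mxE; case: (z 0 j) => x y; case: (w 0 j) => p q; rewrite /cabs2 /=; ring.
rewrite w1 -Re_sum /peak; case: (\sum_(j < n) _) => x y /=; ring.
Qed.

Lemma Re_peak_ge (z : Cn) : (1 - qform wgt z) / 2 <= complex.Re (peak z).
Proof.
have := Re_peak z; have := qform_ge0 (z - w) wgt_ge0; lra.
Qed.

Lemma Re_peak_gt0 (z : Cn) : ellipsoid a z -> 0 < complex.Re (peak z).
Proof. by rewrite ellipsoidE /= => z1; have := Re_peak_ge z; lra. Qed.

Lemma qform_peak (z : Cn) : ellipsoid a z -> qform wgt (z - w) <= 2 * complex.Re (peak z).
Proof. by rewrite ellipsoidE /= => z1; have := Re_peak z; lra. Qed.

(** Passes from the weighted to the Euclidean norm: every semi-axis is at most the sum of all of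
    them, so [1 <= wgt j * (sum of a) ^ 2]. *)
Lemma peak_eball (z : Cn) (d : R) : ellipsoid a z ->
  2 * complex.Re (peak z) * (\sum_(i < n) a i) ^+ 2 < d ^+ 2 -> eball w d z.
Proof.
rewrite eballE => z1 /=; apply: le_lt_trans.
apply: (@le_trans _ _ (qform wgt (z - w) * (\sum_(i < n) a i) ^+ 2)); last first.
  by rewrite ler_wpM2r ?sqr_ge0//; exact: qform_peak.
rewrite /qform mulr_suml; apply: ler_sum => j _.
rewrite -mulrA ler_wpM2l ?cabs2_ge0//.
rewrite /wgt mulrC ler_pdivlMr ?exprn_gt0// mul1r ler_sqr ?nnegrE ?(ltW (a0 j))//.
  by rewrite (bigD1 j)//= lerDl sumr_ge0// => i _; exact: ltW.
by apply: sumr_ge0 => i _; exact: ltW.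
Qed.

(** An affine function vanishing at the centre of a homothety is multiplied by its ratio. *)
Lemma peak_dilate (t : R) (z : Cn) : peak (dilate w t z) = t%:C%C * peak z.
Proof.
have pw : \sum_(j < n) w 0 j * (conjc (w 0 j) * (wgt j)%:C%C) = 1.
  rewrite -[RHS]/((1 : R)%:C%C) -w1 /qform rmorph_sum; apply: eq_bigr => j _ /=.
  by rewrite rmorphM /= mulrA; congr (_ * _); case: (w 0 j) => x y; rewrite /cabs2; apply: complexP => /=; ring.
rewrite /peak mulrBr mulr1 mulr_sumr -[X in X - _]/(1 : C).
rewrite (_ : \sum_j _ = (1 - t)%:C%C * 1 + \sum_(j < n) t%:C%C * (z 0 j * (conjc (w 0 j) * (wgt j)%:C%C))).
  by rewrite rmorphB rmorph1 /=; ring.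
rewrite -pw !mulr_sumr -big_split /=; apply: eq_bigr => j _.
rewrite dilateE !mxE; ring.
Qed.

Lemma dilate_ellipsoid (t : R) (z : Cn) : 0 < t <= 1 -> ellipsoid a z ->
  ellipsoid a (dilate w t z).
Proof.
move=> /andP[t0 t1]; rewrite ellipsoidE /= dilateE qform_conv w1 => z1.
have h : 0 <= t * (1 - t) * qform wgt (w - z).
  by rewrite !mulr_ge0 ?subr_ge0 ?(ltW t0)// qform_ge0//; exact: wgt_ge0.
have : t * qform wgt z < t * 1 by rewrite ltr_pM2l.
by lra.
Qed.

End Peak.
End Omega.
End Ellipsoid_geometry.

(** * Peaking functions at a boundary point *)

Section Peak_functions.
Variables (R : realType) (n : nat).
Local Notation C := (R[i]).
Local Notation Cn := 'rV[C]_n.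

Lemma differentiable_peak (a : 'I_n -> R) (w : Cn) (z : (Cn : normedModType C)) :
  differentiable (peak a w : Cn -> C^o) z.
Proof.
rewrite /peak.
have -> : (fun z : Cn => 1 - \sum_(j < n) z 0 j * (conjc (w 0 j) * (wgt a j)%:C%C)) =
   (cst (1 : C^o)) - \sum_(j < n) ((fun z : (Cn : normedModType C) => (conjc (w 0 j) * (wgt a j)%:C%C) *: (z 0 j : C^o))).
  apply/funext => x /=; rewrite !fctE; congr (_ - _).
  by rewrite fct_sumE; apply: eq_bigr => j _; rewrite mulrC.
apply: differentiableB => //.
apply: differentiable_sum => j.
apply: differentiableZ.
exact: differentiable_coord.
Qed.

Lemma holomorphic_ccontinuous (D : set Cn) (f : Cn -> C^o) :
  holomorphic_on D f -> ccontinuous D f.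
Proof. by move=> h z Dz e e0; apply: differentiable_cabs_cts => //; exact: h. Qed.

Variable a : 'I_n -> R.
Hypothesis a0 : forall j, 0 < a j.
Variable w : Cn.
Hypothesis w1 : qform (wgt a) w = 1.
Local Notation Omega := (ellipsoid a).
Local Notation u := (peak a w).

Definition hump (b : R) (z : Cn) : C := b%:C%C / (b%:C%C + u z).

Lemma cabs_real (x : R) : 0 <= x -> cabs (x%:C%C) = x.
Proof. by move=> x0; rewrite /cabs /cabs2 /= expr0n addr0 sqrtr_sqr ger0_norm. Qed.

Lemma cabsV (z : C) : cabs z^-1 = (cabs z)^-1.
Proof. by rewrite !cabsE Normc.normcV. Qed.

Lemma cabs_ge_Re (b : R) (v : C) : 0 <= b -> 0 <= complex.Re v -> cabs v <= cabs (b%:C%C + v).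
Proof.
move=> b0; case: v => x y /= x0.
rewrite -(ler_sqr (cabs_ge0 _) (cabs_ge0 _)) !sqr_cabs /cabs2 /= add0r lerD2r.
by rewrite ler_sqr ?nnegrE ?addr_ge0// lerDr.
Qed.

Lemma cabs_shift_gt (b : R) (v : C) : 0 < b -> 0 < complex.Re v -> b < cabs (b%:C%C + v).
Proof.
move=> b0 v0; apply: lt_le_trans (normr_Re_le_cabs _).
by case: v v0 => x y /= x0; rewrite ger0_norm ?addr_ge0 ?ltW// ltrDl.
Qed.

Lemma hump_cabs (b : R) z : 0 < b -> cabs (hump b z) = b / cabs (b%:C%C + u z).
Proof. by move=> b0; rewrite cabsM cabsV cabs_real// ltW. Qed.

Lemma hump_le1 (b : R) z : 0 < b -> Omega z -> cabs (hump b z) <= 1.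
Proof.
move=> b0 /(Re_peak_gt0 w1) u0; rewrite hump_cabs//.
have h := cabs_shift_gt b0 u0.
by rewrite ler_pdivrMr ?mul1r ?(ltW h)// (lt_trans b0).
Qed.

Lemma hump_gt0 (b : R) z : 0 < b -> Omega z -> 0 < cabs (hump b z).
Proof.
move=> b0 /(Re_peak_gt0 w1) u0; rewrite hump_cabs// divr_gt0//.
exact: lt_trans (cabs_shift_gt b0 u0).
Qed.

Lemma differentiable_hump (b : R) : 0 < b -> holomorphic_on Omega (hump b : Cn -> C^o).
Proof.
move=> b0 z /(Re_peak_gt0 w1) u0.
have nz : b%:C%C + u z != 0.
  apply/eqP => e; have := cabs_shift_gt b0 u0; rewrite e.
  by rewrite /cabs /cabs2 /= expr0n addr0 sqrtr0 ltNge (ltW b0).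
have dD : differentiable ((cst (b%:C%C : C^o) : Cn -> C^o) + (u : Cn -> C^o)) (z : (Cn : normedModType C)).
  by apply: differentiableD; [exact: differentiable_cst|exact: differentiable_peak].
have dV := differentiableV dD nz.
exact: (differentiableZ b%:C%C dV).
Qed.

Lemma hump_dilate (b t : R) z : 0 < b -> 0 < t -> hump b (dilate w t z) = hump (b / t) z.
Proof.
move=> b0 t0; rewrite /hump peak_dilate//.
have t0' : t%:C%C != 0 :> C by rewrite eq_complex /= eqxx andbT gt_eqF.
have -> : (b / t)%:C%C = b%:C%C / t%:C%C :> C by rewrite rmorphM /= fmorphV.
rewrite -[X in _ = _ / (_ + X)](mulKf t0') -[X in _ / (_ + X)]mulrC -mulrDl.
by rewrite invfM invrK mulrACA mulVf// mulr1.
Qed.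

Lemma Re_hump (b : R) z :
  complex.Re (hump b z) = b * (b + complex.Re (u z)) / cabs (b%:C%C + u z) ^+ 2.
Proof.
rewrite sqr_cabs /hump /cabs2; case: (u z) => x y /=; ring.
Qed.

Lemma Re_hump_ge0 (b : R) z : 0 < b -> Omega z -> 0 <= complex.Re (hump b z).
Proof.
move=> b0 /(Re_peak_gt0 w1) u0; rewrite Re_hump.
by rewrite divr_ge0 ?sqr_ge0// mulr_ge0 ?addr_ge0 ?ltW.
Qed.

Variable K : R.
Hypothesis K0 : 0 < K.

(** In the formula for the real part, the numerator is at least [b ^ 2] and the denominator at most
    [((1 + K) b) ^ 2]. The bound does not depend on [b]. *)
Lemma Re_hump_ge (b : R) z : 0 < b -> Omega z -> cabs (u z) < K * b ->
  (1 + K) ^- 2 <= complex.Re (hump b z).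
Proof.
move=> b0 /(Re_peak_gt0 w1) u0 uK; rewrite Re_hump.
have h := lt_trans b0 (cabs_shift_gt b0 u0).
rewrite ler_pdivlMr ?exprn_gt0// mulrC ler_pdivrMr ?exprn_gt0 ?addr_gt0//.
apply: (@le_trans _ _ (((1 + K) * b) ^+ 2)).
  rewrite ler_sqr ?nnegrE ?(ltW h) ?mulr_ge0 ?addr_ge0 ?(ltW K0) ?(ltW b0)//.
  apply: le_trans (cabsD _ _) _; rewrite cabs_real ?(ltW b0)// mulrDl mul1r lerD2l.
  exact: ltW.
rewrite exprMn mulrC ler_wpM2r ?sqr_ge0// expr2 ler_pM2l//.
by rewrite lerDl ltW.
Qed.

(** The quotient of the two humps is [|2 b + u| / (2 |b + u|)]. Its numerator is at most
    [b + |b + u|], and off the cap [b <= |u| / K <= |b + u| / K]. *)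
Lemma hump_double (b : R) z : 0 < b -> Omega z -> K * b <= cabs (u z) ->
  cabs (hump b z) <= (1 + K^-1) / 2 * cabs (hump (2 * b) z).
Proof.
move=> b0 /(Re_peak_gt0 w1) u0 uK.
have b20 : 0 < 2 * b by rewrite mulr_gt0.
rewrite !hump_cabs//; set x := cabs (b%:C%C + _); set y := cabs (_ + _).
have x0 : 0 < x := lt_trans b0 (cabs_shift_gt b0 u0).
have y0 : 0 < y := lt_trans b20 (cabs_shift_gt b20 u0).
have xK : K * b <= x by rewrite (le_trans uK)// cabs_ge_Re// ltW.
have yx : y <= b + x.
  rewrite /y (_ : (2 * b)%:C%C + u z = b%:C%C + (b%:C%C + u z)).
    by apply: le_trans (cabsD _ _) _; rewrite cabs_real// ltW.
  by case: (u z) => p q; apply: complexP => /=; ring.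
have bx : b <= K^-1 * x by rewrite -[X in X <= _](mulKf (lt0r_neq0 K0)) ler_pM2l ?invr_gt0.
rewrite ler_pdivrMr// (_ : _ * x = b * ((1 + K^-1) * x / y)); last first.
  by field; rewrite gt_eqF// gt_eqF.
rewrite -[leLHS]mulr1 ler_pM2l// ler_pdivlMr// mul1r.
by apply: le_trans yx _; rewrite mulrDl mul1r addrC lerD2l.
Qed.

End Peak_functions.

(** * Hump integrals compared with cap volumes *)

Section Hump_integrals.
Variables (R : realType) (n : nat).
Local Notation C := (R[i]).
Local Notation Cn := 'rV[C]_n.
Local Notation volint := (@volint R n).
Variable a : 'I_n -> R.
Hypothesis a0 : forall j, 0 < a j.
Variable w : Cn.
Hypothesis w1 : qform (wgt a) w = 1.
Local Notation Omega := (ellipsoid a).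
Local Notation u := (peak a w).

Lemma jmeasurable_indic1 (D : set Cn) : copen D -> jmeasurable (fun z => (\1_D z)%:E : \bar R).
Proof.
move=> oD; have := jmeasurable_indic (1 : R) oD; congr (jmeasurable _).
by apply/funext => z; rewrite mulr1.
Qed.

Lemma copen_sublevel (D : set Cn) (f : Cn -> C) (c : R) :
  copen D -> ccontinuous D f -> copen [set z | D z /\ cabs (f z) < c].
Proof.
move=> oD cf z [/= Dz az]; have [e e0 he] := oD _ Dz.
have az0 : 0 < c - cabs (f z) by rewrite subr_gt0.
have [d d0 hd] := cf z Dz _ az0.
exists (Num.min e d); first by rewrite lt_min e0.
move=> v h; split.
  by apply: he => j; have := h j; rewrite lt_min => /andP[].
have : cabs (f v - f z) < c - cabs (f z).
  by apply: hd => j; have := h j; rewrite lt_min => /andP[].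
by have := cabs_dist (f v) (f z); move=> /ler_normlP[]; lra.
Qed.

(* Any exponent above [2 n] would do: dilating about [w] by the factor 2 costs
   [2 ^ (2 n)] in volume and gains [2 ^ decay_exp] in the size of the hump. The ratio
   makes the error [(1 + 1 / cap_ratio) ^ decay_exp] at most 2. *)
Definition decay_exp : nat := (2 * n).+2.
Definition cap_ratio : R := 2 * decay_exp%:R.
Local Notation m := decay_exp.
Local Notation K := cap_ratio.

Definition cap (b : R) : set Cn := [set z | Omega z /\ cabs (u z) < K * b].
Definition hump_pow (r b : R) (z : Cn) : \bar R := (\1_Omega z * cabs (hump a w b z) `^ r)%:E.
Definition hump_int (r b : R) : \bar R := volint (hump_pow r b).
Definition cap_vol (b : R) : \bar R := volint (fun z => (\1_(cap b) z)%:E).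

Lemma cap_ratio_gt0 : 0 < K.
Proof. by rewrite mulr_gt0// ltr0n. Qed.

Lemma bernoulli (x : R) k : 0 <= x <= 1 -> 1 - k%:R * x <= (1 - x) ^+ k.
Proof.
move=> /andP[x0 x1]; elim: k => [|k IH]; first by rewrite expr0 mul0r subr0.
rewrite exprS; apply: (@le_trans _ _ ((1 - x) * (1 - k%:R * x))); last first.
  by rewrite ler_wpM2l// subr_ge0.
have : 0 <= k%:R * x * x by rewrite !mulr_ge0.
by rewrite -natr1; lra.
Qed.

(** With [x = 1 / K], Bernoulli gives [(1 - x) ^ m >= 1 - m / K = 1 / 2], and [(1 + x) (1 - x) <= 1]
    then gives [(1 + x) ^ m <= 2]. What remains is [2 * 2 ^ (2 n) / 2 ^ (2 n + 2) = 1 / 2]. *)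
Lemma cap_ratio_bound : ((1 + K^-1) / 2) ^+ m * 2 ^+ (2 * n) <= 2^-1.
Proof.
have K0 := cap_ratio_gt0; have mK : m%:R * K^-1 = 2^-1.
  by rewrite /K; field; rewrite pnatr_eq0.
have K1 : 0 <= K^-1 <= 1.
  rewrite invr_ge0 (ltW K0)/= invf_le1//.
  by rewrite /K -natrM ler1n.
have h1 := bernoulli m K1; rewrite mK in h1.
have h2 : ((1 + K^-1) * (1 - K^-1)) ^+ m <= 1.
  move: K1 => /andP[k0 k1].
  rewrite exprn_ile1//; first by rewrite mulr_ge0 ?subr_ge0// addr_ge0.
  by rewrite mulrC -subr_sqr expr1n gerBl sqr_ge0.
have h3 : (1 + K^-1) ^+ m <= 2.
  rewrite exprMn in h2; have : 0 <= (1 + K^-1) ^+ m.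
    by rewrite exprn_ge0// addr_ge0//; case/andP: K1.
  by nra.
rewrite expr_div_n mulrAC ler_pdivrMr ?exprn_gt0// [in leRHS]/decay_exp ![in leRHS]exprS.
rewrite -[_ ^+ m]/((1 + K^-1) ^+ decay_exp) [2 * (2 * _)]mulrA mulrA ler_pM2r ?exprn_gt0//; lra.
Qed.

Lemma ccontinuous_peak (D : set Cn) : ccontinuous D u.
Proof. by apply: holomorphic_ccontinuous => z _; exact: differentiable_peak. Qed.

Lemma copen_cap (b : R) : copen (cap b).
Proof. by apply: copen_sublevel; [exact: copen_ellipsoid|exact: ccontinuous_peak]. Qed.

Lemma jmeasurable_hump_pow (r b : R) : 0 < b -> jmeasurable (hump_pow r b).
Proof.
move=> b0; apply: (@jmeasurable_indic_comp _ _ Omega (hump a w b) (@powR R ^~ r)).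
- exact: copen_ellipsoid.
- exact/holomorphic_ccontinuous/differentiable_hump.
- exact: measurable_powR.
Qed.

Lemma hump_pow_ge0 (r b : R) z : (0 <= hump_pow r b z)%E.
Proof. by rewrite lee_fin mulr_ge0// powR_ge0. Qed.

Lemma powR_le1 (x r : R) : 0 <= x <= 1 -> 0 <= r -> x `^ r <= 1.
Proof.
move=> /andP[x0 x1] r0; have -> : 1 = 1 `^ r :> R by rewrite powR1.
by rewrite ge0_ler_powR ?nnegrE.
Qed.

Definition omega_vol : \bar R := volint (fun z => (\1_Omega z)%:E).

Lemma omega_vol_fin : (omega_vol < +oo)%E.
Proof.
apply: (volint_indic_fin (M := \sum_(i < n) a i)); first exact: copen_ellipsoid.
by move=> z j; exact: ellipsoid_coord.
Qed.

Lemma cap_vol_le_omega (b : R) : (cap_vol b <= omega_vol)%E.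
Proof.
apply: le_volint.
- exact/jmeasurable_indic1/copen_cap.
- exact/jmeasurable_indic1/copen_ellipsoid.
- by move=> z; rewrite lee_fin.
- move=> z; rewrite lee_fin !indicE; case: (boolP (z \in cap b)) => //.
  by rewrite inE => -[Oz _]; rewrite mem_set.
Qed.

Lemma hump_int_le_omega (r b : R) : 0 < b -> 0 <= r -> (hump_int r b <= omega_vol)%E.
Proof.
move=> b0 r0; apply: le_volint.
- exact: jmeasurable_hump_pow.
- exact/jmeasurable_indic1/copen_ellipsoid.
- by move=> z; rewrite lee_fin mulr_ge0// powR_ge0.
- move=> z; rewrite lee_fin indicE; case: (boolP (z \in _)); rewrite ?mul0r// mul1r inE => Oz.
  by rewrite powR_le1// cabs_ge0 (hump_le1 w1).
Qed.

(** Both integrals are bounded by the volume of the ellipsoid. Real values are needed because the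
    absorption argument subtracts them. *)
Definition rhump_int r b := fine (hump_int r b).
Definition rcap_vol b := fine (cap_vol b).

Lemma cap_vol_ge0 (b : R) : (0 <= cap_vol b)%E.
Proof. by apply: volint_ge0 => z; rewrite lee_fin. Qed.

Lemma hump_int_ge0 (r b : R) : (0 <= hump_int r b)%E.
Proof. by apply: volint_ge0 => z; exact: hump_pow_ge0. Qed.

Lemma cap_volE (b : R) : cap_vol b = (rcap_vol b)%:E.
Proof.
by rewrite fineK// ge0_fin_numE ?cap_vol_ge0// (le_lt_trans (cap_vol_le_omega b))// omega_vol_fin.
Qed.

Lemma hump_intE (r b : R) : 0 < b -> 0 <= r -> hump_int r b = (rhump_int r b)%:E.
Proof.
move=> b0 r0.
by rewrite fineK// ge0_fin_numE ?hump_int_ge0// (le_lt_trans (hump_int_le_omega b0 r0))// omega_vol_fin.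
Qed.

(** Change of variables by the dilation about [w], which turns parameter [b] into [b / t]. Only an
    inequality results, since the dilation maps the ellipsoid into, not onto, itself. *)
Lemma rhump_int_dilate (r b t : R) : 0 < b -> 0 < t <= 1 -> 0 <= r ->
  t ^+ (2 * n) * rhump_int r (b / t) <= rhump_int r b.
Proof.
move=> b0 /andP[t0 t1] r0; have bt0 : 0 < b / t by rewrite divr_gt0.
have := hump_intE b0 r0; have := hump_intE bt0 r0.
move: (rhump_int r (b / t)) (rhump_int r b) => x y E1 E2.
rewrite -lee_fin EFinM -{}E1 -{}E2.
have mJ := jmeasurable_hump_pow r b0.
rewrite {2}/hump_int (volint_dilate w t0 mJ (@hump_pow_ge0 r b)).
apply: lee_wpmul2l; first by rewrite lee_fin exprn_ge0// ltW.
apply: (le_volint (jmeasurable_hump_pow r bt0) (jmeasurable_dilate w t mJ) (@hump_pow_ge0 _ _)) => z.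
rewrite /hump_pow hump_dilate// lee_fin ler_wpM2r ?powR_ge0// !indicE.
case: (boolP (z \in Omega)) => //; rewrite inE => Oz.
by rewrite mem_set//; apply: dilate_ellipsoid => //; rewrite t0.
Qed.

(** Splits the domain at the cap: inside, the hump is at most 1; outside, [hump_double] applies, and
    [c ^ r <= c ^ m] because [c <= 1] and [m <= r]. *)
Lemma rhump_int_double (r b : R) : 0 < b -> m%:R <= r ->
  rhump_int r b <= rcap_vol b + ((1 + K^-1) / 2) ^+ m * rhump_int r (2 * b).
Proof.
move=> b0 mr; have K0 := cap_ratio_gt0; have r0 : 0 <= r by exact: le_trans mr.
have b20 : 0 < 2 * b by rewrite mulr_gt0.
set c := (_ / 2); have c0 : 0 <= c by rewrite divr_ge0// addr_ge0// invr_ge0 ltW.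
have c1 : c <= 1.
  rewrite ler_pdivrMr// mul1r -[leRHS]natr1 addrC lerD2r invf_le1//.
  by rewrite /K -natrM ler1n.
have := cap_volE b; have := hump_intE b0 r0; have := hump_intE b20 r0.
move: (rhump_int r (2 * b)) (rhump_int r b) (rcap_vol b) => x y l E1 E2 E3.
rewrite -lee_fin EFinD EFinM -{}E1 -{}E2 -{}E3 /hump_int /cap_vol.
have cm0 : 0 <= c ^+ m by rewrite exprn_ge0.
have mL := jmeasurable_indic1 (@copen_cap b).
have mJ := jmeasurable_hump_pow r b0; have mJ2 := jmeasurable_hump_pow r b20.
rewrite -(volintZ cm0 mJ2 (@hump_pow_ge0 _ _)) -(volintD mL (jmeasurableZ _ mJ2)); first last.
- by move=> z; rewrite mule_ge0 ?hump_pow_ge0// lee_fin.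
- by move=> z; rewrite lee_fin.
apply: (le_volint mJ (jmeasurableD mL (jmeasurableZ _ mJ2)) (@hump_pow_ge0 _ _)).
move=> z; rewrite /hump_pow -EFinM -EFinD lee_fin [in leLHS]indicE.
case: (boolP (z \in Omega)); last first.
  by rewrite mul0r => _; rewrite addr_ge0// mulr_ge0// mulr_ge0// powR_ge0.
rewrite inE mul1r => Oz; rewrite [\1_Omega z]indicE mem_set// mul1r.
have [uK|uK] := ltP (cabs (u z)) (K * b).
  rewrite indicE mem_set//= ler_wpDr//.
    by rewrite mulr_ge0 ?exprn_ge0 ?powR_ge0.
  by rewrite powR_le1// cabs_ge0 (hump_le1 w1).
apply: (@le_trans _ _ (c ^+ m * cabs (hump a w (2 * b) z) `^ r)); last by rewrite lerDr.
apply: (@le_trans _ _ ((c * cabs (hump a w (2 * b) z)) `^ r)).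
  apply: ge0_ler_powR => //; rewrite ?nnegrE ?cabs_ge0 ?(mulr_ge0 c0 (cabs_ge0 _))//.
  exact: (hump_double w1).
rewrite powRM ?cabs_ge0// ler_wpM2r ?powR_ge0//.
have [c00|cn0] := eqVneq c 0.
  by rewrite c00 powR0 ?exprn_ge0// gt_eqF// (lt_le_trans _ mr)// ltr0n.
rewrite -powR_mulrn// /powR (negbTE cn0) ler_expR ler_wnM2r//.
by rewrite ln_le0.
Qed.

(* Outside the cap, [hump b] is about half of [hump (2 b)]; as the integral of the
   latter is at most [2 ^ (2 n)] times that of the former, the part outside the cap
   can be absorbed into the left-hand side. *)
Lemma rhump_int_le_rcap_vol (r b : R) : 0 < b -> m%:R <= r -> rhump_int r b <= 2 * rcap_vol b.
Proof.
move=> b0 mr; have r0 : 0 <= r by exact: le_trans mr.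
have h1 := rhump_int_double b0 mr.
have h20 : 0 < (2^-1 : R) <= 1.
  by rewrite invr_gt0 ltr0n/= invf_le1 ?ltr0n// ler1n.
have := rhump_int_dilate b0 h20 r0; rewrite invrK [b * 2]mulrC => h2.
have J0 : 0 <= rhump_int r (2 * b) by rewrite fine_ge0// hump_int_ge0.
have kK := cap_ratio_bound.
move: (rhump_int r b) (rhump_int r (2 * b)) (rcap_vol b) h1 h2 J0 => x y l h1 h2 y0.
have h3 : ((1 + K^-1) / 2) ^+ m * y <= 2^-1 * x.
  apply: (@le_trans _ _ (2^-1 / 2 ^+ (2 * n) * y)).
    by rewrite ler_wpM2r// ler_pdivlMr ?exprn_gt0.
  by rewrite -mulrA ler_pM2l ?invr_gt0// -exprVn.
move: h1 h3; set s := _ * y; lra.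
Qed.

Lemma rcap_vol_homo (b b' : R) : b <= b' -> rcap_vol b <= rcap_vol b'.
Proof.
move=> bb'; rewrite -lee_fin -!cap_volE.
apply: (le_volint (jmeasurable_indic1 (@copen_cap b)) (jmeasurable_indic1 (@copen_cap b'))).
  by move=> z; rewrite lee_fin.
move=> z; rewrite lee_fin !indicE; case: (boolP (z \in cap b)) => //.
rewrite inE => -[Oz uz]; rewrite mem_set//; split => //.
by apply: lt_le_trans uz _; rewrite ler_pM2l// cap_ratio_gt0.
Qed.

Lemma peak_cabs_gt0 z : Omega z -> 0 < cabs (u z).
Proof.
move=> /(Re_peak_gt0 w1) u0; apply: lt_le_trans (normr_Re_le_cabs _).
by rewrite gtr0_norm.
Qed.

(** [peak] has no zero in the ellipsoid, so the complements of the caps increase to the whole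
    ellipsoid; monotone convergence and finiteness of its volume conclude. *)
Lemma rcap_vol_cvg0 (e : R) : 0 < e -> \forall b \near 0^'+, rcap_vol b < e.
Proof.
move=> e0; have K0 := cap_ratio_gt0.
pose b_ (i : nat) : R := i.+1%:R^-1.
have b_0 i : 0 < b_ i by rewrite invr_gt0 ltr0n.
(* The cap volume is monotone in [b], so one member of the sequence [1 / (i + 1)] controls all
   smaller parameters. *)
suff [i hi] : exists i, rcap_vol (b_ i) < e.
  have := nbhs_right_le (b_0 i); apply: filterS => b bi.
  exact: le_lt_trans (rcap_vol_homo bi) hi.
pose G (i : nat) (z : Cn) : \bar R :=
  (\1_Omega z * \1_[set t : R | (K * b_ i <= t)%R] (cabs (u z)))%:E.
have mG i : jmeasurable (G i).
  apply: (@jmeasurable_indic_comp _ _ Omega u (\1_[set t : R | (K * b_ i <= t)%R])).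
  - exact: copen_ellipsoid.
  - exact: ccontinuous_peak.
  - apply: measurable_indic; rewrite (_ : [set t | _] = `[K * b_ i, +oo[%classic)//.
    by apply/seteqP; split => t /=; rewrite in_itv /= andbT.
have G0 i z : (0 <= G i z)%E by rewrite lee_fin mulr_ge0.
have ndG z : {homo G ^~ z : i j / (i <= j)%N >-> (i <= j)%E}.
  move=> i j ij; rewrite /G lee_fin ler_wpM2l// !indicE.
  case: (boolP (_ \in [set t : R | (K * b_ i <= t)%R])) => //; rewrite inE /= => h.
  rewrite mem_set//= (le_trans _ h)// ler_pM2l// lef_pV2 ?posrE ?ltr0n// ler_nat//.
have limG : volint (fun z => limn (G ^~ z)) = limn (fun i => volint (G i)).
  by rewrite /Defs.volint iter_int_monotone.
have ndV : {homo (fun i => volint (G i)) : i j / (i <= j)%N >-> (i <= j)%E}.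
  by move=> i j ij; apply: (le_volint (mG i) (mG j) (G0 i)) => z; exact: ndG.
have limE : (fun z => limn (G ^~ z)) = (fun z => (\1_Omega z)%:E).
  apply/funext => z; apply/cvg_lim => //.
  apply: cvg_near_cst; rewrite /G indicE.
  case: (boolP (z \in Omega)); last by move=> _; apply: nearW => i; rewrite mul0r.
  rewrite inE => /peak_cabs_gt0 uz.
  have := near_infty_natSinv_lt (PosNum (divr_gt0 uz K0)); apply: filterS => i /= h.
  by rewrite mul1r indicE mem_set//= mulrC -ler_pdivlMr// ltW.
rewrite limE -/omega_vol in limG.
have Vsplit i : (volint (G i) + cap_vol (b_ i) = omega_vol)%E.
  rewrite /cap_vol -(volintD (mG i) (jmeasurable_indic1 (@copen_cap _)) (G0 i)); last first.
    by move=> z; rewrite lee_fin.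
  congr (Defs.volint _); apply/funext => z; rewrite /G -EFinD !indicE.
  congr EFin; case: (boolP (z \in Omega)) => Oz; last first.
    by rewrite mul0r add0r memNset// => -[h _]; move: Oz; rewrite mem_set.
  rewrite mul1r; have [h|h] := leP (K * b_ i) (cabs (u z)).
    by rewrite mem_set// memNset ?addr0// => -[_]; rewrite ltNge h.
  by rewrite memNset ?mem_set ?add0r//=; [split => //; exact/set_mem|rewrite leNgt h].
have omE : omega_vol = (fine omega_vol)%:E.
  by rewrite fineK// ge0_fin_numE ?omega_vol_fin// volint_ge0// => z; rewrite lee_fin.
have /lte_lim : ((fine omega_vol - e / 2)%:E < limn (fun i => volint (G i)))%E.
  by rewrite -limG omE lte_fin /= gtrBl divr_gt0.
move=> /(_ ndV (ereal_nondecreasing_is_cvgn ndV)) [i _ /(_ i (leqnn i)) /= hi].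
exists i; have := Vsplit i; rewrite omE cap_volE => h.
have h3 : volint (G i) = (fine (volint (G i)))%:E.
  rewrite fineK// ge0_fin_numE ?volint_ge0//.
  by apply: le_lt_trans omega_vol_fin; rewrite -(Vsplit i) leeDl// cap_vol_ge0.
by move: hi h; rewrite h3 lee_fin -EFinD => hi []; lra.
Qed.

End Hump_integrals.

(** * Choice of the parameters of one hump *)

Section Hump_existence.
Variables (R : realType) (n : nat).
Local Notation C := (R[i]).
Local Notation Cn := 'rV[C]_n.
Local Notation volint := (@volint R n).
Variable a : 'I_n -> R.
Hypothesis a0 : forall j, 0 < a j.
Variable w : Cn.
Hypothesis w1 : qform (wgt a) w = 1.
Local Notation Omega := (ellipsoid a).
Local Notation u := (peak a w).
Local Notation m := (decay_exp n).
Local Notation K := (cap_ratio R n).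
Local Notation rcap_vol := (rcap_vol a w).
Local Notation rhump_int := (rhump_int a w).

Lemma volint0 (G : Cn -> \bar R) : (forall z, G z = 0%E) -> volint G = 0%E.
Proof.
move=> G0; suff E k z : iter_int k G z = 0%E by exact: E.
elim: k z => [|k IH] z /=; first exact: G0.
by apply: integral0_eq => x _; apply: integral0_eq => y _; exact: IH.
Qed.

Lemma ellipsoid0 : Omega 0.
Proof.
rewrite ellipsoidE /= /qform big1 ?ltr01// => j _.
by rewrite mxE /cabs2 /= expr0n addr0 mul0r.
Qed.

Lemma rhump_int_gt0 (r b : R) : 0 < b -> 0 <= r -> 0 < rhump_int r b.
Proof.
move=> b0 r0; rewrite -lte_fin -(hump_intE a0 w1 b0 r0).
have oO : copen Omega by exact: copen_ellipsoid.
have h0 := hump_gt0 w1 b0 ellipsoid0.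
have h20 : 0 < cabs (hump a w b 0) / 2 by rewrite divr_gt0.
have c0 := powR_gt0 r h20.
have := @copen_superlevel _ _ Omega (hump a w b) (cabs (hump a w b 0) / 2) oO
  (holomorphic_ccontinuous (differentiable_hump w1 b0)).
move=> /(_ 0) [].
  by split; [exact: ellipsoid0|rewrite ltr_pdivrMr// ltr_pMr// ltr1n].
move=> e e0 he.
apply: (volint_gt0 (z0 := 0) (jmeasurable_hump_pow w1 r b0) (hump_pow_ge0 _ _ _ _) c0 e0) => z /he [Oz hz].
rewrite /hump_pow lee_fin indicE mem_set// mul1r.
by apply: ge0_ler_powR => //; rewrite ?nnegrE ?cabs_ge0 ?(ltW h20) ?(ltW hz).
Qed.

(** Dilation with ratio [t = b] bounds the hump integral at [b] below by [b ^ (2 n)] times the one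
    at 1, and the cap volume is at least half of the hump integral. *)
Lemma rcap_vol_lower : exists2 c : R, 0 < c & forall b, 0 < b <= 1 -> c * b ^+ (2 * n) <= rcap_vol b.
Proof.
have m0 : 0 <= m%:R :> R by [].
exists (rhump_int m%:R 1 / 2); first by rewrite divr_gt0// rhump_int_gt0.
move=> b /andP[b0 b1].
have h1 := rhump_int_le_rcap_vol a0 w1 b0 (lexx m%:R).
have b01 : 0 < b <= 1 by rewrite b0.
have := rhump_int_dilate a0 w1 b0 b01 m0; rewrite divff ?gt_eqF// => h2.
move: (rhump_int _ _) (rhump_int _ _) (rcap_vol b) h1 h2 => x y l h1; rewrite mulrC => h2.
rewrite mulrAC ler_pdivrMr//; lra.
Qed.

Lemma powRVl (x s : R) : 0 <= x -> x^-1 `^ s = (x `^ s)^-1.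
Proof. by move=> x0; rewrite -powR_inv1// -powRrM mulN1r powRN. Qed.

Lemma powR_small (s e x : R) : 0 < s -> 0 < e -> 0 <= x -> x <= e `^ s^-1 -> x `^ s <= e.
Proof.
move=> s0 e0 x0 xe.
have : x `^ s <= (e `^ s^-1) `^ s.
  by apply: ge0_ler_powR => //; rewrite ?nnegrE ?(ltW s0) ?powR_ge0.
by rewrite -powRrM mulVf ?gt_eqF// powRr1// ltW.
Qed.

Lemma near0_powR_small (s c e : R) : 0 < s -> 0 <= c -> 0 < e ->
  \forall b \near 0^'+, c * b `^ s <= e.
Proof.
move=> s0 c0 e0; have c1 : 0 < c + 1 by rewrite ltr_wpDl.
have ec : 0 < e / (c + 1) by rewrite divr_gt0.
near=> b; have b0 : 0 <= b by near: b; exact: nbhs_right_ge.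
apply: (@le_trans _ _ (c * (e / (c + 1)))).
  rewrite ler_wpM2l// powR_small//; near: b; apply: nbhs_right_le; exact: powR_gt0.
by rewrite mulrA ler_pdivrMr// mulrC ler_pM2l// lerDl.
Unshelve. all: by end_near. Qed.

Lemma rcap_vol_near_powR_small (s c e : R) : 0 < s -> 0 <= c -> 0 < e ->
  \forall b \near 0^'+, c * (rcap_vol b) `^ s <= e.
Proof.
move=> s0 c0 e0; have c1 : 0 < c + 1 by rewrite ltr_wpDl.
have ec : 0 < e / (c + 1) by rewrite divr_gt0.
near=> b.
apply: (@le_trans _ _ (c * (e / (c + 1)))).
  rewrite ler_wpM2l// powR_small//; first by rewrite fine_ge0// cap_vol_ge0.
  apply: ltW; near: b; apply: (rcap_vol_cvg0 a0 w1); exact: powR_gt0.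
by rewrite mulrA ler_pdivrMr// mulrC ler_pM2l// lerDl.
Unshelve. all: by end_near. Qed.

Lemma rcap_vol_near_gt0 : \forall b \near 0^'+, 0 < rcap_vol b.
Proof.
have [c c0 hc] := rcap_vol_lower.
near=> b; have b0 : 0 < b by near: b; exact: nbhs_right_gt.
apply: lt_le_trans (hc b _); first by rewrite mulr_gt0// exprn_gt0.
by rewrite b0/=; near: b; apply: nbhs_right_le.
Unshelve. all: by end_near. Qed.

(* [height q N b] makes [height ^ (m q) * vol (cap b) = N]; its growth as [b -> 0]
   is slow enough since [vol (cap b)] is at least of order [b ^ (2 n)] and [2 n < m q]. *)
Definition height (q : \bar R) (N b : R) : R :=
  if q is EFin q then (N / rcap_vol b) `^ (m%:R * q)^-1 else N.

(** Controls the product of coefficient and parameter of a hump. Away from the boundary a hump is of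
    order [b], so this smallness is what makes the series of humps converge there. *)
Lemma near_height_small (q : \bar R) (N c e : R) : (1 < q)%E -> 0 < N -> 0 < c -> 0 < e ->
  \forall b \near 0^'+, c * height q N b * b <= e.
Proof.
move=> q1 N0 c0 e0; case: q q1 => [q||] q1 //=; last first.
  have := @near0_powR_small 1 (c * N) e ltr01 (ltac:(by rewrite mulr_ge0 ?ltW)) e0.
  apply: filterS2 (nbhs_right_ge 0) => b b0.
  by rewrite powRr1.
have q1' : 1 < q by rewrite -lte_fin.
have mq0 : 0 < m%:R * q by rewrite mulr_gt0 ?ltr0n// (lt_trans _ q1').
have [k k0 hk] := rcap_vol_lower.
pose s := (m%:R * q)^-1; have s0 : 0 < s by rewrite invr_gt0.
have ns : 0 < 1 - (2 * n)%:R * s.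
  rewrite subr_gt0 ltr_pdivrMr// mul1r; apply: (@lt_trans _ _ m%:R).
    by rewrite ltr_nat.
  by rewrite ltr_pMr// ltr0n.
have C0 : 0 <= c * (N / k) `^ s by rewrite mulr_ge0 ?(ltW c0)// powR_ge0.
near=> b; have b0 : 0 < b by near: b; exact: nbhs_right_gt.
have b1 : b <= 1 by near: b; exact: nbhs_right_le.
apply: (@le_trans _ _ (c * (N / k) `^ s * b `^ (1 - (2 * n)%:R * s))); last first.
  by near: b; exact: near0_powR_small.
rewrite -/s -!mulrA ler_pM2l// powRD ?gt_eqF ?implybT//.
rewrite powRr1 ?(ltW b0)// [b * _]mulrC mulrA ler_pM2r//.
have bn0 : 0 < b ^+ (2 * n) by rewrite exprn_gt0.
have L0 : 0 < rcap_vol b by apply: lt_le_trans (hk b _); [rewrite mulr_gt0|rewrite b0].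
apply: (@le_trans _ _ ((N / (k * b ^+ (2 * n))) `^ s)).
  apply: ge0_ler_powR; rewrite ?nnegrE ?(ltW s0) ?divr_ge0 ?mulr_ge0 ?(ltW N0) ?(ltW L0) ?(ltW k0) ?(ltW bn0)//.
  rewrite ler_pM2l// lef_pV2 ?posrE ?mulr_gt0//.
  by apply: hk; rewrite b0.
rewrite invfM mulrA powRM ?divr_ge0 ?invr_ge0 ?(ltW N0) ?(ltW k0) ?(ltW bn0)//.
by rewrite powRN powRrM -powR_mulrn ?(ltW b0)// powRVl ?powR_ge0.
Unshelve. all: by end_near. Qed.

(** After bounding the hump integral by the cap volume, a constant times [vol ^ (1 - p / q)]
    remains, which tends to 0 because [p < q]. For [q = +oo] the height is constant and the volume
    alone tends to 0. *)
Lemma near_height_int (q : \bar R) (N c p e : R) : (1 < q)%E -> 0 < N -> 0 < c ->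
  1 <= p -> (p%:E < q)%E -> 0 < e ->
  \forall b \near 0^'+, (c * height q N b) `^ (m%:R * p) * rhump_int (m%:R * p) b <= e.
Proof.
move=> q1 N0 c0 p1 pq e0.
have p0 : 0 < p := lt_le_trans ltr01 p1.
have mp : m%:R <= m%:R * p by rewrite ler_pMr// ltr0n.
suff : \forall b \near 0^'+, (c * height q N b) `^ (m%:R * p) * (2 * rcap_vol b) <= e.
  apply: filterS2 (nbhs_right_gt 0) => b b0; apply: le_trans.
  by rewrite ler_wpM2l ?powR_ge0//; exact: rhump_int_le_rcap_vol.
case: q q1 pq => [q||] q1 pq //=; last first.
  have := @rcap_vol_near_powR_small 1 ((c * N) `^ (m%:R * p) * 2) e ltr01
    (ltac:(by rewrite mulr_ge0 ?powR_ge0)) e0.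
  apply: filterS => b; rewrite powRr1; first by rewrite mulrA.
  by rewrite fine_ge0// cap_vol_ge0.
have pq' : p < q by rewrite -lte_fin.
have q0 : 0 < q := lt_trans p0 pq'.
pose s := p / q; have s1 : 0 < 1 - s by rewrite subr_gt0 ltr_pdivrMr// mul1r.
have := @rcap_vol_near_powR_small (1 - s) (c `^ (m%:R * p) * 2 * N `^ s) e s1
  (ltac:(by rewrite !mulr_ge0 ?powR_ge0)) e0.
apply: filterS2 rcap_vol_near_gt0 => b L0; apply: le_trans.
rewrite powRM ?powR_ge0 ?(ltW c0)//.
have -> : ((N / rcap_vol b) `^ (m%:R * q)^-1) `^ (m%:R * p) = (N / rcap_vol b) `^ s.
  rewrite -powRrM; congr (_ `^ _); rewrite /s; field.
  by rewrite pnatr_eq0 gt_eqF.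
rewrite powRM ?invr_ge0 ?(ltW N0) ?(ltW L0)//.
rewrite powRD ?gt_eqF ?implybT// powRr1 ?(ltW L0)//.
rewrite powRN powRVl ?(ltW L0)//.
by rewrite le_eqVlt; apply/orP; left; apply/eqP; ring.
Qed.

Lemma near_cap_eball (d : R) : 0 < d -> \forall b \near 0^'+, cap a w b `<=` eball w d.
Proof.
move=> d0; have K0 := cap_ratio_gt0 R n.
pose A := \sum_(i < n) a i.
have A0 : 0 <= A by apply: sumr_ge0 => i _; exact: ltW.
have A1 : 0 < 2 * K * A ^+ 2 + 1 by rewrite ltr_wpDl// !mulr_ge0 ?sqr_ge0 ?(ltW K0).
have h0 : 0 < d ^+ 2 / (2 * K * A ^+ 2 + 1) by rewrite divr_gt0// exprn_gt0.
apply: filterS2 (nbhs_right_gt 0) (nbhs_right_le h0) => b b0 hb z [Oz uz].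
apply: (peak_eball a0 w1) => //; rewrite -/A.
apply: (@le_lt_trans _ _ (2 * (K * b) * A ^+ 2)).
  rewrite ler_wpM2r ?sqr_ge0// ler_pM2l//; apply: ltW; apply: le_lt_trans uz.
  exact: le_trans (ler_norm _) (normr_Re_le_cabs _).
apply: (@lt_le_trans _ _ (b * (2 * K * A ^+ 2 + 1))); last by rewrite -ler_pdivlMr.
by rewrite mulrDr mulr1 [X in X < _](_ : _ = b * (2 * K * A ^+ 2)) ?ltrDl//; ring.
Qed.

Lemma cap_nonempty (b : R) : 0 < b -> 0 < rcap_vol b -> cap a w b !=set0.
Proof.
move=> b0 L0; apply/set0P/eqP => e.
have : cap_vol a w b = 0%E.
  by rewrite /cap_vol e; apply: volint0 => z; rewrite indic0.
by rewrite (cap_volE a0) => -[] /eqP; rewrite gt_eqF.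
Qed.

(** Each requirement holds for all small [b > 0], so the filter at [0^'+] provides one [b] for all
    of them. The exponents form a finite family because only then can they be treated
    simultaneously. *)
Lemma hump_exists (q : \bar R) k (p : 'I_k -> R) (N d e : R) :
  (1 < q)%E -> (forall i, 1 <= p i) -> (forall i, ((p i)%:E < q)%E) ->
  0 < N -> 0 < d -> 0 < e ->
  exists lam b v : R, [/\ 0 < lam, 0 < b & 0 < v] /\
   [/\ lam * b <= e,
       forall i, (volint (fun z => (\1_Omega z *
          (lam * cabs (hump a w b z)) `^ (m%:R * p i))%:E) <= e%:E)%E,
       cap a w b `<=` eball w d & cap a w b !=set0] /\
   (forall z, cap a w b z -> v <= lam * complex.Re (hump a w b z)) /\
   (if q is EFin q then (N%:E <= (v `^ (m%:R * q))%:E * cap_vol a w b)%E else N <= v).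
Proof.
move=> q1 p1 pq N0 d0 e0; have K0 := cap_ratio_gt0 R n.
(* This factor cancels the lower bound [(1 + K) ^- 2] of the real part on the cap, so that the
   height itself can serve as [v]. *)
pose c := (1 + K) ^+ 2; have c0 : 0 < c by rewrite exprn_gt0// addr_gt0.
have : \forall b \near 0^'+, [/\ 0 < b, 0 < rcap_vol b, c * height q N b * b <= e,
   forall i, (c * height q N b) `^ (m%:R * p i) * rhump_int (m%:R * p i) b <= e &
   cap a w b `<=` eball w d].
  near=> b; split.
  - by near: b; exact: nbhs_right_gt.
  - by near: b; exact: rcap_vol_near_gt0.
  - by near: b; exact: near_height_small.
  - by near: b; apply: filter_forall => i; exact: near_height_int.
  - by near: b; exact: near_cap_eball.
move=> /filter_ex [b [b0 L0 h1 h2 h3]].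
have v0 : 0 < height q N b by rewrite /height; case: (q) => // q'; rewrite powR_gt0// divr_gt0.
exists (c * height q N b), b, (height q N b); split; first by split => //; rewrite mulr_gt0.
have l0 : 0 <= c * height q N b by rewrite mulr_ge0 ?(ltW c0) ?(ltW v0).
split.
  split => //; last exact: cap_nonempty.
  move=> i; have := h2 i.
  have r0 : 0 <= m%:R * p i by rewrite mulr_ge0 ?(le_trans ler01 (p1 i)).
  rewrite -lee_fin EFinM -(hump_intE a0 w1 b0 r0) /hump_int.
  rewrite -(volintZ (powR_ge0 _ _) (jmeasurable_hump_pow w1 _ b0) (hump_pow_ge0 _ _ _ _)).
  apply: le_trans; rewrite le_eqVlt; apply/orP; left; apply/eqP; congr (Defs.volint _).
  apply/funext => z; rewrite /hump_pow -EFinM powRM ?cabs_ge0//; congr EFin; ring.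
split.
  move=> z [Oz uz].
  have := Re_hump_ge w1 K0 b0 Oz uz; set x := complex.Re _ => hx.
  rewrite mulrAC -[leLHS]mul1r ler_wpM2r ?(ltW v0)//.
  by rewrite -ler_pdivrMl// mulr1.
case: q q1 pq h1 h2 v0 l0 => [q||] q1 pq h1 h2 v0 l0 //=.
rewrite (cap_volE a0) -EFinM lee_fin -powRrM mulVf ?powRr1 ?divfK ?gt_eqF//.
  by rewrite divr_ge0 ?ltW.
by rewrite mulr_gt0 ?ltr0n// (lt_trans ltr01)// -lte_fin.
Unshelve. all: by end_near. Qed.

End Hump_existence.

(** * Series of humps *)

Section Differentiability_criterion.
Variables (R : realType) (n : nat).
Local Notation C := (R[i]).
Local Notation Cn := 'rV[C]_n.

Lemma coord_le_norm (v : Cn) j : `|v 0 j| <= `|v|.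
Proof.
have := @mx_norm_ball C 1 n.
move=> /(congr1 (fun f => f 0 (`|v 0 j|) v)) e.
rewrite real_leNgt ?normr_real//; apply/negP => h.
have : ball 0 `|v 0 j| v by rewrite e /ball_ /= sub0r normrN.
by move=> [_ /(_ 0 j)]; rewrite -ball_normE /ball_ /= mxE sub0r normrN ltxx.
Qed.

Lemma norm_lt_coord (v : Cn) (e : R) : 0 < e ->
  (forall j, cabs (v 0 j) < e) -> `|v| < e%:C%C.
Proof.
move=> e0 h; have := @mx_norm_ball C 1 n.
move=> /(congr1 (fun f => f 0 (e%:C%C) v)) E.
suff : ball 0 e%:C%C v by rewrite E /ball_ /= sub0r normrN.
split; first by rewrite ltcR.
by move=> i j; rewrite (ord1 i) -ball_normE /ball_ /= mxE sub0r normrN normcE ltcR.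
Qed.

(* The differential of [g] at [z] is then zero. *)
Lemma differentiable_quadratic (g : Cn -> C^o) (z : Cn) (K d : R) : 0 < d ->
  (forall (v : Cn) (t : R), 0 <= t <= d -> (forall j, cabs (v 0 j) <= t) ->
     cabs (g (z + v) - g z) <= K * t ^+ 2) ->
  differentiable g (z : (Cn : normedModType C)).
Proof.
move=> d0 h.
pose df : {linear (Cn : normedModType C) -> C^o} := \0%R.
have cdf : continuous df by move=> x; exact: cst_continuous.
have hdf : g \o shift (z : (Cn : normedModType C)) = cst (g z) + df +o_ (0 : (Cn : normedModType C)) id.
  apply/eqaddoP => e e0.
  have [r [r0 ->]] : exists r : R, 0 < r /\ e = r%:C%C.
    by exists (complex.Re e); move: e e0 => [x y] /=; rewrite ltcE /= => /andP[/eqP -> x0].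
  have K1 : 0 < `|K| + 1 by rewrite ltr_wpDl.
  apply/nbhs_CnP; exists (Num.min d (r / (`|K| + 1))); first by rewrite lt_min d0 divr_gt0.
  set s := Num.min _ _ => v hv.
  have s0 : 0 < s by rewrite lt_min d0 divr_gt0.
  have {hv} vs : `|v| < s%:C%C.
    by apply: norm_lt_coord => // j; have := hv j; rewrite mxE subr0.
  (* The norm of [Cn] takes values in [R[i]] but is real; [t] is the corresponding real number. *)
  pose t := complex.Re `|v|.
  have tE : `|v| = t%:C%C.
    have : 0 <= `|v| by []. 
    by rewrite /t; case: `|v| => x y; rewrite lecE /= => /andP[/eqP ->].
  have ts : t < s by rewrite -ltcR -tE.
  have vt j : cabs (v 0 j) <= t by rewrite -lecR -normcE -tE coord_le_norm.
  have t0 : 0 <= t.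
    by have : 0 <= `|v| by []; rewrite tE lecE /= => /andP[].
  have td : t <= d by rewrite (le_trans (ltW ts))// ge_min lexx.
  have := h v t (introT andP (conj t0 td)) vt.
  rewrite !fctE /= addr0 [v + z]addrC tE normcE -rmorphM lecR => /le_trans; apply.
  rewrite expr2 mulrA ler_wpM2r//.
  apply: (@le_trans _ _ ((`|K| + 1) * t)).
    by rewrite ler_wpM2r// (le_trans (ler_norm _))// lerDl.
  rewrite mulrC -ler_pdivlMr// (le_trans (ltW ts))// ge_min lexx orbT//.
have dE := diff_unique cdf hdf.
by apply/diff_locallyP; rewrite dE.
Qed.

End Differentiability_criterion.

(** * Series dominated by a geometric series *)

Section Geometric_sums.
Variable R : realType.
Local Notation C := (R[i]).

Definition rsum (x : nat -> R) : R := limn (series x).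
Definition rgeo (M : R) (x : nat -> R) : Prop := forall k, `|x k| <= M * 2^-1 ^+ k.

Lemma rgeo_ge0 M x : rgeo M x -> 0 <= M.
Proof. by move=> /(_ 0%N); rewrite expr0 mulr1; apply: le_trans. Qed.

Lemma cvg_geometric2 (M : R) : series (geometric M 2^-1) @ \oo --> M * 2.
Proof.
have h : `|2^-1 : R| < 1 by rewrite ger0_norm ?invr_ge0// invf_lt1// ltr1n.
have := @cvg_geometric_series _ M _ h.
by rewrite (_ : 1 - 2^-1 = 2^-1 :> R) ?invrK//; field.
Qed.

Lemma rgeo_normed M x : rgeo M x -> cvgn [normed series x].
Proof.
move=> h; apply: (@series_le_cvg _ _ (geometric M 2^-1)) => //.
- by move=> k; exact: normr_ge0.
- by move=> k /=; rewrite mulr_ge0 ?exprn_ge0 ?invr_ge0//; exact: rgeo_ge0 h.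
- by apply/cvg_ex; exists (M * 2); exact: cvg_geometric2.
Qed.

Lemma rgeo_cvg M x : rgeo M x -> cvgn (series x).
Proof. by move=> /rgeo_normed; exact: normed_cvg. Qed.

Lemma rsum_le M x : rgeo M x -> `|rsum x| <= M * 2.
Proof.
move=> h; apply: le_trans (lim_series_norm (rgeo_normed h)) _.
have -> : M * 2 = limn (series (geometric M 2^-1)).
  by apply/esym/cvg_lim => //; exact: cvg_geometric2.
apply: lim_series_le; first exact: rgeo_normed h.
  by apply/cvg_ex; exists (M * 2); exact: cvg_geometric2.
exact: h.
Qed.

Lemma rsumD M N x y : rgeo M x -> rgeo N y ->
  rsum (fun k => x k + y k) = rsum x + rsum y.
Proof. by move=> hx hy; rewrite /rsum -lim_seriesD//; [exact: rgeo_cvg hx|exact: rgeo_cvg hy]. Qed.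

Lemma rsumZ M x c : rgeo M x -> rsum (fun k => c * x k) = c * rsum x.
Proof. by move=> hx; rewrite /rsum -[RHS]lim_seriesZ//; exact: rgeo_cvg hx. Qed.

Lemma rgeoZ M x c : rgeo M x -> rgeo (`|c| * M) (fun k => c * x k).
Proof. by move=> h k; rewrite normrM -mulrA ler_wpM2l. Qed.

Lemma rsumB M N x y : rgeo M x -> rgeo N y ->
  rsum (fun k => x k - y k) = rsum x - rsum y.
Proof. by move=> hx hy; rewrite /rsum -lim_seriesB//; [exact: rgeo_cvg hx|exact: rgeo_cvg hy]. Qed.

Lemma rsum_ge_term M x j : rgeo M x -> (forall k, 0 <= x k) -> x j <= rsum x.
Proof.
move=> hx x0; apply: (@le_trans _ _ (series x j.+1)).
  rewrite /series /= big_nat_recr//= lerDr; apply: sumr_ge0 => i _; exact: x0.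
apply: nondecreasing_cvgn_le; last exact: rgeo_cvg hx.
by apply/nondecreasing_seqP => k; rewrite /series /= [leRHS]big_nat_recr//= lerDl.
Qed.

(** Summing real and imaginary parts separately lets the theory of real series apply, and makes the
    real part of the sum available by definition for the positivity argument. *)
Definition csum (x : nat -> C) : C :=
  (rsum (fun k => complex.Re (x k)) +i* rsum (fun k => complex.Im (x k)))%C.
Definition cgeo (M : R) (x : nat -> C) : Prop := forall k, cabs (x k) <= M * 2^-1 ^+ k.

Lemma cgeo_Re M x : cgeo M x -> rgeo M (fun k => complex.Re (x k)).
Proof. by move=> h k; apply: le_trans (normr_Re_le_cabs _) (h k). Qed.

Lemma cgeo_Im M x : cgeo M x -> rgeo M (fun k => complex.Im (x k)).
Proof. by move=> h k; apply: le_trans (normr_Im_le_cabs _) (h k). Qed.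

(** The 4 is twice the geometric sum 2, once for the real and once for the imaginary part. *)
Lemma csum_le M x : cgeo M x -> cabs (csum x) <= M * 4.
Proof.
move=> h; apply: le_trans (cabs_le_ReIm _) _.
have := rsum_le (cgeo_Re h); have := rsum_le (cgeo_Im h); rewrite /csum /=; lra.
Qed.

Lemma cgeoB M N x y : cgeo M x -> cgeo N y -> cgeo (M + N) (fun k => x k - y k).
Proof.
move=> hx hy k; apply: le_trans (cabsD _ _) _.
by rewrite cabsN mulrDl lerD.
Qed.

Lemma csumB M N x y : cgeo M x -> cgeo N y ->
  csum (fun k => x k - y k) = csum x - csum y.
Proof.
move=> hx hy; apply: complexP => /=.
  rewrite -(rsumB (cgeo_Re hx) (cgeo_Re hy)); congr rsum; apply/funext => k.
  by case: (x k); case: (y k).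
rewrite -(rsumB (cgeo_Im hx) (cgeo_Im hy)); congr rsum; apply/funext => k.
by case: (x k); case: (y k).
Qed.

Lemma csumD M N x y : cgeo M x -> cgeo N y ->
  csum (fun k => x k + y k) = csum x + csum y.
Proof.
move=> hx hy; apply: complexP => /=.
  rewrite -(rsumD (cgeo_Re hx) (cgeo_Re hy)); congr rsum; apply/funext => k.
  by case: (x k); case: (y k).
rewrite -(rsumD (cgeo_Im hx) (cgeo_Im hy)); congr rsum; apply/funext => k.
by case: (x k); case: (y k).
Qed.

Lemma csumZ M x c : cgeo M x -> csum (fun k => c * x k) = c * csum x.
Proof.
case: c => p q h; have hR := cgeo_Re h; have hI := cgeo_Im h.
apply: complexP => /=.
  rewrite -(rsumZ p hR) -(rsumZ q hI) -(rsumB (rgeoZ p hR) (rgeoZ q hI)).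
  by congr rsum; apply/funext => k; case: (x k).
rewrite -(rsumZ p hI) -(rsumZ q hR) -(rsumD (rgeoZ p hI) (rgeoZ q hR)).
by congr rsum; apply/funext => k; case: (x k).
Qed.

Lemma cgeoZ M x c : cgeo M x -> cgeo (cabs c * M) (fun k => c * x k).
Proof. by move=> h k; rewrite cabsM -mulrA ler_wpM2l// cabs_ge0. Qed.

Lemma csum_big_ord p (M : 'I_p -> R) (c : 'I_p -> C) (x : 'I_p -> nat -> C) :
  (forall j, cgeo (M j) (x j)) ->
  csum (fun k => \sum_(j < p) c j * x j k) = \sum_(j < p) c j * csum (x j).
Proof.
move=> h.
(* The induction must also carry a geometric bound for the partial combination, because [csumD]
   requires one for both summands. *)
suff [N [_ ->]] : exists N, cgeo N (fun k => \sum_(j < p) c j * x j k) /\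
    csum (fun k => \sum_(j < p) c j * x j k) = \sum_(j < p) c j * csum (x j) by [].
elim: p M c x h => [|p IH] M c x h.
  exists 0; split.
    by move=> k; rewrite big_ord0 mul0r /cabs /cabs2 /= expr0n addr0 sqrtr0.
  rewrite big_ord0; under [in LHS]eq_fun do rewrite big_ord0.
  have e : rsum (fun=> 0 : R) = 0.
    by have /rsum_le : rgeo 0 (fun=> 0 : R); [move=> k; rewrite normr0 mul0r|rewrite mul0r normr_le0 => /eqP].
  by rewrite /csum /= e.
have [N [hN E]] := IH _ (fun j => c (lift ord0 j)) (fun j => x (lift ord0 j)) (fun j => h (lift ord0 j)).
have h0 := cgeoZ (c ord0) (h ord0).
exists (cabs (c ord0) * M ord0 + N); split.
  by move=> k; rewrite big_ord_recl (le_trans (cabsD _ _))// mulrDl lerD// h0.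
under [in LHS]eq_fun do rewrite big_ord_recl.
by rewrite (csumD h0 hN) big_ord_recl E (csumZ _ (h ord0)).
Qed.

Lemma nneseries_ge_term (x : nat -> \bar R) k :
  (forall i, (0 <= x i)%E) -> (x k <= \sum_(i <oo) x i)%E.
Proof.
move=> x0; apply: le_trans (nneseries_lim_ge k.+1 _) => //.
by rewrite big_nat_recr//= leeDr// sume_ge0.
Qed.

Lemma sum_geometric2 (K : nat) : \sum_(0 <= k < K) (2^-1 : R) ^+ k <= 2.
Proof.
suff -> : \sum_(0 <= k < K) (2^-1 : R) ^+ k = 2 - 2 * 2^-1 ^+ K.
  by rewrite gerBl mulr_ge0// exprn_ge0// invr_ge0.
elim: K => [|K IH]; first by rewrite big_nil expr0 mulr1 subrr.
by rewrite big_nat_recr//= IH exprS mulrA mulfV// mul1r; ring.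
Qed.

Lemma nneseries_geo_le (M : R) (x : nat -> \bar R) : 0 <= M ->
  (forall k, (0 <= x k)%E) -> (forall k, (x k <= (M * 2^-1 ^+ k)%:E)%E) ->
  (\sum_(k <oo) x k <= (M * 2)%:E)%E.
Proof.
move=> M0 x0 xM; apply: lime_le; first exact: is_cvg_nneseries.
apply: nearW => K; apply: (@le_trans _ _ (\sum_(0 <= k < K) (M * 2^-1 ^+ k)%:E)%E).
  by apply: lee_sum => k _; exact: xM.
by rewrite sumEFin lee_fin -mulr_sumr ler_wpM2l// sum_geometric2.
Qed.

(** The finitely many early terms go into the constant of a geometric bound. This is needed because
    the [k]-th hump is small in the [j]-th norm only for [k >= j]. *)
Lemma nneseries_eventually_geo (j : nat) (x : nat -> \bar R) :
  (forall k, (0 <= x k)%E) -> (forall k, (x k < +oo)%E) ->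
  (forall k, (j <= k)%N -> (x k <= (2^-1 ^+ k)%:E)%E) ->
  (\sum_(k <oo) x k < +oo)%E.
Proof.
move=> x0 xfin xj.
suff [M [M0 hM]] : exists M : R, 0 <= M /\ forall k, (x k <= (M * 2^-1 ^+ k)%:E)%E.
  by apply: le_lt_trans (nneseries_geo_le M0 x0 hM) _; exact: ltry.
pose y k := fine (x k) * 2 ^+ k.
have xE k : x k = (y k * 2^-1 ^+ k)%:E.
  rewrite /y exprVn mulfK ?expf_neq0// fineK// ge0_fin_numE//.
have y0 k : 0 <= y k by rewrite mulr_ge0 ?fine_ge0// exprn_ge0.
exists (1 + \sum_(i < j) y i); split; first by rewrite addr_ge0// sumr_ge0.
move=> k; have [kj|jk] := ltnP k j.
  rewrite xE lee_fin ler_wpM2r ?exprn_ge0 ?invr_ge0//.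
  rewrite (bigD1 (Ordinal kj))//= addrCA lerDl addr_ge0// sumr_ge0//.
apply: le_trans (xj _ jk) _; rewrite lee_fin -[leLHS]mul1r.
by rewrite ler_wpM2r ?exprn_ge0 ?invr_ge0// lerDl sumr_ge0.
Qed.

End Geometric_sums.

(** * Holomorphy and size of a sum of humps *)

Section Sum_of_humps.
Variables (R : realType) (n : nat).
Local Notation C := (R[i]).
Local Notation Cn := 'rV[C]_n.
Variable a : 'I_n -> R.
Hypothesis a0 : forall j, 0 < a j.
Local Notation Omega := (ellipsoid a).
Variables (w : nat -> Cn) (lam b : nat -> R).
Hypothesis w1 : forall k, qform (wgt a) (w k) = 1.
Hypothesis lam0 : forall k, 0 < lam k.
Hypothesis b0 : forall k, 0 < b k.
Hypothesis lamb : forall k, lam k * b k <= 2^-1 ^+ k.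

Definition hsummand (k : nat) (z : Cn) : C := (lam k)%:C%C * hump a (w k) (b k) z.
Definition hsum (z : Cn) : C := csum (hsummand ^~ z).

(** Each summand is [c k / A k z] with [A k] affine. The [s k j] are, up to sign, the coefficients
    of [A k]; [S j] and [B] bound them independently of [k]. *)
Let A k (z : Cn) : C := (b k)%:C%C + peak a (w k) z.
Let c k : R := lam k * b k.
Let S j : R := (\sum_(i < n) a i) * wgt a j.
Let B : R := \sum_(j < n) S j.
Let s k j : C := conjc (w k 0 j) * (wgt a j)%:C%C.

Lemma cabsJ (z : C) : cabs (conjc z) = cabs z.
Proof. by case: z => x y; rewrite /cabs /cabs2 /= sqrrN. Qed.

Let sS k j : cabs (s k j) <= S j.
Proof.
rewrite /s /S cabsM cabsJ cabs_real ?wgt_ge0// ler_wpM2r ?wgt_ge0//.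
by apply: (qform_le1_coord a0); rewrite w1.
Qed.

Let S0 j : 0 <= S j.
Proof. exact: le_trans (cabs_ge0 _) (sS 0 j). Qed.

Let B0 : 0 <= B.
Proof. by apply: sumr_ge0 => j _; exact: S0. Qed.

Let hsummandE k z : hsummand k z = (c k)%:C%C / A k z.
Proof. by rewrite /hsummand /hump mulrA -rmorphM. Qed.

Let c0 k : 0 <= c k.
Proof. by rewrite mulr_ge0 ?ltW. Qed.

Lemma cabs_sum (I : finType) (F : I -> C) : cabs (\sum_i F i) <= \sum_i cabs (F i).
Proof.
elim/big_ind2 : _ => //; first by rewrite /cabs /cabs2 /= expr0n addr0 sqrtr0.
by move=> x1 x2 y1 y2 h1 h2; rewrite (le_trans (cabsD _ _))// lerD.
Qed.

Let ell_le k (v : Cn) t : (forall j, cabs (v 0 j) <= t) ->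
  cabs (\sum_(j < n) v 0 j * s k j) <= B * t.
Proof.
move=> h; apply: le_trans (cabs_sum _) _; rewrite /B mulr_suml; apply: ler_sum => j _.
by rewrite cabsM mulrC; apply: ler_pM; rewrite ?cabs_ge0.
Qed.

Let A_shift k z v : A k (z + v) = A k z - \sum_(j < n) v 0 j * s k j.
Proof.
rewrite /A /peak -!addrA; congr (_ + (_ + _)); rewrite -opprD -big_split /=.
by congr (- _); apply: eq_bigr => j _; rewrite mxE mulrDl.
Qed.

(** A lower bound for all denominators [A k z] at once, positive in the ellipsoid. *)
Let rho z : R := (1 - qform (wgt a) z) / 2.

Let A_ge k z : rho z <= cabs (A k z).
Proof.
apply: le_trans (Re_peak_ge (w1 k) z) _; rewrite /A.
apply: le_trans (le_trans (ler_norm _) (normr_Re_le_cabs _)).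
by case: (peak _ _ _) => x y /=; rewrite lerDr ltW.
Qed.

(** The series itself, its termwise derivative and its remainder all have this shape; the geometric
    factor always comes from [c k]. *)
Let quot_cgeo (x : nat -> C) (y : nat -> C) (M N : R) : 0 < N -> 0 <= M ->
  (forall k, cabs (x k) <= M) -> (forall k, N <= cabs (y k)) ->
  cgeo (M / N) (fun k => (c k)%:C%C * x k / y k).
Proof.
move=> N0 M0 hx hy k; rewrite !cabsM cabsV (cabs_real (c0 k)).
move: (c k) (c0 k) (lamb k : c k <= _) => e e0 e1.
apply: (@le_trans _ _ (2^-1 ^+ k * M / N)); last by rewrite -mulrA mulrC.
apply: ler_pM; rewrite ?invr_ge0 ?cabs_ge0 ?(mulr_ge0 e0 (cabs_ge0 _))//.
  by apply: ler_pM; rewrite ?cabs_ge0.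
by rewrite lef_pV2 ?posrE// (lt_le_trans N0).
Qed.

Lemma cgeo_hsummand_of (z : Cn) (N : R) : 0 < N -> (forall k, N <= cabs (A k z)) ->
  cgeo N^-1 (hsummand ^~ z).
Proof.
move=> N0 hN; rewrite -[N^-1]mul1r.
have -> : hsummand ^~ z = (fun k => (c k)%:C%C * 1 / A k z).
  by apply/funext => k; rewrite mulr1 hsummandE.
apply: quot_cgeo => // k; rewrite -[1 in leLHS]/((1 : R)%:C%C) cabs_real//.
Qed.

Lemma cgeo_hsummand (z : Cn) : Omega z -> cgeo (rho z)^-1 (hsummand ^~ z).
Proof.
rewrite ellipsoidE /= => z1; apply: cgeo_hsummand_of => [|k]; last exact: A_ge.
by rewrite divr_gt0// subr_gt0.
Qed.

(** With [l] the increment, [1 / (A - l) - 1 / A - l / A ^ 2 = l ^ 2 / (A ^ 2 (A - l))]. The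
    denominators are bounded below uniformly in [k], so the remainders sum to something quadratic in
    the increment. Subtracting the linear part from [hsum] then leaves a function to which
    [differentiable_quadratic] applies. *)
Lemma differentiable_hsum : holomorphic_on Omega (hsum : Cn -> C^o).
Proof.
move=> z Oz; pose r := rho z.
have r0 : 0 < r by rewrite divr_gt0// subr_gt0; exact: Oz.
pose D j := csum (fun k => (c k)%:C%C * s k j / A k z ^+ 2).
have D_geo j : cgeo (S j / r ^+ 2) (fun k => (c k)%:C%C * s k j / A k z ^+ 2).
  apply: quot_cgeo => //; first by rewrite exprn_gt0.
  by move=> k; rewrite expr2 cabsM -expr2 ler_sqr ?nnegrE ?cabs_ge0 ?(ltW r0)// A_ge.
pose g := (fun z : Cn => hsum z - \sum_(j < n) z 0 j * D j : C^o).
have dg : differentiable g (z : (Cn : normedModType C)).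
  have B1 : 0 < 2 * (B + 1) by rewrite mulr_gt0// ltr_wpDl.
  (* The radius makes every increment at most [r / 2], hence keeps the shifted denominators above
     [r / 2]; the factor 4 is that of [csum_le]. *)
  apply: (@differentiable_quadratic _ _ g z (B ^+ 2 / (r ^+ 2 * (r / 2)) * 4) (r / (2 * (B + 1)))).
    by rewrite divr_gt0.
  move=> v t /andP[t0 tr] hv.
  pose l k := \sum_(j < n) v 0 j * s k j.
  have lB k : cabs (l k) <= B * t by exact: ell_le.
  have lr k : cabs (l k) <= r / 2.
    apply: le_trans (lB k) _; apply: (@le_trans _ _ ((B + 1) * t)).
      by rewrite ler_wpM2r// lerDl.
    rewrite mulrC -ler_pdivlMr ?ltr_wpDl//; apply: le_trans tr _.
    by rewrite invfM mulrA.
  have Al k : r / 2 <= cabs (A k z - l k).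
    have := cabsD (A k z - l k) (l k); rewrite subrK.
    have := lr k; have := A_ge k z; rewrite -/r; lra.
  have r20 : 0 < r / 2 by rewrite divr_gt0.
  have g1 : cgeo (r / 2)^-1 (hsummand ^~ (z + v)).
    by apply: cgeo_hsummand_of => // k; rewrite A_shift.
  have g2 : cgeo r^-1 (hsummand ^~ z) by exact: cgeo_hsummand.
  have g3 j : cgeo (S j / r ^+ 2) (fun k => (c k)%:C%C * s k j / A k z ^+ 2) := D_geo j.
  have Q_geo : cgeo ((B * t) ^+ 2 / (r ^+ 2 * (r / 2)))
      (fun k => (c k)%:C%C * l k ^+ 2 / (A k z ^+ 2 * (A k z - l k))).
    apply: quot_cgeo.
    - by rewrite mulr_gt0// exprn_gt0.
    - by rewrite sqr_ge0.
    - by move=> k; rewrite expr2 cabsM -expr2 ler_sqr ?nnegrE ?cabs_ge0 ?mulr_ge0//.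
    - move=> k; rewrite cabsM ler_pM ?sqr_ge0 ?(ltW r20)//.
      by rewrite expr2 cabsM -expr2 ler_sqr ?nnegrE ?cabs_ge0 ?(ltW r0)// A_ge.
  have -> : g (z + v) - g z =
      csum (fun k => (c k)%:C%C * l k ^+ 2 / (A k z ^+ 2 * (A k z - l k))).
    have -> : g (z + v) - g z = hsum (z + v) - hsum z - \sum_(j < n) v 0 j * D j.
      rewrite /g; have -> : \sum_(j < n) (z + v) 0 j * D j =
          \sum_(j < n) z 0 j * D j + \sum_(j < n) v 0 j * D j.
        by rewrite -big_split /=; apply: eq_bigr => j _; rewrite mxE mulrDl.
      ring.
    have -> : \sum_(j < n) v 0 j * D j = csum (fun k => (c k)%:C%C * l k / A k z ^+ 2).
      rewrite -(csum_big_ord (v 0) g3); congr csum; apply/funext => k.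
      rewrite /l mulr_sumr mulr_suml; apply: eq_bigr => j _; ring.
    have L_geo : cgeo (B * t / r ^+ 2) (fun k => (c k)%:C%C * l k / A k z ^+ 2).
      apply: quot_cgeo => //; [by rewrite exprn_gt0|by rewrite mulr_ge0|].
      by move=> k; rewrite expr2 cabsM -expr2 ler_sqr ?nnegrE ?cabs_ge0 ?(ltW r0)// A_ge.
    rewrite /hsum -(csumB g1 g2) -(csumB (cgeoB g1 g2) L_geo).
    congr csum; apply/funext => k; rewrite !hsummandE A_shift -/(l k).
    have nz (x : C) y : 0 < y -> y <= cabs x -> x != 0.
      move=> y0 yx; apply/eqP => x0; move: yx; rewrite x0 leNgt.
      by rewrite /cabs /cabs2 /= expr0n addr0 sqrtr0 y0.
    have nA := nz _ _ r0 (A_ge k z); have nAl := nz _ _ r20 (Al k).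
    by field; rewrite nA nAl.
  apply: le_trans (csum_le Q_geo) _.
  rewrite le_eqVlt; apply/orP; left; apply/eqP; field.
  by rewrite gt_eqF.
rewrite (_ : hsum = g + \sum_(j < n) (fun z : (Cn : normedModType C) => D j *: (z 0 j : C^o))); last first.
  apply/funext => x; rewrite !fctE fct_sumE /g.
  rewrite -[LHS](subrK (\sum_(j < n) x 0 j * D j)); congr (_ + _).
  by apply: eq_bigr => j _; rewrite mulrC.
apply: differentiableD => //.
apply: differentiable_sum => j; apply: differentiableZ; exact: differentiable_coord.
Qed.

Lemma Re_hsummand (k : nat) (z : Cn) :
  complex.Re (hsummand k z) = lam k * complex.Re (hump a (w k) (b k) z).
Proof. by rewrite /hsummand; case: (hump _ _ _ _) => x y /=; rewrite mul0r subr0. Qed.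

Lemma Re_hsum_ge (k : nat) (z : Cn) : Omega z ->
  lam k * complex.Re (hump a (w k) (b k) z) <= complex.Re (hsum z).
Proof.
move=> Oz; rewrite -Re_hsummand.
apply: (rsum_ge_term k (cgeo_Re (cgeo_hsummand Oz))) => i.
by rewrite Re_hsummand mulr_ge0 ?(ltW (lam0 i))// (Re_hump_ge0 (w1 i)).
Qed.

Lemma cabs_hsummand (k : nat) (z : Cn) :
  cabs (hsummand k z) = lam k * cabs (hump a (w k) (b k) z).
Proof. by rewrite /hsummand cabsM cabs_real// ltW. Qed.

(* If the right-hand side is [T], each summand is at most [T ^ (1 / r) / (4 * 2 ^ k)],
   so no convexity is needed. *)
Lemma hsum_powR_le (r : R) (z : Cn) : 0 < r -> Omega z ->
  ((cabs (hsum z) `^ r)%:E <=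
   \sum_(k <oo) ((4 * 2 ^+ k) `^ r)%:E * ((lam k * cabs (hump a (w k) (b k) z)) `^ r)%:E)%E.
Proof.
move=> r0 Oz.
set T := (\sum_(k <oo) _)%E.
have t0 k : (0 <= ((4 * 2 ^+ k) `^ r)%:E * ((lam k * cabs (hump a (w k) (b k) z)) `^ r)%:E)%E.
  by rewrite -EFinM lee_fin mulr_ge0 ?powR_ge0.
have T0 : (0 <= T)%E by apply: nneseries_ge0.
have tT k : (((4 * 2 ^+ k) `^ r)%:E * ((lam k * cabs (hump a (w k) (b k) z)) `^ r)%:E <= T)%E.
  exact: nneseries_ge_term.
have [->|Tfin] := eqVneq T +oo%E; first by rewrite leey.
have TE : T = (fine T)%:E by rewrite fineK// ge0_fin_numE// ltey.
set x := fine T in TE.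
have x0 : 0 <= x by rewrite -lee_fin -TE.
have tau k : cabs (hsummand k z) <= x `^ r^-1 / 4 * 2^-1 ^+ k.
  have := tT k; rewrite TE -EFinM lee_fin -cabs_hsummand.
  set y := cabs _; have y0 : 0 <= y by exact: cabs_ge0.
  have p0 : 0 <= 4 * 2 ^+ k :> R by rewrite mulr_ge0// exprn_ge0.
  rewrite -powRM// => h.
  have : ((4 * 2 ^+ k * y) `^ r) `^ r^-1 <= x `^ r^-1.
    by apply: ge0_ler_powR => //; rewrite ?nnegrE ?invr_ge0 ?(ltW r0) ?powR_ge0.
  rewrite -powRrM mulfV ?gt_eqF// powRr1 ?mulr_ge0// => h2.
  rewrite -mulrA exprVn -invfM ler_pdivlMr ?mulr_gt0 ?exprn_gt0//.
  by rewrite mulrC.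
have := csum_le (tau : cgeo (x `^ r^-1 / 4) (hsummand ^~ z)).
rewrite divfK// -/(hsum z) TE lee_fin => h.
have : cabs (hsum z) `^ r <= (x `^ r^-1) `^ r.
  by apply: ge0_ler_powR => //; rewrite ?nnegrE ?cabs_ge0 ?powR_ge0 ?(ltW r0).
by rewrite -powRrM mulVf ?gt_eqF// powRr1.
Qed.

End Sum_of_humps.

(** * A function outside OL^q on countably many given sets *)

Section Nowhere_integrable_function.
Variables (R : realType) (n : nat).
Local Notation C := (R[i]).
Local Notation Cn := 'rV[C]_n.
Local Notation volint := (@volint R n).
Variable a : 'I_n -> R.
Hypothesis a0 : forall j, 0 < a j.
Local Notation Omega := (ellipsoid a).
Local Notation m := (decay_exp n).

Lemma cabsX (z : C) k : cabs (z ^+ k) = cabs z ^+ k.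
Proof.
elim: k => [|k IH]; last by rewrite !exprS cabsM IH.
by rewrite !expr0 -[1 in LHS]/((1 : R)%:C%C) cabs_real.
Qed.

Lemma Lp_int_le (D1 D2 : set Cn) (p : R) (f : Cn -> C^o) : copen D1 -> copen D2 ->
  D1 `<=` D2 -> ccontinuous D2 f -> (Lp_int D1 p f <= Lp_int D2 p f)%E.
Proof.
move=> o1 o2 D12 cf; have cf1 : ccontinuous D1 f by move=> z /D12; exact: cf.
apply: le_volint.
- exact: (jmeasurable_indic_comp o1 cf1 (measurable_powR p)).
- exact: (jmeasurable_indic_comp o2 cf (measurable_powR p)).
- by move=> z; rewrite lee_fin mulr_ge0 ?powR_ge0.
- move=> z; rewrite lee_fin ler_wpM2r ?powR_ge0// !indicE.
  by case: (boolP (z \in D1)) => //; rewrite inE => /D12 h; rewrite mem_set.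
Qed.

(* Each pair (ball, threshold) gets its own hump. The real parts of the humps are
   nonnegative, so in the sum they cannot cancel each other near the boundary. *)
Lemma exists_nowhere_OL (q : \bar R) (pj : nat -> R) (w : nat -> Cn) (d : nat -> R) :
  (1 < q)%E -> (forall j, 1 <= pj j) -> (forall j, ((pj j)%:E < q)%E) ->
  {homo pj : i j / (i <= j)%N >-> i <= j} ->
  (forall i, qform (wgt a) (w i) = 1) -> (forall i, 0 < d i) ->
  exists h : Cn -> C^o, [/\ holomorphic_on Omega h,
    forall j, (Lp_int Omega (pj j) h < +oo)%E &
    forall i, ~ OL q (eball (w i) (d i) `&` Omega) h].
Proof.
move=> q1 p1 pq pnd w1 d0.
(* Decodes [k] into a ball and a threshold; the default pair at other indices only repeats a
   requirement. *)
pose iN (k : nat) : nat * nat := odflt (0, 0)%N (unpickle k).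
(* The divisor pays for the weight in [hsum_powR_le] with exponent [pj k], hence for every [pj j]
   with [j <= k], and leaves a summable [2 ^ - k]. *)
pose e_ (k : nat) : R := 2^-1 ^+ k / (4 * 2 ^+ k) `^ (m%:R * pj k).
have base1 k : 1 <= 4 * 2 ^+ k :> R.
  by rewrite -natrX -natrM ler1n muln_gt0 expn_gt0.
have e_0 k : 0 < e_ k.
  by rewrite divr_gt0 ?exprn_gt0 ?invr_gt0// powR_gt0// (lt_le_trans _ (base1 k)).
have e_le k : e_ k <= 2^-1 ^+ k.
  rewrite ler_pdivrMr ?powR_gt0 ?(lt_le_trans _ (base1 k))// ler_peMr//.
  rewrite -[leLHS](powRr0 (4 * 2 ^+ k)) ler_powR// mulr_ge0//.
  exact: le_trans (p1 k).
(* Infinitely many norms are handled diagonally: the [k]-th hump is made small in the norms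
   [pj 0, ..., pj k] only. *)
have H k := hump_exists a0 (w1 (iN k).1) (p := fun i : 'I_k.+1 => pj i) q1
   (fun i => p1 i) (fun i => pq i) (ltr0Sn R (iN k).2) (d0 (iN k).1) (e_0 k).
have [lam /choice [b /choice [v HF]]] := choice H.
have lam0 k : 0 < lam k by have [[]] := HF k.
have b0 k : 0 < b k by have [[]] := HF k.
have v0 k : 0 < v k by have [[]] := HF k.
have lamb k : lam k * b k <= 2^-1 ^+ k.
  by have [_ [[h _ _ _] _]] := HF k; exact: le_trans h (e_le k).
have w1' k : qform (wgt a) (w (iN k).1) = 1 by exact: w1.
pose W k := w (iN k).1.
pose Hs := hsum a W lam b.
have dH : holomorphic_on Omega (Hs : Cn -> C^o) by exact: (differentiable_hsum a0 w1' lam0 b0 lamb).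
have oO : copen Omega by exact: copen_ellipsoid.
pose h : Cn -> C^o := (Hs : Cn -> C^o) ^+ m.
have hE z : h z = Hs z ^+ m by rewrite /h; elim: (m) => [|k IH]; rewrite ?expr0// !exprS fctE IH.
have dh : holomorphic_on Omega h by move=> z Oz; apply: differentiableX; exact: dH.
have ch : ccontinuous Omega h by exact: holomorphic_ccontinuous.
have hp p z : cabs (h z) `^ p = cabs (Hs z) `^ (m%:R * p).
  by rewrite hE cabsX -powR_mulrn ?cabs_ge0// -powRrM.
exists h; split => //.
  move=> j; set p := pj j.
  have mp0 : 0 < m%:R * p :> R by rewrite mulr_gt0 ?ltr0n// (lt_le_trans ltr01 (p1 j)).
  have p4 k r : 0 <= (4 * 2 ^+ k) `^ r :> R by exact: powR_ge0.
  pose G k (z : Cn) : \bar R := (\1_Omega z * (lam k * cabs (hump a (W k) (b k) z)) `^ (m%:R * p))%:E.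
  have GE k : G k = (fun z => ((lam k) `^ (m%:R * p))%:E * hump_pow a (W k) (m%:R * p) (b k) z)%E.
    apply/funext => z; rewrite /G /hump_pow -EFinM powRM ?cabs_ge0 ?(ltW (lam0 k))//.
    by congr EFin; ring.
  have mJ k := jmeasurable_hump_pow (w1' k) (m%:R * p) (b0 k).
  have mG k : jmeasurable (G k) by rewrite GE; exact: (jmeasurableZ _ (mJ k)).
  have G0 k z : (0 <= G k z)%E by rewrite lee_fin mulr_ge0 ?powR_ge0.
  have Gfin k : (volint (G k) < +oo)%E.
    rewrite GE (volintZ (powR_ge0 _ _) (mJ k) (hump_pow_ge0 _ _ _ _)).
    by rewrite -/(hump_int a (W k) _ _) (hump_intE a0 (w1' k) (b0 k) (ltW mp0)) -EFinM ltry.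
  have mwG k := @jmeasurableZ _ _ ((4 * 2 ^+ k) `^ (m%:R * p)) _ (mG k).
  have wG0 k z : (0 <= ((4 * 2 ^+ k) `^ (m%:R * p))%:E * G k z)%E.
    by rewrite mule_ge0// lee_fin.
  apply: (@le_lt_trans _ _ (volint (fun z => \sum_(k <oo) ((4 * 2 ^+ k) `^ (m%:R * p))%:E * G k z)%E)).
    apply: le_volint.
    - exact: (jmeasurable_indic_comp oO ch (measurable_powR p)).
    - by apply: jmeasurable_nneseries => k; [exact: mwG|exact: wG0].
    - by move=> z; rewrite lee_fin mulr_ge0 ?powR_ge0.
    - move=> z; rewrite indicE; case: (boolP (z \in Omega)); last first.
        by move=> _; rewrite mul0r; apply: nneseries_ge0 => k _ _; exact: wG0.
      move=> Oz; rewrite mul1r hp.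
      apply: (le_trans (hsum_powR_le W b lam0 mp0 (set_mem Oz))).
      rewrite le_eqVlt; apply/orP; left; apply/eqP; apply: eq_eseriesr => k _.
      by rewrite /G indicE Oz mul1r.
  rewrite /Defs.volint iter_int_nneseries//.
  apply: (@nneseries_eventually_geo _ j) => k.
  - exact: iter_int_ge0.
  - rewrite -/(volint _) volintZ// (_ : volint (G k) = (fine (volint (G k)))%:E).
      by rewrite -EFinM ltry.
    by rewrite fineK// ge0_fin_numE ?Gfin// volint_ge0.
  - move=> jk; rewrite -/(volint _) volintZ//.
    have [_ [[_ hk _ _] _]] := HF k.
    have {hk} := hk (Ordinal (jk : (j < k.+1)%N)) => /=.
    rewrite -/p -/(W k) -/(G k) => hk.
    apply: (@le_trans _ _ (((4 * 2 ^+ k) `^ (m%:R * p))%:E * (e_ k)%:E)%E).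
      by apply: lee_wpmul2l => //; rewrite lee_fin.
    rewrite -EFinM lee_fin /e_ mulrCA -[leRHS]mulr1 ler_wpM2l ?exprn_ge0 ?invr_ge0//.
    rewrite ler_pdivrMr ?mul1r ?powR_gt0 ?(lt_le_trans _ (base1 k))// ler_powR//.
    by rewrite ler_wpM2l//; exact: pnd.
have capD k z : cap a (W k) (b k) z ->
    (eball (w (iN k).1) (d (iN k).1) `&` Omega) z /\ v k <= cabs (Hs z).
  move=> cz; have [_ [[_ _ sub _] [hv _]]] := HF k.
  split; first by split; [exact: sub|case: cz].
  apply: le_trans (hv _ cz) _; apply: le_trans (Re_hsum_ge w1' lam0 b0 lamb k _) _.
    by case: cz.
  exact: le_trans (ler_norm _) (normr_Re_le_cabs _).
move=> i hOL; have iNE N : iN (pickle (i, N)) = (i, N) by rewrite /iN pickleK.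
case: q q1 pq H HF hOL => [q||] q1 pq H HF [_ hq].
- have q0 : 0 < q by rewrite -lte_fin (lt_trans _ q1)// lte_fin.
  set x := Lp_int _ _ _ in hq.
  have xE : x = (fine x)%:E.
    by rewrite fineK// ge0_fin_numE// volint_ge0// => z; rewrite lee_fin mulr_ge0 ?powR_ge0.
  (* The hump for the pair [(i, N)] forces the integral to be at least [N + 1], which exceeds its
     supposed finite value. *)
  pose N := Num.truncn (fine x); pose k := pickle (i, N).
  have [_ [_ [_]]] := HF k; rewrite iNE /= => hN.
  have : ((N.+1%:R)%:E <= x)%E.
    apply: le_trans hN _.
    rewrite /cap_vol -volintZ ?powR_ge0//; last exact/jmeasurable_indic1/copen_cap.
    have oD : copen (eball (w i) (d i) `&` Omega).
      by apply: copenI => //; exact: copen_eball.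
    have cD : ccontinuous (eball (w i) (d i) `&` Omega) h by move=> z [_]; exact: ch.
    apply: le_volint.
    + apply: jmeasurableZ; exact/jmeasurable_indic1/copen_cap.
    + exact: (jmeasurable_indic_comp oD cD (measurable_powR q)).
    + by move=> z; rewrite mule_ge0// lee_fin ?powR_ge0.
    + move=> z; rewrite -EFinM lee_fin [in leLHS]indicE.
      case: (boolP (z \in _)); last by rewrite mulr0 mulr_ge0 ?powR_ge0.
      rewrite inE mulr1 => cz; have := @capD k z; rewrite /W iNE => /(_ cz) [Dz vz].
      rewrite indicE mem_set// mul1r hp; apply: ge0_ler_powR => //.
      * by rewrite mulr_ge0// ltW.
      * by rewrite nnegrE ltW.
      * by rewrite nnegrE cabs_ge0.
  by rewrite xE lee_fin leNgt truncnS_gt.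
- move: hq => [M hM]; pose N := Num.truncn M; pose k := pickle (i, N).
  have [_ [[_ _ _ [z cz]] [_]]] := HF k; rewrite iNE /= => hN.
  have [] := capD k z cz; rewrite iNE /= => Dz vz.
  have := hM z Dz; rewrite hE cabsX leNgt => /negP; apply.
  (* Thresholds are at least 1, so raising to the power [m] cannot lower the value. *)
  apply: lt_le_trans (truncnS_gt _) _; apply: le_trans (le_trans hN vz) _.
  have H1 : 1 <= cabs (Hs z) by apply: le_trans (le_trans hN vz); rewrite ler1n.
  by rewrite ler_eXnr.
- by [].
Qed.

End Nowhere_integrable_function.

(** * The metric on the intersection of the spaces OL^p *)

Section OL_space.
Variables (R : realType) (n : nat).
Local Notation C := (R[i]).
Local Notation Cn := 'rV[C]_n.
Local Notation volint := (@volint R n).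

Lemma holomorphic_comb (D : set Cn) (f g : Cn -> C^o) (c : C) :
  holomorphic_on D f -> holomorphic_on D g ->
  holomorphic_on D (fun z => f z + c * g z : C^o).
Proof.
move=> hf hg z Dz; apply: (@differentiableD _ _ _ f (c *: g)); first exact: hf.
by apply: differentiableZ; exact: hg.
Qed.

Definition Lpfun (D : set Cn) (p : R) (f : Cn -> C^o) (z : Cn) : \bar R :=
  (\1_D z * cabs (f z) `^ p)%:E.

Lemma Lpfun_ge0 D p f z : (0 <= Lpfun D p f z)%E.
Proof. by rewrite lee_fin mulr_ge0 ?powR_ge0. Qed.

Lemma jmeasurable_Lpfun (D : set Cn) (p : R) (f : Cn -> C^o) : copen D ->
  holomorphic_on D f -> jmeasurable (Lpfun D p f).
Proof.
move=> oD hf.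
exact: (jmeasurable_indic_comp oD (holomorphic_ccontinuous hf) (measurable_powR p)).
Qed.

Lemma Lp_int_ge0 D p (f : Cn -> C^o) : (0 <= Lp_int D p f)%E.
Proof. by apply: volint_ge0 => z; exact: Lpfun_ge0. Qed.

(** From [x + y <= 2 max x y]; the constant is not sharp, but only finiteness matters. *)
Lemma powRD_le (x y p : R) : 0 <= x -> 0 <= y -> 0 <= p ->
  (x + y) `^ p <= 2 `^ p * (x `^ p + y `^ p).
Proof.
move=> x0 y0 p0.
suff key u v : 0 <= u -> u <= v -> (u + v) `^ p <= 2 `^ p * (u `^ p + v `^ p).
  have [xy|yx] := leP x y; first exact: key.
  by rewrite addrC [x `^ p + _]addrC; apply: key => //; exact: ltW.
move=> u0 uv; have v0 := le_trans u0 uv.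
apply: (@le_trans _ _ ((2 * v) `^ p)).
  by apply: ge0_ler_powR; rewrite ?nnegrE ?addr_ge0 ?mulr_ge0//; lra.
by rewrite powRM// ler_wpM2l ?powR_ge0// lerDr powR_ge0.
Qed.

Lemma powR_comb_le (x y c p : R) : 0 <= x -> 0 <= y -> 0 <= c -> 0 <= p ->
  (x + c * y) `^ p <= 2 `^ p * (1 + c `^ p) * (x `^ p + y `^ p).
Proof.
move=> x0 y0 c0 p0; apply: (le_trans (powRD_le x0 (mulr_ge0 c0 y0) p0)).
rewrite -mulrA ler_wpM2l ?powR_ge0// powRM// mulrDl mul1r mulrDr.
have := powR_ge0 x p; have := powR_ge0 y p; have := powR_ge0 c p.
move: (x `^ _) (y `^ _) (c `^ _) => u v s s0 v0 u0.
have : 0 <= s * u by exact: mulr_ge0.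
lra.
Qed.

Lemma Lp_int_comb (D : set Cn) (p : R) (f g : Cn -> C^o) (c : C) : copen D -> 0 <= p ->
  holomorphic_on D f -> holomorphic_on D g ->
  (Lp_int D p f < +oo)%E -> (Lp_int D p g < +oo)%E ->
  (Lp_int D p (fun z => (f z + c * g z)%R) < +oo)%E.
Proof.
move=> oD p0 hf hg ff fg.
have mf := jmeasurable_Lpfun p oD hf; have mg := jmeasurable_Lpfun p oD hg.
pose k := 2 `^ p * (1 + cabs c `^ p).
have k0 : 0 <= k by rewrite mulr_ge0 ?powR_ge0// addr_ge0 ?powR_ge0.
have fg0 z : (0 <= Lpfun D p f z + Lpfun D p g z)%E by rewrite adde_ge0 ?Lpfun_ge0.
have mfg := jmeasurableD mf mg.
apply: (@le_lt_trans _ _ (k%:E * (Lp_int D p f + Lp_int D p g))%E).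
  rewrite /Lp_int -(volintD mf mg (Lpfun_ge0 _ _ _) (Lpfun_ge0 _ _ _)).
  rewrite -(volintZ k0 mfg fg0).
  apply: (le_volint (jmeasurable_Lpfun p oD (holomorphic_comb c hf hg)) (jmeasurableZ k mfg)
    (Lpfun_ge0 _ _ _)) => z.
  have h : cabs (f z + c * g z) `^ p <= k * (cabs (f z) `^ p + cabs (g z) `^ p).
    apply: le_trans (powR_comb_le (cabs_ge0 _) (cabs_ge0 _) (cabs_ge0 _) p0).
    apply: ge0_ler_powR; rewrite ?nnegrE ?addr_ge0 ?mulr_ge0 ?cabs_ge0//.
    by rewrite -cabsM cabsD.
  rewrite /Lpfun -EFinD -EFinM lee_fin; move: h.
  move: (cabs _ `^ p) (cabs (f z) `^ p) (cabs (g z) `^ p) => x y s h.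
  by rewrite -mulrDr mulrCA; apply: ler_wpM2l.
have Lf0 := Lp_int_ge0 D p f; have Lg0 := Lp_int_ge0 D p g.
move: (Lp_int D p f) (Lp_int D p g) ff fg Lf0 Lg0 => [x||] [y||] // _ _ _ _.
by rewrite -EFinD -EFinM ltry.
Qed.

Lemma OL_comb (q : \bar R) (D : set Cn) (f g : Cn -> C^o) (c : C) : copen D -> (1 < q)%E ->
  OL q D f -> OL q D g -> OL q D (fun z => f z + c * g z).
Proof.
move=> oD; case: q => [q||] q1 [hf ff] [hg fg]; last by [].
  split; first exact: holomorphic_comb.
  apply: Lp_int_comb => //; rewrite lte_fin in q1; exact: (le_trans ler01 (ltW q1)).
split; first exact: holomorphic_comb.
move: ff fg => [M hM] [N hN]; exists (M + cabs c * N) => z Dz.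
by rewrite (le_trans (cabsD _ _))// lerD ?hM// cabsM ler_wpM2l ?cabs_ge0// hN.
Qed.

Lemma OL_sub (q : \bar R) (D1 D2 : set Cn) (f : Cn -> C^o) : copen D1 -> copen D2 ->
  D1 `<=` D2 -> OL q D2 f -> OL q D1 f.
Proof.
move=> o1 o2 D12; case: q => [q||] [hf ff] //; (split; first by move=> z /D12; exact: hf).
  apply: le_lt_trans ff; apply: Lp_int_le => //; exact: holomorphic_ccontinuous.
by move: ff => [M hM]; exists M => z /D12; exact: hM.
Qed.

(** When [x > eta], write [x ^ p = x * x ^ (p - 1)] and bound the last factor below by
    [eta ^ (p - 1)]. *)
Lemma le_eta_powR (x eta p : R) : 0 <= x -> 0 < eta -> 1 <= p ->
  x <= eta + (eta `^ (p - 1))^-1 * x `^ p.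
Proof.
move=> x0 e0 p1; have ep : 0 < eta `^ (p - 1) by exact: powR_gt0.
have [xe|ex] := leP x eta; first by rewrite ler_wpDr// mulr_ge0 ?powR_ge0// invr_ge0 ltW.
have x0' : 0 < x := lt_trans e0 ex.
apply: (@le_trans _ _ ((eta `^ (p - 1))^-1 * x `^ p)); last by rewrite lerDr ltW.
rewrite mulrC ler_pdivlMr//.
have -> : x `^ p = x * x `^ (p - 1).
  have := @powRD R x 1 (p - 1); rewrite (gt_eqF x0') implybT => /(_ isT).
  by rewrite powRr1 ?ltW// addrC subrK.
rewrite ler_pM2l//; by apply: ge0_ler_powR; rewrite ?nnegrE ?subr_ge0 ?(ltW e0) ?(ltW ex).
Qed.

Section On_ellipsoid.
Variable a : 'I_n -> R.
Hypothesis a0 : forall j, 0 < a j.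
Local Notation Omega := (ellipsoid a).

(** From [x ^ p <= 1 + x ^ p'] and the finite volume of the ellipsoid. *)
Lemma Lp_int_mono (p p' : R) (f : Cn -> C^o) : 0 <= p -> p <= p' -> holomorphic_on Omega f ->
  (Lp_int Omega p' f < +oo)%E -> (Lp_int Omega p f < +oo)%E.
Proof.
move=> p0 pp' hf ff; have oO : copen Omega by exact: copen_ellipsoid.
have mf := jmeasurable_Lpfun p oO hf; have mf' := jmeasurable_Lpfun p' oO hf.
have m1 := jmeasurable_indic1 oO.
apply: (@le_lt_trans _ _ (omega_vol a + Lp_int Omega p' f)%E).
  rewrite /omega_vol /Lp_int -(volintD m1 mf' _ (Lpfun_ge0 _ _ _)); last first.
    by move=> z; rewrite lee_fin.
  apply: (le_volint mf (jmeasurableD m1 mf') (Lpfun_ge0 _ _ _)) => z.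
  rewrite /Lpfun -EFinD lee_fin -{2}[\1_Omega z]mulr1 -mulrDr ler_wpM2l//.
  have x0 := cabs_ge0 (f z); move: (cabs (f z)) x0 => x x0.
  have [x1|x1] := leP x 1.
    by apply: (@le_trans _ _ 1); [apply: powR_le1; rewrite ?x0|rewrite lerDl powR_ge0].
  apply: (@le_trans _ _ (x `^ p')); last by rewrite lerDr.
  by rewrite ler_powR// ltW.
have o1 := omega_vol_fin a0; have L0 := Lp_int_ge0 Omega p' f.
have o0 : (0 <= omega_vol a)%E by apply: volint_ge0 => z; rewrite lee_fin.
move: (Lp_int Omega p' f) (omega_vol a) ff o1 L0 o0 => [x||] [y||] // _ _ _ _.
by rewrite -EFinD ltry.
Qed.

Variables (q : \bar R) (pj : nat -> R).
Hypothesis q1 : (1 < q)%E.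
Hypothesis p0 : 1 < pj 0.
Hypothesis pS : forall j, pj j < pj j.+1.
Hypothesis pq : ((fun j => (pj j)%:E) @ \oo --> q).

Lemma pj_homo : {homo pj : i j / (i <= j)%N >-> i <= j}.
Proof. by apply/nondecreasing_seqP => k; exact: ltW. Qed.

Lemma pj_gt1 j : 1 < pj j.
Proof. by apply: lt_le_trans p0 _; exact: pj_homo. Qed.

Lemma pj_lt j : ((pj j)%:E < q)%E.
Proof.
apply: (@lt_le_trans _ _ (pj j.+1)%:E); first by rewrite lte_fin.
rewrite -(cvg_lim _ pq)//.
have nd : {homo (fun j => (pj j)%:E) : i j / (i <= j)%N >-> (i <= j)%E}.
  by move=> i k ik; rewrite lee_fin pj_homo.
by rewrite (cvg_lim _ (ereal_nondecreasing_cvgn nd))//; apply: ereal_sup_ubound; exists j.+1.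
Qed.

Lemma pj_above (p : R) : (p%:E < q)%E -> exists j, p <= pj j.
Proof.
move=> pq'; have nd : {homo (fun j => (pj j)%:E) : i j / (i <= j)%N >-> (i <= j)%E}.
  by move=> i k ik; rewrite lee_fin pj_homo.
have h : (p%:E < limn (fun j => (pj j)%:E))%E by rewrite (cvg_lim _ pq).
have [i _ /(_ i (leqnn i)) /=] := lte_lim nd (ereal_nondecreasing_is_cvgn nd) h.
by rewrite lee_fin; exists i.
Qed.

Lemma OLcapP (f : Cn -> C^o) : OLcap q Omega f <->
  holomorphic_on Omega f /\ forall j, (Lp_int Omega (pj j) f < +oo)%E.
Proof.
split=> [h|[hf h] p p1 /pj_above [j pj']].
  split; first by have [] := h _ (ltW p0) (pj_lt 0).
  by move=> j; have [] := h _ (ltW (pj_gt1 j)) (pj_lt j).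
split => //; exact: (Lp_int_mono (le_trans ler01 p1) pj' hf (h j)).
Qed.

Lemma OLcap_comb (f g : Cn -> C^o) (c : C) : OLcap q Omega f -> OLcap q Omega g ->
  OLcap q Omega (fun z => f z + c * g z).
Proof.
move=> /OLcapP [hf ff] /OLcapP [hg fg]; apply/OLcapP; split; first exact: holomorphic_comb.
move=> j; apply: Lp_int_comb => //; first exact: copen_ellipsoid.
exact: (le_trans ler01 (ltW (pj_gt1 j))).
Qed.

Definition dist_term (f g : Cn -> C^o) (j : nat) : R :=
  (2 ^- j.+1) * (pnorm Omega (pj j) (fun z => f z - g z) /
                   (1 + pnorm Omega (pj j) (fun z => f z - g z))).

Lemma pnorm_ge0 p (f : Cn -> C^o) : 0 <= pnorm Omega p f.
Proof. exact: powR_ge0. Qed.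

Lemma dist_term_ge0 f g j : 0 <= dist_term f g j.
Proof.
have h := pnorm_ge0 (pj j) (fun z => f z - g z).
by rewrite mulr_ge0 ?divr_ge0 ?addr_ge0// invr_ge0 exprn_ge0.
Qed.

Lemma dist_term_le f g j : dist_term f g j <= 2 ^- j.+1.
Proof.
have h := pnorm_ge0 (pj j) (fun z => f z - g z).
rewrite ler_piMr ?invr_ge0 ?exprn_ge0// ler_pdivrMr ?mul1r ?lerDr//.
by rewrite ltr_pwDl.
Qed.

Lemma dist_rgeo f g : rgeo 1 (dist_term f g).
Proof.
move=> j; rewrite ger0_norm ?dist_term_ge0// (le_trans (dist_term_le f g j))//.
by rewrite mul1r exprVn lef_pV2 ?posrE ?exprn_gt0// exprS ler_peMl ?exprn_ge0// ler1n.
Qed.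

(** The first term of the metric alone gives [x / (1 + x) < 2 e], hence [x < 2 e / (1 - 2 e) <= 4 e]
    when [e <= 1 / 4]. *)
Lemma pnorm_lt_of_dist (f g : Cn -> C^o) (e : R) : e <= 1 / 4 -> dist Omega pj f g < e ->
  pnorm Omega (pj 0) (fun z => f z - g z) < 4 * e.
Proof.
move=> e4; have := rsum_ge_term 0 (dist_rgeo f g) (dist_term_ge0 f g).
rewrite -[rsum _]/(dist Omega pj f g) /dist_term expr1.
have := pnorm_ge0 (pj 0) (fun z => f z - g z); move: (pnorm _ _ _) => x x0 h1 h2.
have : 2^-1 * (x / (1 + x)) < e by exact: le_lt_trans h1 h2.
rewrite mulrA ltr_pdivrMr; last by rewrite ltr_pwDl.
by nra.
Qed.

Lemma Lp_int_pnorm (f : Cn -> C^o) (p e : R) : 1 <= p -> e <= 1 ->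
  (Lp_int Omega p f < +oo)%E -> pnorm Omega p f <= e -> fine (Lp_int Omega p f) <= e.
Proof.
move=> p1 e1 ff; rewrite /pnorm; set x := fine _.
have x0 : 0 <= x by rewrite fine_ge0// Lp_int_ge0.
have pp : 0 < p by apply: lt_le_trans p1.
move=> h; have h0 := le_trans (powR_ge0 _ _) h.
have : (x `^ p^-1) `^ p <= e `^ p.
  by apply: ge0_ler_powR; rewrite ?nnegrE ?powR_ge0 ?(ltW pp).
rewrite -powRrM mulVf ?gt_eqF// powRr1// => /le_trans; apply.
have [->|en0] := eqVneq e 0; first by rewrite powR0 ?gt_eqF.
by rewrite -[leRHS]powRr1// ger_powR// lt_neqAle eq_sym en0 h0.
Qed.

Lemma pnorm_perturb (f g : Cn -> C^o) (p c : R) : 0 <= c -> 0 < p -> holomorphic_on Omega g ->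
  pnorm Omega p (fun z => f z - (f z + c%:C%C * g z)) = c * pnorm Omega p g.
Proof.
move=> c0 pp hg; have oO : copen Omega by exact: copen_ellipsoid.
have -> : c * pnorm Omega p g = ((c `^ p) * fine (Lp_int Omega p g)) `^ p^-1.
  rewrite powRM ?powR_ge0 ?fine_ge0 ?Lp_int_ge0//.
  by rewrite -powRrM mulfV ?gt_eqF// powRr1.
rewrite /pnorm; congr (_ `^ _).
have -> : Lp_int Omega p (fun z => f z - (f z + c%:C%C * g z))%R =
    ((c `^ p)%:E * Lp_int Omega p g)%E.
  rewrite /Lp_int -(volintZ (powR_ge0 c p) (jmeasurable_Lpfun p oO hg) (Lpfun_ge0 _ _ _)).
  congr (Defs.volint _); apply/funext => z; rewrite /Lpfun -EFinM; congr EFin.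
  by rewrite opprD addNKr cabsN cabsM cabs_real// powRM ?cabs_ge0// mulrCA.
(* If the integral is infinite, both sides are 0 because [fine +oo = 0]. *)
have := Lp_int_ge0 Omega p g; case: (Lp_int Omega p g) => [x||] //= _.
have [->|cn0] := eqVneq (c `^ p) 0; first by rewrite mul0e mul0r.
by rewrite mulr0 gt0_muley// lte_fin lt_neqAle eq_sym cn0 powR_ge0.
Qed.

Lemma dist_term_perturb (f g : Cn -> C^o) (c : R) j : 0 <= c -> holomorphic_on Omega g ->
  dist_term f (fun z => f z + c%:C%C * g z) j <= c * pnorm Omega (pj j) g.
Proof.
move=> c0 hg; have pp : 0 < pj j := lt_trans ltr01 (pj_gt1 j).
rewrite /dist_term pnorm_perturb//; set x := c * _.
have x0 : 0 <= x by rewrite mulr_ge0// pnorm_ge0.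
rewrite -[leRHS]mul1r; apply: ler_pM; rewrite ?invr_ge0 ?exprn_ge0 ?divr_ge0 ?addr_ge0//.
  by rewrite invf_le1 ?exprn_gt0// -natrX ler1n expn_gt0.
rewrite ler_pdivrMr; last by rewrite ltr_pwDl.
by rewrite mulrDr mulr1 lerDl mulr_ge0.
Qed.

(** The tail of the metric is small whatever the functions are, and each of the finitely many
    remaining terms is at most linear in [c]. *)
Lemma dist_perturb_small (f g : Cn -> C^o) (e : R) : 0 < e -> holomorphic_on Omega g ->
  exists2 c0 : R, 0 < c0 & forall c, 0 < c < c0 ->
    dist Omega pj f (fun z => f z + c%:C%C * g z) < e.
Proof.
move=> e0 hg; have e2 : 0 < e / 2 / 2 by rewrite !divr_gt0.
have [J _ /(_ J (leqnn J)) /= hJ] : \forall J \near \oo, (2^-1 : R) ^+ J < e / 2 / 2.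
  have h : `|2^-1 : R| < 1 by rewrite ger0_norm ?invr_ge0// invf_lt1// ltr1n.
  have /cvgrPdist_lt /(_ _ e2) := cvg_expr h; apply: filterS => J.
  by rewrite sub0r normrN; apply: le_lt_trans; rewrite ler_norm.
pose S := \sum_(0 <= j < J) pnorm Omega (pj j) g.
have S0 : 0 <= S by apply: sumr_ge0 => j _; exact: pnorm_ge0.
exists (e / 2 / 2 / (S + 1)); first by rewrite divr_gt0// ltr_wpDl.
move=> c /andP[cp cS]; set t := dist_term f (fun z => f z + c%:C%C * g z).
have cS2 : c * S <= e / 2 / 2.
  apply: (@le_trans _ _ (c * (S + 1))); first by rewrite ler_wpM2l ?(ltW cp)// lerDl.
  by rewrite -ler_pdivlMr ?ltr_wpDl// ltW.
(* The bound [2 ^ - (K + 1)] on the [K]-th term equals [2 ^ - K - 2 ^ - (K + 1)], so the tail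
   telescopes. *)
have key K : (J <= K)%N -> \sum_(0 <= j < K) t j <= c * S + (2^-1 ^+ J - 2^-1 ^+ K).
  elim: K => [|K IH].
    rewrite leqn0 => /eqP J0; rewrite big_nil J0 subrr addr0 mulr_ge0 ?(ltW cp)//.
  rewrite leq_eqVlt => /orP[/eqP <-|].
    rewrite subrr addr0 /S mulr_sumr; apply: ler_sum => j _.
    exact: dist_term_perturb (ltW cp) hg.
  rewrite ltnS => JK; rewrite big_nat_recr//=.
  have tK : t K <= 2^-1 ^+ K.+1 by rewrite exprVn; exact: dist_term_le.
  have eK : 2^-1 ^+ K = 2 * 2^-1 ^+ K.+1 :> R by rewrite exprS mulrA mulfV// mul1r.
  move: (IH JK) tK; rewrite eK; move: (_ ^+ K.+1) (_ ^+ J) => x y; lra.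
apply: (@le_lt_trans _ _ (e / 2)); last by rewrite ltr_pdivrMr// ltr_pMr// ltr1n.
have := rgeo_cvg (dist_rgeo f (fun z => f z + c%:C%C * g z)) => ct.
rewrite -[dist _ _ _ _]/(limn (series t)); apply: limr_le => //.
exists J => // K /= JK; apply: le_trans (key K JK) _.
have : 0 <= (2^-1 : R) ^+ K by rewrite exprn_ge0// invr_ge0.
by move: hJ cS2; move: (_ ^+ K) (_ ^+ J) (c * S) => x y s; lra.
Qed.

Definition rvol (D : set Cn) (phi : R -> R) (f : Cn -> C^o) : \bar R :=
  volint (fun z => (\1_D z * phi (cabs (f z)))%:E).

(* [|x| <= eta + eta ^ (1 - p) * |x| ^ p] bounds the variation of [rvol D phi] by the
   [p]-norm of the difference, without Hoelder's inequality. *)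
Lemma rel_open_rvol (D : set Cn) (phi : R -> R) (M L c : R) :
  copen D -> D `<=` Omega -> measurable_fun [set: R] phi -> 0 <= L ->
  (forall x, 0 <= x -> 0 <= phi x <= M) ->
  (forall x y, 0 <= x -> 0 <= y -> phi x <= phi y + L * `|x - y|) ->
  rel_open (dist Omega pj) (OLcap q Omega)
    [set f | OLcap q Omega f /\ (c%:E < rvol D phi f)%E].
Proof.
move=> oD DO mphi L0 phiM phiL; split; first by move=> f [].
move=> f [Xf cf]; have [hf ff] := (OLcapP f).1 Xf.
have oO : copen Omega by exact: copen_ellipsoid.
have m1 := jmeasurable_indic1 oO.
have mphiD (g : Cn -> C^o) : holomorphic_on Omega g ->
    jmeasurable (fun z => (\1_D z * phi (cabs (g z)))%:E).
  move=> hg; apply: jmeasurable_indic_comp => //; apply: holomorphic_ccontinuous.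
  by move=> z /DO; exact: hg.
have phi0 (g : Cn -> C^o) z : (0 <= (\1_D z * phi (cabs (g z)))%:E)%E.
  by rewrite lee_fin mulr_ge0//; have /andP[] := phiM _ (cabs_ge0 (g z)).
have omE : omega_vol a = (fine (omega_vol a))%:E.
  by rewrite fineK// ge0_fin_numE ?omega_vol_fin// volint_ge0// => z; rewrite lee_fin.
set om := fine _ in omE.
have om0 : 0 <= om by rewrite -lee_fin -omE volint_ge0// => z; rewrite lee_fin.
have rfin (g : Cn -> C^o) : holomorphic_on Omega g -> (rvol D phi g < +oo)%E.
  move=> hg; apply: (@le_lt_trans _ _ (`|M|%:E * omega_vol a)%E); last by rewrite omE -EFinM ltry.
  rewrite /omega_vol -(volintZ (normr_ge0 M) m1); last by move=> z; rewrite lee_fin.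
  apply: (le_volint (mphiD g hg) (jmeasurableZ _ m1) (phi0 g)) => z.
  rewrite -EFinM lee_fin !indicE; case: (boolP (z \in D)); last by rewrite mul0r mulr_ge0.
  rewrite inE => /DO Oz; rewrite mem_set// mul1r mulr1 (le_trans _ (ler_norm _))//.
  by have /andP[] := phiM _ (cabs_ge0 (g z)).
have rE (g : Cn -> C^o) : holomorphic_on Omega g -> rvol D phi g = (fine (rvol D phi g))%:E.
  by move=> hg; rewrite fineK// ge0_fin_numE ?rfin// volint_ge0.
set x := fine (rvol D phi f).
have gap : 0 < x - c by rewrite subr_gt0 -lte_fin -rE.
(* The choice of [eta] spends a quarter of the gap [x - c] on [L * eta * om]; the later choice of
   [e] spends another quarter on [L * k * I], where [I <= 4 * e]. *)
pose eta := (x - c) / (4 * (L * om + 1)).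
have Lom : 0 < 4 * (L * om + 1) by rewrite mulr_gt0// ltr_wpDl// mulr_ge0.
have eta0 : 0 < eta by rewrite divr_gt0.
pose p := pj 0; have p1 : 1 <= p := ltW (pj_gt1 0).
pose k := (eta `^ (p - 1))^-1.
have k0 : 0 <= k by rewrite invr_ge0 powR_ge0.
pose e := Num.min (1 / 4) ((x - c) / (16 * (L * k + 1))).
have Lk : 0 < L * k + 1 by rewrite ltr_wpDl// mulr_ge0.
have e0 : 0 < e by rewrite lt_min divr_gt0//= divr_gt0// mulr_gt0.
exists e => // g Xg dfg; have [hg fg] := (OLcapP g).1 Xg.
split => //.
have e4 : e <= 1 / 4 by rewrite ge_min lexx.
have := pnorm_lt_of_dist e4 dfg; set w := (fun z => f z - g z) => /ltW pw.
have hw : holomorphic_on Omega w.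
  by move=> z Oz; apply: differentiableB; [exact: hf|exact: hg].
have fw : (Lp_int Omega p w < +oo)%E.
  rewrite (_ : w = (fun z => f z + (-1) * g z)); last by apply/funext => z; rewrite mulN1r.
  apply: Lp_int_comb => //; [exact: (le_trans ler01 p1)|exact: ff|exact: fg].
have e41 : 4 * e <= 1 by move: e4; lra.
have := Lp_int_pnorm p1 e41 fw pw; set I := fine _ => Ie.
have IE : Lp_int Omega p w = I%:E by rewrite fineK// ge0_fin_numE ?Lp_int_ge0.
have main : (rvol D phi f <= rvol D phi g + ((L * eta)%:E * omega_vol a + (L * k)%:E * Lp_int Omega p w))%E.
  have mw := jmeasurable_Lpfun p oO hw.
  have i0 z : (0 <= (\1_Omega z)%:E :> \bar R)%E by rewrite lee_fin.
  have Le0 : 0 <= L * eta by rewrite mulr_ge0// ltW.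
  have Lk0 : 0 <= L * k by rewrite mulr_ge0.
  have t1 z : (0 <= (L * eta)%:E * (\1_Omega z)%:E :> \bar R)%E by rewrite mule_ge0// lee_fin.
  have t2 z : (0 <= (L * k)%:E * Lpfun Omega p w z)%E by rewrite mule_ge0 ?lee_fin// mulr_ge0 ?powR_ge0.
  have t3 z := adde_ge0 (t1 z) (t2 z).
  have mm1 := jmeasurableZ (L * eta) m1; have mm2 := jmeasurableZ (L * k) mw.
  rewrite /omega_vol /Lp_int -(volintZ Le0 m1 i0) -(volintZ Lk0 mw (Lpfun_ge0 _ _ _)).
  rewrite -(volintD mm1 mm2 t1 t2) /rvol -(volintD (mphiD g hg) (jmeasurableD mm1 mm2) (phi0 g) t3).
  apply: (le_volint (mphiD f hf) (jmeasurableD (mphiD g hg) (jmeasurableD mm1 mm2)) (phi0 f)) => z.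
  rewrite /Lpfun -!EFinM -!EFinD lee_fin.
  rewrite [\1_D z]indicE; case: (boolP (z \in D)) => Dz; last first.
    rewrite !mul0r add0r; apply: addr_ge0; first exact: mulr_ge0.
    by apply: mulr_ge0 => //; apply: mulr_ge0 => //; exact: powR_ge0.
  rewrite indicE mem_set ?mul1r ?mulr1; last exact/DO/set_mem.
  apply: le_trans (phiL _ _ (cabs_ge0 (f z)) (cabs_ge0 (g z))) _; rewrite lerD2l.
  have := le_eta_powR (cabs_ge0 (w z)) eta0 p1; rewrite -/k.
  have := cabs_dist (f z) (g z); rewrite -/(w z).
  move: (cabs (w z) `^ p) (cabs (w z)) (`|_|) => u1 u2 u3 h1 h2.
  by rewrite -!mulrA -mulrDr ler_wpM2l// (le_trans h1).
move: main; rewrite (rE f hf) (rE g hg) omE IE -!EFinM -!EFinD lee_fin lte_fin -/x.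
have h1 : L * eta * om <= (x - c) / 4.
  rewrite mulrAC /eta mulrA ler_pdivrMr// mulrC mulrA.
  rewrite (_ : (x - c) / 4 * (4 * (L * om + 1)) = (x - c) * (L * om + 1)); last by field.
  by rewrite -mulrA ler_wpM2l ?(ltW gap)// lerDl.
have h2 : L * k * I <= (x - c) / 4.
  apply: (@le_trans _ _ ((L * k + 1) * (4 * e))).
    apply: ler_pM => //; [by rewrite mulr_ge0|by rewrite fine_ge0// Lp_int_ge0|by rewrite lerDl].
  have : e <= (x - c) / (16 * (L * k + 1)) by rewrite ge_min lexx orbT.
  rewrite ler_pdivlMr ?mulr_gt0// => h; rewrite (_ : _ * (4 * e) = e * (16 * (L * k + 1)) / 4).
    by rewrite ler_pM2r ?invr_gt0.
  by field.
move: (fine (rvol D phi g)) (L * eta * om) (L * k * I) h1 h2 gap => r s1 s2; lra.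
Qed.

End On_ellipsoid.
End OL_space.

(** * Countably many boundary balls *)

Section Boundary_tests.
Variables (R : realType) (n : nat).
Local Notation C := (R[i]).
Local Notation Cn := 'rV[C]_n.
Local Notation volint := (@volint R n).
Local Notation grid := ('rV[(int * int)%type]_n * nat)%type.
Hypothesis n0 : (0 < n)%N.
Variable a : 'I_n -> R.
Hypothesis a0 : forall j, 0 < a j.
Local Notation Omega := (ellipsoid a).

(** The radius is large enough for the Euclidean ball to contain the grid box of half-side
    [1 / (N + 1)], so the balls of each level cover the space. *)
Definition grid_ball (vN : grid) : set Cn :=
  eball (gridpt R vN.1 vN.2) ((2 * n)%:R / vN.2.+1%:R).

Lemma cabs2D_le (x y : C) : cabs2 (x + y) <= 2 * cabs2 x + 2 * cabs2 y.
Proof.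
case: x => x x'; case: y => y y'; rewrite /cabs2 /= -subr_ge0.
rewrite (_ : _ - _ = (x - y) ^+ 2 + (x' - y') ^+ 2); last by ring.
by rewrite addr_ge0// sqr_ge0.
Qed.

Lemma grid_ball_sub_eball (zeta : Cn) (eps : R) : 0 < eps ->
  exists vN, grid_ball vN zeta /\ grid_ball vN `<=` eball zeta eps.
Proof.
move=> e0; have N0 : 0 < (4 * n)%:R :> R by rewrite ltr0n muln_gt0.
(* Makes the diameter [4 n / (N + 1)] of the grid ball less than [eps]. *)
have [N _ /(_ N (leqnn N)) /= HN] := near_infty_natSinv_lt (PosNum (divr_gt0 e0 N0)).
have [v hv] := gridpt_approx zeta N; exists (v, N).
have n1 : 1 <= n%:R :> R by rewrite ler1n.
set d := N.+1%:R^-1 in HN hv.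
have d0 : 0 < d by rewrite invr_gt0.
have zin : grid_ball (v, N) zeta.
  rewrite /grid_ball /eball /=; apply: (@le_lt_trans _ _ (\sum_(j < n) 2 * d ^+ 2)).
    apply: ler_sum => j _; have [h1 h2] := hv j; rewrite /cabs2 mulr_natl mulr2n.
    apply: lerD; rewrite -[X in X <= _](real_normK (num_real _)) ler_sqr ?nnegrE ?(ltW d0)//; exact: ltW.
  rewrite (_ : (2 * n)%:R / N.+1%:R = 2 * n%:R * d); last by rewrite natrM.
  rewrite sumr_const card_ord -[X in X < _]mulr_natl exprMn.
  have y0 : 0 < d ^+ 2 by rewrite exprn_gt0.
  move: (d ^+ 2) (n%:R : R) n1 y0 => y k k1 y0.
  rewrite mulrA ltr_pM2r// exprMn; nra.
split => // z zv; rewrite /eball /=.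
have rE : (2 * n)%:R * d * 2 <= eps.
  rewrite mulrAC -natrM -mulnA [(n * 2)%N]mulnC mulnA -ler_pdivlMl// mulrC.
  by rewrite mulrC; apply: ltW; rewrite [ltRHS]mulrC.
apply: (@lt_le_trans _ _ (4 * ((2 * n)%:R * d) ^+ 2)); last first.
  rewrite (_ : 4 * _ = ((2 * n)%:R * d * 2) ^+ 2); last by ring.
  by rewrite ler_sqr ?nnegrE ?mulr_ge0 ?(ltW d0) ?(ltW e0).
move: zv zin; rewrite /grid_ball /eball /= -/d => zv zin.
apply: (@le_lt_trans _ _ (\sum_(j < n) (2 * cabs2 (z 0 j - gridpt R v N 0 j) +
    2 * cabs2 (zeta 0 j - gridpt R v N 0 j)))).
  apply: ler_sum => j _.
  have := cabs2D_le (z 0 j - gridpt R v N 0 j) (gridpt R v N 0 j - zeta 0 j).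
  rewrite addrA subrK => /le_trans; apply; rewrite lerD2l.
  by case: (zeta 0 j) => x y; case: (gridpt R v N 0 j) => s t; rewrite /cabs2 /=; nra.
rewrite big_split -!mulr_sumr /=; lra.
Qed.

Definition is_test (vN : grid) : Prop := exists2 w : Cn, bdry Omega w & grid_ball vN w.
Definition test_set (vN : grid) : set Cn := grid_ball vN `&` Omega.

Lemma copen_test_set vN : copen (test_set vN).
Proof. by apply: copenI; [exact: copen_eball|exact: copen_ellipsoid]. Qed.

Lemma eball_sub_copen (D : set Cn) (w : Cn) : copen D -> D w ->
  exists2 d : R, 0 < d & eball w d `<=` D.
Proof.
move=> oD /oD [e e0 eD]; exists e => // z zw; apply: eD => j.
rewrite -(@ltr_sqr _ (cabs _) e) ?nnegrE ?cabs_ge0 ?(ltW e0)// sqr_cabs.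
apply: le_lt_trans zw; rewrite (bigD1 j)//= lerDl.
by apply: sumr_ge0 => i _; exact: cabs2_ge0.
Qed.

(** Membership in [OL q] passes to smaller open sets. Around a boundary point of a grid ball fits a
    small ball, and around the centre of a ball fits a grid ball containing that centre. *)
Lemma tests_suffice (q : \bar R) (g : Cn -> C^o) :
  (forall zeta eps, bdry Omega zeta -> 0 < eps -> ~ OL q (eball zeta eps `&` Omega) g) <->
  (forall vN, is_test vN -> ~ OL q (test_set vN) g).
Proof.
have oO : copen Omega by exact: copen_ellipsoid.
split=> [h vN [w bw gw] gOL|h zeta eps bz e0 gOL].
  have og : copen (grid_ball vN) by exact: copen_eball.
  have [d d0 dw] := eball_sub_copen og gw.
  apply: (h w d bw d0); apply: OL_sub gOL.
  - by apply: copenI => //; exact: copen_eball.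
  - exact: copen_test_set.
  - by move=> z [/dw ? ?].
have [vN [gz gsub]] := grid_ball_sub_eball zeta e0.
apply: (h vN); first by exists zeta.
apply: OL_sub gOL.
- exact: copen_test_set.
- by apply: copenI => //; exact: copen_eball.
- by move=> z [/gsub ? ?].
Qed.

Lemma OL_of_bounded (q : \bar R) (D : set Cn) (M : R) (g : Cn -> C^o) : (1 < q)%E ->
  copen D -> D `<=` Omega -> holomorphic_on D g -> (forall z, D z -> cabs (g z) <= M) ->
  OL q D g.
Proof.
move=> q1 oD DO hg hM; split => //; case: q q1 => [q||] q1 //; last by exists M.
have q0 : 0 <= q by rewrite lte_fin in q1; exact: (le_trans ler01 (ltW q1)).
have oO : copen Omega by exact: copen_ellipsoid.
have m1 := jmeasurable_indic1 oO.
have i0 z : (0 <= (\1_Omega z)%:E :> \bar R)%E by rewrite lee_fin.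
apply: (@le_lt_trans _ _ ((`|M| `^ q)%:E * omega_vol a)%E).
  rewrite /omega_vol -(volintZ (powR_ge0 _ _) m1 i0).
  apply: (le_volint (jmeasurable_Lpfun q oD hg) (jmeasurableZ _ m1) (Lpfun_ge0 _ _ _)) => z.
  rewrite /Lpfun -EFinM lee_fin !indicE; case: (boolP (z \in D)) => Dz; last first.
    by rewrite mul0r mulr_ge0 ?powR_ge0.
  rewrite mem_set ?mul1r ?mulr1; last exact/DO/set_mem.
  apply: ge0_ler_powR; rewrite ?nnegrE ?cabs_ge0//.
  exact: le_trans (hM _ (set_mem Dz)) (ler_norm _).
have o1 := omega_vol_fin a0.
have o0 : (0 <= omega_vol a)%E by exact: volint_ge0.
by move: (omega_vol a) o1 o0 => [x||] // _ _; rewrite -EFinM ltry.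
Qed.

Lemma segment_continuous (x y : Cn) :
  continuous ((fun t : R => (1 - t)%:C%C *: x + t%:C%C *: y) : R -> (Cn : normedModType C)).
Proof.
move=> t A /nbhs_CnP [e e0 eA].
pose K := \sum_(j < n) cabs (y 0 j - x 0 j).
have K0 : 0 <= K by apply: sumr_ge0 => j _; exact: cabs_ge0.
have K1 : 0 < K + 1 by rewrite ltr_wpDl.
apply/nbhs_ballP; exists (e / (K + 1)); first by rewrite /= divr_gt0.
move=> s; rewrite -ball_normE /ball_ /= => ts; apply: eA => j.
have -> : ((1 - s)%:C%C *: x + s%:C%C *: y) 0 j - ((1 - t)%:C%C *: x + t%:C%C *: y) 0 j =
    (s - t)%:C%C * (y 0 j - x 0 j).
  by rewrite !mxE !rmorphB rmorph1; ring.
have cr : cabs ((s - t)%:C%C) = `|t - s|.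
  by rewrite /cabs /cabs2 /= expr0n addr0 sqrtr_sqr distrC.
rewrite cabsM cr; apply: (@le_lt_trans _ _ (`|t - s| * (K + 1))); last by rewrite -ltr_pdivlMr.
rewrite ler_wpM2l// (@le_trans _ _ K)// ?lerDl// /K (bigD1 j)//= lerDl.
by apply: sumr_ge0 => i _; exact: cabs_ge0.
Qed.

(** The intersection is convex and a segment is connected, so there is only one component. *)
Lemma connected_component_eball (c : Cn) (r : R) (x z : Cn) :
  (eball c r `&` Omega) x -> (eball c r `&` Omega) z ->
  @connected_component (Cn : normedModType C) (eball c r `&` Omega) x z.
Proof.
move=> Ex Ez.
pose f := (fun t : R => (1 - t)%:C%C *: x + t%:C%C *: z) : R -> (Cn : normedModType C).
exists [set f t | t in `[0, 1]%classic]; last first.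
  by exists 1; [rewrite /= in_itv /= ler01 lexx|rewrite /f subrr scale0r add0r scale1r].
split.
- by exists 0; [rewrite /= in_itv /= ler01 lexx|rewrite /f subr0 scale0r addr0 scale1r].
- move=> _ /= [t t01 <-]; apply: convex_eball_ellipsoid => //.
- apply: connected_continuous_connected; first exact: segment_connected.
  by apply: continuous_subspaceT => t; exact: segment_continuous.
Qed.

Lemma totally_unbounded_of_tests (q : \bar R) (g : Cn -> C^o) : (1 < q)%E ->
  holomorphic_on Omega g ->
  (forall zeta eps, bdry Omega zeta -> 0 < eps -> ~ OL q (eball zeta eps `&` Omega) g) ->
  totally_unbounded Omega g.
Proof.
move=> q1 hg h w d bw d0 x Ex M; apply: contrapT => /forallNP nz.
apply: (h w d bw d0); apply: (@OL_of_bounded q _ M) => //.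
- by apply: copenI; [exact: copen_eball|exact: copen_ellipsoid].
- by move=> z [_]; exact: hg.
- move=> z Ez; rewrite leNgt; apply/negP => Mz; apply: (nz z); split => //.
  exact: connected_component_eball.
Qed.

End Boundary_tests.

(** * Density and the G-delta property *)

Section Truncations.
Variable R : realType.

Definition trunc_pow (q K t : R) : R := Num.min t K `^ q.
(* Bounded Lipschitz profiles: [D] carries a point with [cabs (f z) > M] if and only if
   the integral of [excess M (cabs (f z))] over [D] is positive. *)
Definition excess (M t : R) : R := Num.min (Num.max (t - M) 0) 1.

Lemma measurable_trunc_pow (q K : R) : measurable_fun [set: R] (trunc_pow q K).
Proof.
apply: (measurableT_comp (measurable_powR q)).
by apply: measurable_funrM || apply: measurable_minr.
Qed.

Lemma measurable_excess (M : R) : measurable_fun [set: R] (excess M).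
Proof.
apply: measurable_minr => //; apply: measurable_maxr => //.
exact: measurable_funB.
Qed.

Lemma trunc_pow_bound (q K x : R) : 0 <= q -> 0 <= K -> 0 <= x ->
  0 <= trunc_pow q K x <= K `^ q.
Proof.
move=> q0 K0 x0; rewrite powR_ge0/=; apply: ge0_ler_powR; rewrite ?nnegrE ?le_min ?x0//.
by rewrite ge_min lexx orbT.
Qed.

Lemma excess_bound (M x : R) : 0 <= excess M x <= 1.
Proof. by rewrite /excess le_min le_max lexx orbT ler01 ge_min lexx orbT. Qed.

Lemma excess_lipschitz (M x y : R) : excess M x <= excess M y + 1 * `|x - y|.
Proof.
rewrite mul1r /excess; have := ler_norm (x - y); have := normr_ge0 (x - y).
move: (`|_|) => u u0 xy; rewrite /Order.min /Order.max.
by case: ifPn; case: ifPn; case: ifPn; case: ifPn; rewrite -?leNgt; lra.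
Qed.

(** Derivative-free: with [r = y / x <= 1] and an integer [k >= q], Bernoulli gives
    [r ^ q >= r ^ k >= 1 - k (1 - r)]; multiply by [x ^ q]. *)
Lemma powR_lipschitz (q K x y : R) (k : nat) : 1 <= q -> q <= k%:R ->
  0 <= y -> y <= x -> x <= K -> x `^ q <= y `^ q + k%:R * K `^ (q - 1) * (x - y).
Proof.
move=> q1 qk y0 yx xK; have x0 := le_trans y0 yx.
have [xe|xn0] := eqVneq x 0.
  have ye : y = 0 by apply/eqP; rewrite eq_le y0 andbT -xe.
  by rewrite xe ye subrr mulr0 addr0.
have xp : 0 < x by rewrite lt_neqAle eq_sym xn0.
pose r := y / x; have r0 : 0 <= r by rewrite divr_ge0.
have r1 : r <= 1 by rewrite ler_pdivrMr ?mul1r.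
have yE : y = r * x by rewrite /r divfK.
have rq : 1 - k%:R * (1 - r) <= r `^ q.
  apply: (@le_trans _ _ (r ^+ k)).
    have := @bernoulli _ (1 - r) k; rewrite subKr; apply.
    by rewrite subr_ge0 r1 gerBl.
  rewrite -powR_mulrn//; have [->|rn0] := eqVneq r 0.
    rewrite !powR0 ?gt_eqF//; first exact: lt_le_trans ltr01 q1.
    exact: lt_le_trans ltr01 (le_trans q1 qk).
  by rewrite ger_powR// lt_neqAle eq_sym rn0 r0.
have xq : x `^ q = x * x `^ (q - 1).
  have := @powRD R x 1 (q - 1); rewrite (gt_eqF xp) implybT => /(_ isT).
  by rewrite powRr1// addrC subrK.
rewrite yE (powRM _ r0 x0).
have h : x `^ (q - 1) <= K `^ (q - 1).
  by apply: ge0_ler_powR; rewrite ?nnegrE ?subr_ge0// (le_trans x0).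
apply: (@le_trans _ _ (r `^ q * x `^ q + k%:R * x `^ (q - 1) * (x - r * x))).
  rewrite (_ : k%:R * x `^ (q - 1) * (x - r * x) = k%:R * (1 - r) * x `^ q); last by rewrite xq; ring.
  by rewrite -mulrDl -[leLHS]mul1r ler_wpM2r ?powR_ge0//; lra.
rewrite lerD2l ler_wpM2r ?ler_wpM2l//.
by rewrite -[X in _ - X]yE subr_ge0.
Qed.

Lemma trunc_pow_lipschitz (q K : R) : 1 <= q -> 0 <= K -> exists2 L : R, 0 <= L &
  forall x y, 0 <= x -> 0 <= y -> trunc_pow q K x <= trunc_pow q K y + L * `|x - y|.
Proof.
move=> q1 K0; pose k := (Num.truncn q).+1; have qk : q <= k%:R by rewrite ltW// truncnS_gt.
have L0 : 0 <= k%:R * K `^ (q - 1) by rewrite mulr_ge0 ?powR_ge0.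
exists (k%:R * K `^ (q - 1)) => // x y x0 y0; rewrite /trunc_pow.
set x' := Num.min x K; set y' := Num.min y K.
have x'0 : 0 <= x' by rewrite le_min x0.
have y'0 : 0 <= y' by rewrite le_min y0.
have [xy|yx] := leP x' y'.
  apply: (@le_trans _ _ (y' `^ q)); last by rewrite lerDl mulr_ge0.
  by apply: ge0_ler_powR; rewrite ?nnegrE// (le_trans ler01).
have x'K : x' <= K by rewrite ge_min lexx orbT.
apply: (le_trans (powR_lipschitz q1 qk y'0 (ltW yx) x'K)); rewrite lerD2l ler_wpM2l//.
have := ler_norm (x - y); move: (`|_|) => u; move: yx.
by rewrite /x' /y' /Order.min; case: ifPn; case: ifPn; rewrite -?leNgt; lra.
Qed.

End Truncations.

Lemma rel_open_bigcup (T : Type) (R : realType) (d : T -> T -> R) (X : set T) (I : Type)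
  (U : I -> set T) : (forall i, rel_open d X (U i)) -> rel_open d X (\bigcup_i U i).
Proof.
move=> h; split; first by move=> f [i _]; exact: (h i).1.
move=> f [i _ Uf]; have [e e0 he] := (h i).2 f Uf.
by exists e => // g Xg dg; exists i => //; exact: he.
Qed.

(** A countable set has Lebesgue measure 0, while the interval has measure [c]. *)
Lemma uncountable_itv (R : realType) (B : set R) (c : R) : countable B -> 0 < c ->
  exists2 x, 0 < x < c & ~ B x.
Proof.
move=> cB c0; apply: contrapT => h.
have sub : `]0, c[%classic `<=` B.
  move=> x; rewrite /= in_itv /= => xc; apply: contrapT => nBx; apply: h; by exists x.
have := countable_lebesgue_measure0 (sub_countable (subset_card_le sub) cB).
rewrite lebesgue_measure_itv /= lte_fin c0 -EFinB subr0 => -[] /eqP.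
by rewrite gt_eqF.
Qed.

Section Main.
Variables (R : realType) (n : nat).
Local Notation C := (R[i]).
Local Notation Cn := 'rV[C]_n.
Local Notation grid := ('rV[(int * int)%type]_n * nat)%type.
Hypothesis n0 : (0 < n)%N.
Variable a : 'I_n -> R.
Hypothesis a0 : forall j, 0 < a j.
Local Notation Omega := (ellipsoid a).
Variables (q : \bar R) (pj : nat -> R).
Hypothesis q1 : (1 < q)%E.
Hypothesis p0 : 1 < pj 0.
Hypothesis pS : forall j, pj j < pj j.+1.
Hypothesis pq : ((fun j => (pj j)%:E) @ \oo --> q).

Lemma rvol_cvg_Lp_int (D : set Cn) (r : R) (f : Cn -> C^o) : 0 <= r -> copen D ->
  holomorphic_on D f -> Lp_int D r f = +oo%E ->
  forall M : R, exists K : nat, (M%:E < rvol D (trunc_pow r K%:R) f)%E.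
Proof.
move=> r0 oD hf foo M.
pose G (K : nat) (z : Cn) : \bar R := (\1_D z * trunc_pow r K%:R (cabs (f z)))%:E.
have mG K : jmeasurable (G K).
  apply: (jmeasurable_indic_comp oD (holomorphic_ccontinuous hf)).
  exact: measurable_trunc_pow.
have G0 K z : (0 <= G K z)%E by rewrite lee_fin mulr_ge0 ?powR_ge0.
have nd z : {homo G ^~ z : i j / (i <= j)%N >-> (i <= j)%E}.
  move=> i j ij; rewrite lee_fin ler_wpM2l//; apply: ge0_ler_powR => //;
    rewrite ?nnegrE ?le_min ?cabs_ge0 ?ge_min ?lexx//=.
  by rewrite ler_nat ij orbT.
have limE : (fun z => limn (G ^~ z)) = Lpfun D r f.
  apply/funext => z; apply/cvg_lim => //; apply: cvg_near_cst.
  exists (Num.truncn (cabs (f z))).+1 => // K /= hK; rewrite /G /Lpfun /trunc_pow.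
  by rewrite min_l// (le_trans (ltW (truncnS_gt _)))// ler_nat.
have lim : limn (fun K => rvol D (trunc_pow r K%:R) f) = +oo%E.
  by rewrite -foo -[RHS]/(volint (Lpfun D r f)) -limE /volint iter_int_monotone.
have ndV : {homo (fun K : nat => rvol D (trunc_pow r K%:R) f) : i j / (i <= j)%N >-> (i <= j)%E}.
  by move=> i j ij; apply: (le_volint (mG i) (mG j) (G0 i)) => z; exact: nd.
(* Passing from the limit to a term yields only a weak inequality; the added 1 restores the strict
   one. *)
have h : ((M + 1)%:E < limn (fun K => rvol D (trunc_pow r K%:R) f))%E by rewrite lim ltry.
have [K _ /(_ K (leqnn K)) /= hK] := lte_lim ndV (ereal_nondecreasing_is_cvgn ndV) h.
by exists K; apply: lt_le_trans hK; rewrite lte_fin ltrDl.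
Qed.

Lemma not_OL_Gdelta (D : set Cn) : copen D -> D `<=` Omega ->
  exists U : nat -> set (Cn -> C^o),
    (forall M, rel_open (dist Omega pj) (OLcap q Omega) (U M)) /\
    (forall f, OLcap q Omega f -> (forall M, U M f) <-> ~ OL q D f).
Proof.
move=> oD DO; have holD f : OLcap q Omega f -> holomorphic_on D f.
  by move=> /(OLcapP a0 p0 pS pq) [hf _] z /DO; exact: hf.
have q1' := q1; move: (q) q1' holD (rel_open_rvol a0 p0 pS pq) => [r||] r1 holD openP //.
- have {}r1 : 1 < r by rewrite -lte_fin.
  have r0 : 0 <= r := le_trans ler01 (ltW r1).
  (* By monotone convergence, the integral of [|f| ^ r] is infinite iff every level [M] is exceeded
     by the integral of some truncation; unions of open sets are open. *)
  exists (fun M => \bigcup_(K : nat) [set f | OLcap r%:E Omega f /\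
     ((M%:R : R)%:E < rvol D (trunc_pow r K%:R) f)%E]); split.
    move=> M; apply: rel_open_bigcup => K.
    have [L L0 hL] := @trunc_pow_lipschitz _ r K%:R (ltW r1) (ler0n _ _).
    apply: openP hL => //; first exact: measurable_trunc_pow.
    by move=> x x0; exact: trunc_pow_bound.
  move=> f Xf; have hf := holD f Xf; split.
    move=> h [_ ff]; set x := Lp_int D r f in ff.
    have x0 : (0 <= x)%E by exact: Lp_int_ge0.
    have xE : x = (fine x)%:E by rewrite fineK// ge0_fin_numE.
    have [K _ [_]] := h (Num.truncn (fine x)).+1; rewrite ltNge => /negP; apply.
    apply: (@le_trans _ _ x); last by rewrite xE lee_fin ltW// truncnS_gt.
    have hc := holomorphic_ccontinuous hf.
    apply: (le_volint (jmeasurable_indic_comp oD hc (measurable_trunc_pow r K%:R))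
      (jmeasurable_Lpfun r oD hf)).
      by move=> z; rewrite lee_fin mulr_ge0 ?powR_ge0.
    move=> z; rewrite lee_fin ler_wpM2l//; apply: ge0_ler_powR => //.
    - by rewrite nnegrE le_min cabs_ge0 ler0n.
    - by rewrite nnegrE cabs_ge0.
    - by rewrite ge_min lexx.
  move=> nOL M; have foo : Lp_int D r f = +oo%E.
    apply: contrapT => /eqP foo; apply: nOL; split => //.
    by rewrite ltey.
  by have [K hK] := rvol_cvg_Lp_int r0 oD hf foo M%:R; exists K.
- exists (fun M => [set f | OLcap +oo%E Omega f /\ (0%:E < rvol D (excess M%:R) f)%E]); split.
    move=> M; apply: (openP D _ 1 1) => //.
    + exact: measurable_excess.
    + by move=> x _; exact: excess_bound.
    + by move=> x y _ _; exact: excess_lipschitz.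
  move=> f Xf; have hf := holD f Xf; have hc := holomorphic_ccontinuous hf.
  have m M := jmeasurable_indic_comp oD hc (@measurable_excess R M).
  have e0 M z : (0 <= (\1_D z * excess M (cabs (f z)))%:E)%E.
    by rewrite lee_fin mulr_ge0//; have /andP[] := excess_bound M (cabs (f z)).
  split.
    move=> h [_ [B hB]]; have [_] := h (Num.truncn B).+1; rewrite lt_neqAle => /andP[/eqP + _].
    apply; apply/esym/volint0 => z; rewrite indicE; case: (boolP (z \in D)) => Dz; last by rewrite mul0r.
    rewrite mul1r /excess max_r ?min_l// subr_le0.
    by rewrite (le_trans (hB _ (set_mem Dz)))// ltW// truncnS_gt.
  move=> nOL M; split => //; apply: contrapT => hle; apply: nOL; split => //.
  exists (M%:R + 1) => z Dz; rewrite leNgt; apply/negP => Mz; apply: hle.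
  have [e e0' he] := copen_superlevel oD hc (conj Dz Mz).
  apply: (volint_gt0 (m M%:R) (e0 M%:R) ltr01 e0') => v /he [Dv Mv].
  rewrite lee_fin indicE mem_set// mul1r /excess le_min lexx andbT le_max.
  by apply/orP; left; rewrite lerBrDl ltW.
Qed.

Definition singular : set (Cn -> C^o) := [set g | OLcap q Omega g /\
  forall vN : grid, is_test a vN -> ~ OL q (test_set a vN) g].

Lemma singular_Gdelta : Gdelta_in (dist Omega pj) (OLcap q Omega) singular.
Proof.
have XX : rel_open (dist Omega pj) (OLcap q Omega) (OLcap q Omega).
  by split => // f Xf; exists 1.
have H (vN : grid) : exists U : nat -> set (Cn -> C^o),
    (forall M, rel_open (dist Omega pj) (OLcap q Omega) (U M)) /\
    (forall f, OLcap q Omega f -> (forall M, U M f) <-> (is_test a vN -> ~ OL q (test_set a vN) f)).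
  have [tvN|ntvN] := pselect (is_test a vN).
    have [|U [oU hU]] := @not_OL_Gdelta (test_set a vN) (@copen_test_set _ _ a vN).
      by move=> z [].
    exists U; split => // f Xf; split; first by move=> /hU h _; exact: h.
    by move=> h; apply/hU => //; exact: h.
  (* A grid ball without boundary point imposes no condition, so the whole space is taken. *)
  by exists (fun=> OLcap q Omega); split => // f Xf; split.
have [U hU] := choice H.
exists (fun k => if unpickle k is Some (vN, M) then U vN M else OLcap q Omega); split.
  by move=> k; case: unpickle => [[vN M]|//]; exact: (hU vN).1.
apply/seteqP; split => f.
  move=> [Xf hf] k _; case: unpickle => [[vN M]|//].
  by apply: ((hU vN).2 f Xf).2 => //; exact: hf.
move=> h; have hvN vN M : U vN M f.
  by have := h (pickle (vN, M)) I; rewrite pickleK.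
have Xf : OLcap q Omega f by exact: ((hU (0, 0%N)).1 0).1 _ (hvN _ _).
by split => // vN; apply: ((hU vN).2 f Xf).1 => M; exact: hvN.
Qed.

(* For each test set, [f + c h] is good for all values of [c] but at most one. *)
Lemma singular_dense : dense_in (dist Omega pj) (OLcap q Omega) singular.
Proof.
split; first by move=> f [].
(* A boundary point on the first axis, which exists since [n > 0]; it fills the indices that code no
   test. *)
pose w0 : Cn := \row_j (if (j : nat) == 0%N then (a j)%:C%C else 0).
have w01 : qform (wgt a) w0 = 1.
  rewrite /qform (bigD1 (Ordinal n0))//= big1 ?addr0.
    by rewrite mxE eqxx /cabs2 /= expr0n addr0 /wgt divff// expf_neq0// gt_eqF.
  move=> j jn; rewrite mxE ifN; last by apply: contra jn => /eqP j0; apply/eqP/val_inj.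
  by rewrite /cabs2 /= expr0n addr0 mul0r.
have H (k : nat) : exists wd : Cn * R, [/\ qform (wgt a) wd.1 = 1, 0 < wd.2 &
    forall vN : grid, unpickle k = Some vN -> is_test a vN -> eball wd.1 wd.2 `<=` grid_ball vN].
  case uk : (unpickle k : option grid) => [vN|]; last by exists (w0, 1).
  have [[w bw gw]|ntvN] := pselect (is_test a vN).
    have og : copen (grid_ball vN : set Cn) by exact: copen_eball.
    have [d d0 dw] := eball_sub_copen og gw.
    by exists (w, d); split => //=; [exact: (bdry_ellipsoid bw)|move=> _ [<-]].
  by exists (w0, 1); split => // _ [<-].
have [wd hwd] := choice H.
have [h [hh hp hOL]] := @exists_nowhere_OL _ _ a a0 q pj (fun k => (wd k).1) (fun k => (wd k).2) q1
  (fun j => ltW (pj_gt1 p0 pS j)) (pj_lt pS pq) (pj_homo pS)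
  (fun k => let: And3 x _ _ := hwd k in x) (fun k => let: And3 _ x _ := hwd k in x).
have Xh : OLcap q Omega h by apply: (OLcapP a0 p0 pS pq h).2.
have nh (vN : grid) : is_test a vN -> ~ OL q (test_set a vN) h.
  move=> tvN hOLv; apply: (hOL (pickle vN)).
  have [_ _ /(_ vN (pickleK vN) tvN) sub] := hwd (pickle vN).
  apply: OL_sub hOLv; [|exact: copen_test_set|by move=> z [/sub ? ?]].
  by apply: copenI; [exact: copen_eball|exact: copen_ellipsoid].
move=> f Xf e e0.
have [c0 c00 hc0] := dist_perturb_small p0 pS f e0 hh.
pose B (vN : grid) : set R := [set c | is_test a vN /\ OL q (test_set a vN) (fun z => f z + c%:C%C * h z)].
have cB : countable (\bigcup_vN B vN).
  apply: bigcup_countable => // vN _.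
  have [[c Bc]|nB] := pselect (exists c, B vN c); last first.
    by rewrite (_ : B vN = set0)//; apply/seteqP; split => // c Bc; case: nB; exists c.
  rewrite (_ : B vN = [set c])//; apply/seteqP; split; last by move=> _ ->.
  move=> c' [tvN OL'] /=; apply: contrapT => cc'; apply: (nh vN tvN).
  have oT := @copen_test_set _ _ a vN.
  have dn0 : (c' - c)%:C%C != 0 :> C.
    by rewrite eq_complex /= eqxx andbT subr_eq0; apply/eqP.
  have F := OL_comb (-1) oT q1 OL' Bc.2.
  (* [F] concerns the difference [(c' - c) h]. Adding [(1 / (c' - c) - 1)] times this function to
     itself rescales it to [h], contradicting [nh]. *)
  have := OL_comb (((c' - c)%:C%C)^-1 - 1) oT q1 F F; congr (OL _ _ _).
  apply/funext => z; rewrite mulN1r opprD addrACA subrr add0r -mulrBl -rmorphB /=.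
  by rewrite -{1}[_ * h z]mul1r -mulrDl addrC subrK mulKf.
have [c cc nBc] := uncountable_itv cB c00.
exists (fun z => f z + c%:C%C * h z); split; last exact: hc0.
split; first exact: (OLcap_comb a0 p0 pS pq c%:C%C Xf Xh).
by move=> vN tvN hOLv; apply: nBc; exists vN.
Qed.

End Main.

Theorem theorem12 (R : realType) (n : nat) (q : \bar R) (a : 'I_n -> R)
    (pj : nat -> R) :
  (0 < n)%N -> (1%:E < q)%E -> (forall j, 0 < a j) ->
  1 < pj 0%N -> (forall j, pj j < pj j.+1) ->
  ((fun j => (pj j)%:E) @ \oo --> q) ->
  let Omega := ellipsoid a in
  let X := OLcap q Omega in
  let S := [set g | X g /\ totally_unbounded Omega g /\
             (forall (zeta : 'rV[R[i]]_n) (eps : R),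
                bdry Omega zeta -> 0 < eps ->
                ~ OL q (eball zeta eps `&` Omega) g)] in
  dense_in (dist Omega pj) X S /\ Gdelta_in (dist Omega pj) X S.
Proof.
move=> n0 q1 a0 p0 pS pq Omega X S.
have -> : S = singular a q.
  apply/seteqP; split => g.
    by move=> [Xg [_ hg]]; split => //; apply/(tests_suffice n0 a q g).
  move=> [Xg hg]; split => //.
  have hg' := (tests_suffice n0 a q g).2 hg; split => //.
  by apply: (totally_unbounded_of_tests a0 q1 _ hg'); have [] := (OLcapP a0 p0 pS pq g).1 Xg.
by split; [exact: singular_dense|exact: singular_Gdelta].
Qed.
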